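(* The number $\frac13$ is an accumulation point of the set $\{\pi_{\mathrm u}(\mathcal F) : \mathcal F\text{ a finite family of finite }3\text{-uniform hypergraphs}\}$ of uniform Turán densities of finite forbidden families.
   Context: A $3$-graph is a $3$-uniform hypergraph. For $d\in[0,1]$ and $\eta>0$, an $n$-vertex $3$-graph $G$ is $(d,\eta)$-uniformly dense if every $U\subseteq V(G)$ with $|U|\ge\eta n$ satisfies $e_G(U)\ge d\binom{|U|}{3}$, where $e_G(U)$ is the number of edges of $G$ contained in $U$. For a family $\mathcal F$ of finite $3$-graphs, $G$ is $\mathcal F$-free if it contains no member of $\mathcal F$ as a (not necessarily induced) subhypergraph, and the uniform Turán density $\pi_{\mathrm u}(\mathcal F)$ is the supremum of all $d\in[0,1]$ such that for every $\eta>0$ and every $n_0$ there is an $\mathcal F$-free $(d,\eta)$-uniformly dense $3$-graph on some $n\ge n_0$ vertices. *)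

(* Defs.v *)
From mathcomp Require Import all_boot all_order all_algebra.
From mathcomp Require Import all_classical all_reals all_analysis.

Set Implicit Arguments.
Unset Strict Implicit.
Unset Printing Implicit Defensive.

Import Order.TTheory GRing.Theory Num.Theory.

Local Open Scope classical_set_scope.
Local Open Scope ring_scope.

(* Vertex sets are taken to be 'I_n. All notions below are invariant under
   isomorphism, so this loses no generality. *)
Record three_graph := ThreeGraph {
  nverts : nat;
  edges : {set {set 'I_nverts}};
  edges_card : [forall e in edges, #|e| == 3%N]
}.

Definition edges_in (G : three_graph) (U : {set 'I_(nverts G)}) : nat :=
  #|[set e in edges G | e \subset U]|.

Definition uniformly_dense (R : realType) (d eta : R) (G : three_graph) : Prop :=
  forall U : {set 'I_(nverts G)},
    eta * (nverts G)%:R <= #|U|%:R ->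
    d * 'C(#|U|, 3)%:R <= (edges_in U)%:R.

Definition contains (G H : three_graph) : Prop :=
  exists2 f : 'I_(nverts H) -> 'I_(nverts G), injective f &
    forall e : {set 'I_(nverts H)}, e \in edges H -> f @: e \in edges G.

Definition family_free (F : set three_graph) (G : three_graph) : Prop :=
  forall H, F H -> ~ contains G H.

(* The set below is bounded by 1. It is empty only when F contains a 3-graph
   without edges; then the supremum is 0, since sup set0 = 0. *)
Definition uniform_turan_density (R : realType) (F : set three_graph) : R :=
  sup [set d : R | 0 <= d <= 1 /\
    forall (eta : R) (n0 : nat), 0 < eta ->
      exists G : three_graph,
        [/\ (n0 <= nverts G)%N, family_free F G & uniformly_dense d eta G]].

(* Main.v *)
(* Accumulation from below. Fix k ordered colours and call a 3-graph admissible if its pairs can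
   be coloured and oriented so that every edge {b, a, c} has a source b and the base pair ac has a
   strictly smaller colour than both ba and bc. Forbid all inadmissible 3-graphs on at most N
   vertices.

   Lower bound: orient by a linear order and colour pairs quasirandomly with k equally likely
   colours; all large sets then have density about sum_s w_s (w_{s+1} + ... + w_k)^2, which is at
   least (1 - 8/k)/3 since w_s <= 2/k. A quasirandom colouring comes from the labels
   a u + c + v of the pairs (a, c), (u, v) of points of a finite field plane.

   Upper bound: in a dense 3-graph, passing to sparser and sparser boxes yields many disjoint sets
   whose triples are all regular, and a bounded random sample of points preserves this regularity
   (it is detected by a polynomial functional). The sample is admissible, so it carries a colouring
   and an orientation; regularising these too and applying Ramsey's theorem makes the colour
   densities q_s of all pairs of parts equal, and triangle counting bounds the density of some
   triple of parts by sum_s q_s (q_{s+1} + ... + q_k)^2 <= (1 - sum_s q_s^3)/3 <= (1 - 1/k^2)/3.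
   Averaging over the parts transfers this bound to the original 3-graph. *)
Require Import Defs.
From mathcomp Require Import all_boot all_order all_algebra.
From mathcomp Require Import all_classical all_reals all_analysis.
From mathcomp Require Import ring lra zify.
From mathcomp Require Import fintype finset.

Set Implicit Arguments.
Unset Strict Implicit.
Unset Printing Implicit Defensive.

Import Order.TTheory GRing.Theory Num.Theory.
Import numFieldNormedType.Exports.

Local Open Scope ring_scope.

(** * Regular boxes *)

(** A finite family can only control bounded pieces: a free 3-graph is known to be admissible on
    sets of at most [N] vertices, with [N] fixed before the 3-graph. The colouring and orientation
    thus exist on a bounded sample only, and different samples need not carry compatible ones. This
    forces the order of the argument: the 3-graph is regularised first, without reference to
    colours, and its regularity must survive both the sampling and a second regularisation, that of
    the colouring on the sample. The boxes of that second step have relative mass at least some [c]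
    depending only on [k] and the wanted precision, so the sampling error can be made a small
    multiple of [c ^+ 3] afterwards. Sampled points may coincide, hence weights instead of sets
    throughout.

    No regular partition is wanted: one system of regular boxes suffices, which a simple density
    decrement provides.

    The densities of the families are never computed. It is enough to enclose each of them in an
    interval strictly below 1/3 whose ends tend to 1/3 as [k] grows. *)

Definition mass (R : archiRealFieldType) (V : finType) (u : V -> R) (A : {set V}) : R :=
  \sum_(x in A) u x.

Definition box3 (R : archiRealFieldType) (V : finType) (u v w : V -> R)
    (f : V -> V -> V -> R) (X Y Z : {set V}) : R :=
  \sum_(x in X) \sum_(y in Y) \sum_(z in Z) u x * v y * w z * f x y z.

Definition regular3 (R : archiRealFieldType) (V : finType) (e P : R) (u v w : V -> R)
    (f : V -> V -> V -> R) (A B C : {set V}) : Prop :=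
  forall X Y Z : {set V}, X \subset A -> Y \subset B -> Z \subset C ->
    `|box3 u v w f X Y Z - P * (mass u X * mass v Y * mass w Z)|
      <= e * (mass u A * mass v B * mass w C).

Section Regularity.
Context (R : archiRealFieldType).

Lemma mass_ge0 (V : finType) (u : V -> R) (A : {set V}) :
  (forall x, 0 <= u x) -> 0 <= mass u A.
Proof. by move=> u0; apply: sumr_ge0. Qed.

Lemma mass_setD (V : finType) (u : V -> R) (A X : {set V}) :
  X \subset A -> mass u A = mass u X + mass u (A :\: X).
Proof. by move=> /setIidPr XA; rewrite /mass (big_setID X) /= XA. Qed.

Lemma mass_sub (V : finType) (u : V -> R) (A X : {set V}) :
  (forall x, 0 <= u x) -> X \subset A -> mass u X <= mass u A.
Proof. by move=> u0 XA; rewrite (mass_setD u XA) lerDl mass_ge0. Qed.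

Section Weights.
Context (V : finType) (u v w : V -> R) (f : V -> V -> V -> R).
Hypotheses (u0 : forall x, 0 <= u x) (v0 : forall x, 0 <= v x) (w0 : forall x, 0 <= w x).
Hypothesis f01 : forall x y z, 0 <= f x y z <= 1.

Lemma box3_ge0 (X Y Z : {set V}) : 0 <= box3 u v w f X Y Z.
Proof.
apply: sumr_ge0 => x _; apply: sumr_ge0 => y _; apply: sumr_ge0 => z _.
by rewrite !mulr_ge0 //; case/andP: (f01 x y z).
Qed.

Lemma massM_sub (A B C X Y Z : {set V}) : X \subset A -> Y \subset B -> Z \subset C ->
  mass u X * mass v Y * mass w Z <= mass u A * mass v B * mass w C.
Proof.
move=> XA YB ZC.
by rewrite ler_pM ?mulr_ge0 ?mass_ge0 ?mass_sub // ler_pM ?mass_ge0 ?mass_sub.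
Qed.

Lemma box3_le_massM (X Y Z : {set V}) : box3 u v w f X Y Z <= mass u X * mass v Y * mass w Z.
Proof.
rewrite -mulrA /mass mulr_suml; apply: ler_sum => x _.
rewrite mulr_suml mulr_sumr; apply: ler_sum => y _.
rewrite !mulr_sumr; apply: ler_sum => z _; rewrite mulrA.
by rewrite ler_piMr ?mulr_ge0 //; case/andP: (f01 x y z).
Qed.

Lemma box3_setD1 (A Y Z X : {set V}) : X \subset A ->
  box3 u v w f A Y Z = box3 u v w f X Y Z + box3 u v w f (A :\: X) Y Z.
Proof. exact: mass_setD. Qed.

Lemma box3_setD2 (X B Z Y : {set V}) : Y \subset B ->
  box3 u v w f X B Z = box3 u v w f X Y Z + box3 u v w f X (B :\: Y) Z.
Proof.
by move=> YB; rewrite /box3 -big_split; apply: eq_bigr => x _; exact: mass_setD.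
Qed.

Lemma box3_setD3 (X Y C Z : {set V}) : Z \subset C ->
  box3 u v w f X Y C = box3 u v w f X Y Z + box3 u v w f X Y (C :\: Z).
Proof.
move=> ZC; rewrite /box3 -big_split; apply: eq_bigr => x _.
by rewrite -big_split; apply: eq_bigr => y _; exact: mass_setD.
Qed.

Lemma box3_sub (A B C X Y Z : {set V}) : X \subset A -> Y \subset B -> Z \subset C ->
  box3 u v w f X Y Z <= box3 u v w f A B C.
Proof.
move=> XA YB ZC.
rewrite (box3_setD1 _ _ XA) (box3_setD2 _ _ YB) (box3_setD3 _ _ ZC).
by rewrite -!addrA lerDl !addr_ge0 // box3_ge0.
Qed.

(* A box in which no large subbox is much sparser has no much denser subbox either:
   the complement of a subbox splits into three boxes. *)
Lemma stable_regular3 (e P : R) (A B C : {set V}) :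
    0 <= e -> 0 <= P <= 1 ->
    box3 u v w f A B C = P * (mass u A * mass v B * mass w C) ->
    (forall X Y Z : {set V}, X \subset A -> Y \subset B -> Z \subset C ->
      e * mass u A <= mass u X -> e * mass v B <= mass v Y -> e * mass w C <= mass w Z ->
      (P - e) * (mass u X * mass v Y * mass w Z) <= box3 u v w f X Y Z) ->
  regular3 (3 * e) P u v w f A B C.
Proof.
move=> e0 /andP[P0 P1] EP stab.
have mA := mass_ge0 A u0; have mB := mass_ge0 B v0; have mC := mass_ge0 C w0.
have low (X Y Z : {set V}) : X \subset A -> Y \subset B -> Z \subset C ->
    - e * (mass u A * mass v B * mass w C) <=
    box3 u v w f X Y Z - P * (mass u X * mass v Y * mass w Z).
  move=> XA YB ZC.
  have mX := mass_ge0 X u0; have mY := mass_ge0 Y v0; have mZ := mass_ge0 Z w0.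
  have lX := mass_sub u0 XA; have lY := mass_sub v0 YB; have lZ := mass_sub w0 ZC.
  have b0 := box3_ge0 X Y Z.
  have mM := massM_sub XA YB ZC.
  have mM0 : 0 <= mass u X * mass v Y * mass w Z by rewrite !mulr_ge0.
  have PM : P * (mass u X * mass v Y * mass w Z) <= mass u X * mass v Y * mass w Z.
    by rewrite ler_piMl.
  (* If one side is below its threshold, the whole expected mass [P * (...)] of the subbox fits into
     the error; otherwise stability applies. *)
  suff : (mass u X * mass v Y * mass w Z <= e * (mass u A * mass v B * mass w C)) \/
     (P - e) * (mass u X * mass v Y * mass w Z) <= box3 u v w f X Y Z.
    case; first by lra.
    move=> h; have := ler_wpM2l e0 mM; lra.
  case: (leP (e * mass u A) (mass u X)) => hX; last first.
    left; rewrite !mulrA ler_pM ?mulr_ge0 // ler_pM ?mulr_ge0 // ltW //.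
  case: (leP (e * mass v B) (mass v Y)) => hY; last first.
    left; rewrite mulrA [e * (_ * _)]mulrCA ler_pM ?mulr_ge0 // ler_pM ?mulr_ge0 // ltW //.
  case: (leP (e * mass w C) (mass w Z)) => hZ; last first.
    left; rewrite [e * (_ * _)]mulrCA ler_pM ?mulr_ge0 // ?ler_pM ?mulr_ge0 // ltW //.
  by right; apply: stab.
move=> X Y Z XA YB ZC; rewrite ler_norml; apply/andP; split.
  have := low X Y Z XA YB ZC.
  have : 0 <= e * (mass u A * mass v B * mass w C) by rewrite !mulr_ge0.
  lra.
have h1 := low _ _ _ (subsetDl A X) (subxx B) (subxx C).
have h2 := low _ _ _ XA (subsetDl B Y) (subxx C).
have h3 := low _ _ _ XA YB (subsetDl C Z).
move: EP; rewrite (box3_setD1 _ _ XA) (box3_setD2 _ _ YB) (box3_setD3 _ _ ZC).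
move: h1 h2 h3; have -> : mass u A * mass v B * mass w C =
  mass u X * mass v Y * mass w Z + mass u (A :\: X) * mass v B * mass w C
  + mass u X * mass v (B :\: Y) * mass w C + mass u X * mass v Y * mass w (C :\: Z).
  rewrite {1}(mass_setD u XA) {1}(mass_setD v YB) {1}(mass_setD w ZC).
  rewrite (mass_setD v YB) (mass_setD w ZC); ring.
lra.
Qed.

(* While the box is not regular, pass to a subbox whose density is smaller by e. *)
Lemma regular3_box_step (e : R) (N : nat) (A B C : {set V}) : 0 < e -> e <= 1 ->
    box3 u v w f A B C <= N%:R * e * (mass u A * mass v B * mass w C) ->
  exists (A' B' C' : {set V}) (P : R), [/\ [/\ A' \subset A, B' \subset B & C' \subset C],
    [/\ e ^+ N * mass u A <= mass u A', e ^+ N * mass v B <= mass v B' &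
        e ^+ N * mass w C <= mass w C'],
    0 <= P <= 1 & regular3 (3 * e) P u v w f A' B' C'].
Proof.
move=> e0 e1; elim: N A B C => [|N IH] A B C hE.
  exists A, B, C, 0; split=> //; first by rewrite expr0 !mul1r.
    by rewrite lexx ler01.
  move=> X Y Z XA YB ZC; rewrite mul0r subr0 ger0_norm ?box3_ge0 //.
  apply: le_trans (box3_sub XA YB ZC) _; apply: le_trans hE _.
  by rewrite !mul0r !mulr_ge0 ?mass_ge0 // ltW.
set M := mass u A * mass v B * mass w C in hE.
have M0 : 0 <= M by rewrite !mulr_ge0 ?mass_ge0.
(* For [M = 0] division yields [P = 0], which is consistent because the box sum vanishes as well. *)
pose P := box3 u v w f A B C / M.
have EP : box3 u v w f A B C = P * M.
  have [M0'|Mn] := eqVneq M 0; last by rewrite divfK.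
  rewrite M0' mulr0; apply/eqP; rewrite eq_le box3_ge0 andbT.
  by have := box3_le_massM A B C; rewrite -/M M0'.
have P01 : 0 <= P <= 1.
  rewrite divr_ge0 ?box3_ge0 //=.
  have [M0'|Mn] := eqVneq M 0; first by rewrite /P M0' invr0 mulr0 ler01.
  by rewrite ler_pdivrMr ?lt0r ?Mn // mul1r box3_le_massM.
pose bad (T : {set V} * {set V} * {set V}) :=
  [&& T.1.1 \subset A, T.1.2 \subset B, T.2 \subset C,
      e * mass u A <= mass u T.1.1, e * mass v B <= mass v T.1.2, e * mass w C <= mass w T.2 &
      box3 u v w f T.1.1 T.1.2 T.2 < (P - e) * (mass u T.1.1 * mass v T.1.2 * mass w T.2)].
have [|/existsPn nobad] := boolP [exists T, bad T]; last first.
  exists A, B, C, P; split=> //.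
    by split; rewrite ler_piMl ?mass_ge0 // exprn_ile1 // ltW.
  apply: stable_regular3 => //; first exact: ltW.
  move=> X Y Z XA YB ZC hX hY hZ; rewrite leNgt; apply/negP => h.
  by have := nobad (X, Y, Z); rewrite /bad /= XA YB ZC hX hY hZ h.
case/existsP => [[[X Y] Z]] /and5P[/= XA YB ZC hX /and3P[hY hZ hlt]].
have mX := mass_ge0 X u0; have mY := mass_ge0 Y v0; have mZ := mass_ge0 Z w0.
have [|X' [Y' [Z' [Q [[sX sY sZ] [lX lY lZ] Q01 reg]]]]] := IH X Y Z.
  have [M0'|Mn] := eqVneq M 0.
    have : mass u X * mass v Y * mass w Z <= 0 by rewrite -M0' /M massM_sub.
    have := box3_le_massM X Y Z.
    have h : 0 <= mass u X * mass v Y * mass w Z by rewrite !mulr_ge0.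
    move=> h1 h2; have -> : mass u X * mass v Y * mass w Z = 0 by apply/eqP; rewrite eq_le h2 h.
    rewrite mulr0; lra.
  have PN : P <= N.+1%:R * e by rewrite /P ler_pdivrMr // lt0r Mn M0.
  apply: le_trans (ltW hlt) _; apply: ler_wpM2r; first by rewrite !mulr_ge0.
  by move: PN; rewrite -natr1; lra.
exists X', Y', Z', Q; split=> //.
  by split; [exact: subset_trans XA|exact: subset_trans YB|exact: subset_trans ZC].
have eN : 0 <= e ^+ N by rewrite exprn_ge0 // ltW.
by split; rewrite exprSr -mulrA;
  [apply: le_trans lX|apply: le_trans lY|apply: le_trans lZ]; apply: ler_wpM2l.
Qed.

End Weights.

End Regularity.

Section RegularBoxes.
Context (R : archiRealFieldType).

(** Densities lie in [0,1] and every decrement costs [d], so at most [N] steps occur, with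
    [N * d >= 1]. The loss [d ^+ N] therefore depends on [e] alone and not on the vertex set or on
    [f]. *)
Lemma regular3_box (e : R) : 0 < e ->
  exists c : R, 0 < c <= 1 /\ forall (V : finType) (u v w : V -> R) (f : V -> V -> V -> R),
    (forall x, 0 <= u x) -> (forall x, 0 <= v x) -> (forall x, 0 <= w x) ->
    (forall x y z, 0 <= f x y z <= 1) -> forall A B C : {set V},
    exists (A' B' C' : {set V}) (P : R), [/\ [/\ A' \subset A, B' \subset B & C' \subset C],
      [/\ c * mass u A <= mass u A', c * mass v B <= mass v B' & c * mass w C <= mass w C'],
      0 <= P <= 1 & regular3 e P u v w f A' B' C'].
Proof.
move=> e0; pose d := Num.min (e / 3) 1.
have d0 : 0 < d by rewrite lt_min ltr01 andbT; lra.
have d1 : d <= 1 by rewrite ge_min lexx orbT.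
have de : 3 * d <= e.
  have : d <= e / 3 by rewrite ge_min lexx.
  lra.
pose N := Num.bound d^-1.
have hN : 1 <= N%:R * d.
  by rewrite -ler_pdivrMr // div1r ltW // archi_boundP // invr_ge0 ltW.
exists (d ^+ N); split; first by rewrite exprn_gt0 // exprn_ile1 // ltW.
move=> V u v w f u0 v0 w0 f01 A B C.
have [|A' [B' [C' [P [s m P01 reg]]]]] := regular3_box_step u0 v0 w0 f01 d0 d1 (N := N) (A :=
  A) (B := B) (C := C).
  apply: le_trans (box3_le_massM u0 v0 w0 f01 _ _ _) _.
  by rewrite ler_peMl // !mulr_ge0 ?mass_ge0.
exists A', B', C', P; split=> // X Y Z XA YB ZC.
apply: le_trans (reg X Y Z XA YB ZC) _.
by rewrite ler_wpM2r // !mulr_ge0 ?mass_ge0.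
Qed.

(** The error is measured against the whole box; three sides of relative mass at least [c] cost a
    factor [c ^+ 3]. *)
Lemma regular3_sub (e c P : R) (V : finType) (u v w : V -> R) (f : V -> V -> V -> R)
    (A B C A' B' C' : {set V}) :
  0 <= e -> 0 <= c ->
  (forall x, 0 <= u x) -> (forall x, 0 <= v x) -> (forall x, 0 <= w x) ->
  A' \subset A -> B' \subset B -> C' \subset C ->
  c * mass u A <= mass u A' -> c * mass v B <= mass v B' -> c * mass w C <= mass w C' ->
  regular3 (e * c ^+ 3) P u v w f A B C -> regular3 e P u v w f A' B' C'.
Proof.
move=> e0 c0 u0 v0 w0 sA sB sC hA hB hC reg X Y Z XA YB ZC.
apply: le_trans (reg X Y Z (subset_trans XA sA) (subset_trans YB sB) (subset_trans ZC sC)) _.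
rewrite -mulrA ler_wpM2l //.
have -> : c ^+ 3 * (mass u A * mass v B * mass w C) =
  (c * mass u A) * (c * mass v B) * (c * mass w C) by ring.
by rewrite ler_pM ?mulr_ge0 ?mass_ge0 // ler_pM ?mulr_ge0 ?mass_ge0.
Qed.

(** The triples are treated one by one. The first is made regular with accuracy [e * c' ^+ 3],
    because the remaining ones may still shrink its parts by the factor [c']. The constant depends
    only on [e] and on the number of triples. *)
Lemma regularity (n : nat) (e : R) : 0 < e ->
  exists c : R, 0 < c <= 1 /\
  forall (I V Q : finType) (u : I -> V -> R) (ci cj cl : Q -> I) (f : Q -> V -> V -> V -> R),
    (forall i x, 0 <= u i x) -> (forall q x y z, 0 <= f q x y z <= 1) ->
    (forall q, [/\ ci q != cj q, cj q != cl q & ci q != cl q]) ->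
  forall s : seq Q, (size s <= n)%N -> forall B0 : I -> {set V},
  exists B : I -> {set V},
    (forall i, B i \subset B0 i /\ c * mass (u i) (B0 i) <= mass (u i) (B i)) /\
    forall q, q \in s -> exists P : R, 0 <= P <= 1 /\
      regular3 e P (u (ci q)) (u (cj q)) (u (cl q)) (f q) (B (ci q)) (B (cj q)) (B (cl q)).
Proof.
elim: n e => [|n IH] e e0.
  exists 1; split; first by rewrite ltr01 lexx.
  move=> I V Q u ci cj cl f u0 f01 d [|//] _ B0; exists B0; split=> // i.
  by rewrite mul1r.
have [c' [/andP[c0 c1] {}IH]] := IH e e0.
have ec0 : 0 < e * c' ^+ 3 by rewrite mulr_gt0 // exprn_gt0.
have [c2 [/andP[c20 c21] box]] := regular3_box ec0.
exists (c2 * c'); split; first by rewrite mulr_gt0 // mulr_ile1 // ltW.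
move=> I V Q u ci cj cl f u0 f01 dist [_ B0|q s /= hs B0].
  exists B0; split=> // i; split=> //.
  by rewrite ler_piMl ?mass_ge0 // mulr_ile1 // ltW.
have [dij djl dil] := dist q.
have [A' [B' [C' [P [[sA sB sC] [mA mB mC] P01 reg]]]]] :=
  box V _ _ _ (f q) (u0 (ci q)) (u0 (cj q)) (u0 (cl q)) (f01 q) (B0 (ci q)) (B0 (cj q)) (B0 (cl q)).
pose B1 i := if i == ci q then A' else if i == cj q then B' else
  if i == cl q then C' else B0 i.
have B1i : B1 (ci q) = A' by rewrite /B1 eqxx.
have B1j : B1 (cj q) = B' by rewrite /B1 eqxx eq_sym (negPf dij).
have B1l : B1 (cl q) = C' by rewrite /B1 eqxx eq_sym (negPf dil) eq_sym (negPf djl).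
have B1P i : B1 i \subset B0 i /\ c2 * mass (u i) (B0 i) <= mass (u i) (B1 i).
  rewrite /B1; case: eqP => [->//|_]; case: eqP => [->//|_]; case: eqP => [->//|_].
  by split=> //; rewrite ler_piMl ?mass_ge0.
have [B [BP regB]] := IH I V Q u ci cj cl f u0 f01 dist s hs B1.
exists B; split=> [i|q'].
  have [s1 m1] := BP i; have [s2 m2] := B1P i.
  split; first exact: subset_trans s2.
  by apply: le_trans m1; rewrite mulrAC [c2 * _ * _]mulrC ler_wpM2l // ltW.
rewrite inE; case: eqP => [-> _|_ /= q's]; last exact: regB.
exists P; split=> //.
have [si mi] := BP (ci q); have [sj mj] := BP (cj q); have [sl ml] := BP (cl q).
rewrite B1i in si mi; rewrite B1j in sj mj; rewrite B1l in sl ml.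
by apply: (regular3_sub (c := c')) reg => //; exact: ltW.
Qed.

(** Splitting by the sign of [h] turns a bounded test function into two test sets, whence the factor
    2; doing this in each of three variables gives the 8 of [sum3_abs_le]. *)
Lemma sum_abs_le (V : finType) (h : V -> R) (E : R) :
  (forall X : {set V}, `|\sum_(x in X) h x| <= E) ->
  forall a : V -> R, (forall x, `|a x| <= 1) -> `|\sum_x a x * h x| <= 2 * E.
Proof.
move=> hE a a1; apply: le_trans (ler_norm_sum _ _ _) _.
apply: (@le_trans _ _ (\sum_x `|h x|)).
  by apply: ler_sum => x _; rewrite normrM ler_piMl.
rewrite (bigID [pred x | x \in [set x | 0 <= h x]]) /=.
have -> : \sum_(x | x \in [set x | 0 <= h x]) `|h x| = \sum_(x in [set x | 0 <= h x]) h x.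
  by apply: eq_bigr => x; rewrite inE => /ger0_norm.
have -> : \sum_(x | x \notin [set x | 0 <= h x]) `|h x| = - \sum_(x in [set x | h x < 0]) h x.
  rewrite -sumrN; apply: eq_big => x; first by rewrite !inE ltNge.
  by rewrite inE -ltNge => /ltr0_norm.
have := hE [set x | 0 <= h x]; have := hE [set x | h x < 0].
by rewrite !ler_norml => /andP[]; lra.
Qed.

Lemma sum3_abs_le (V : finType) (h : V -> V -> V -> R) (E : R) :
  (forall X Y Z : {set V}, `|\sum_(x in X) \sum_(y in Y) \sum_(z in Z) h x y z| <= E) ->
  forall a b c : V -> R, (forall x, `|a x| <= 1) -> (forall x, `|b x| <= 1) ->
    (forall x, `|c x| <= 1) ->
  `|\sum_x \sum_y \sum_z a x * b y * c z * h x y z| <= 8 * E.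
Proof.
move=> hE a b c a1 b1 c1.
have hz (X Y : {set V}) : `|\sum_(x in X) \sum_(y in Y) \sum_z c z * h x y z| <= 2 * E.
  have := sum_abs_le (h := fun z => \sum_(x in X) \sum_(y in Y) h x y z) (E := E) _ c1.
  have -> : \sum_(x in X) \sum_(y in Y) \sum_z c z * h x y z =
      \sum_z c z * \sum_(x in X) \sum_(y in Y) h x y z.
    under [RHS]eq_bigr => z _ do rewrite mulr_sumr.
    rewrite [RHS]exchange_big /=; apply: eq_bigr => x _.
    under [RHS]eq_bigr => z _ do rewrite mulr_sumr.
    by rewrite [RHS]exchange_big.
  apply=> Z; have := hE X Y Z; congr (`|_| <= _).
  rewrite [RHS]exchange_big /=; apply: eq_bigr => x _.
  by rewrite [RHS]exchange_big.
have hy (X : {set V}) : `|\sum_(x in X) \sum_y \sum_z b y * c z * h x y z| <= 4 * E.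
  have := sum_abs_le (h := fun y => \sum_(x in X) \sum_z c z * h x y z) (E := 2 * E) _ b1.
  have -> : \sum_(x in X) \sum_y \sum_z b y * c z * h x y z =
      \sum_y b y * \sum_(x in X) \sum_z c z * h x y z.
    under [RHS]eq_bigr => z _ do rewrite mulr_sumr.
    rewrite [RHS]exchange_big /=; apply: eq_bigr => x _; apply: eq_bigr => y _.
    by rewrite mulr_sumr; apply: eq_bigr => z _; rewrite mulrA.
  rewrite (_ : 2 * (2 * E) = 4 * E); last by ring.
  apply=> Y; have := hz X Y; congr (`|_| <= _).
  by rewrite [RHS]exchange_big.
have := sum_abs_le (h := fun x => \sum_y \sum_z b y * c z * h x y z) (E := 4 * E) hy a1.
rewrite (_ : 2 * (4 * E) = 8 * E); last by ring.
congr (`|_| <= _); apply: eq_bigr => x _; rewrite mulr_sumr; apply: eq_bigr => y _.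
by rewrite mulr_sumr; apply: eq_bigr => z _; rewrite !mulrA.
Qed.

End RegularBoxes.

(** * Sampling *)

Definition is_prob (R : archiRealFieldType) (T : finType) (w : T -> R) : Prop :=
  (forall x, 0 <= w x) /\ \sum_x w x = 1.

Definition wprod (R : archiRealFieldType) (T : finType) (w : T -> R) (p : T * T) : R :=
  w p.1 * w p.2.

Definition codeg (R : archiRealFieldType) (V : finType) (w : V -> R) (f : V -> V -> V -> R)
    (p q : V * V) : R :=
  \sum_z w z * (f p.1 q.1 z * f p.2 q.2 z).

(* The eighth power of a Gowers-type norm dominating the cut norm of f. Unlike the cut norm
   it is a polynomial, of degree four in each of u, v, w, so it survives random sampling. *)
Definition cut_energy (R : archiRealFieldType) (V : finType) (u v w : V -> R)
    (f : V -> V -> V -> R) : R :=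
  \sum_(Q : (V * V) * (V * V)) wprod (wprod v) Q *
    (\sum_p wprod u p * (codeg w f p Q.1 * codeg w f p Q.2)) ^+ 2.

Section CutEnergy.
Context (R : archiRealFieldType).

Lemma sum_pair (S T : finType) (F : S * T -> R) : \sum_p F p = \sum_x \sum_y F (x, y).
Proof. by rewrite pair_bigA; apply: eq_bigr => -[]. Qed.

Lemma sumM_pair (T : finType) (F G : T -> R) :
  (\sum_x F x) * (\sum_x G x) = \sum_p F p.1 * G p.2.
Proof. by rewrite big_distrlr pair_bigA. Qed.

Lemma wprod_prob (T : finType) (w : T -> R) : is_prob w -> is_prob (wprod w).
Proof.
move=> [w0 w1]; split; first by move=> p; rewrite mulr_ge0.
by rewrite /wprod -sumM_pair w1 mulr1.
Qed.

Lemma prob_norm_le (T : finType) (w h : T -> R) (E : R) : is_prob w ->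
  (forall x, `|h x| <= E) -> `|\sum_x w x * h x| <= E.
Proof.
move=> [w0 w1] hE; apply: le_trans (ler_norm_sum _ _ _) _.
rewrite -[leRHS]mul1r -w1 mulr_suml; apply: ler_sum => x _.
by rewrite normrM ger0_norm // ler_wpM2l.
Qed.

Lemma prob_le (T : finType) (w h : T -> R) (E : R) : is_prob w ->
  (forall x, h x <= E) -> \sum_x w x * h x <= E.
Proof.
move=> [w0 w1] hE; rewrite -[leRHS]mul1r -w1 mulr_suml; apply: ler_sum => x _.
by rewrite ler_wpM2l.
Qed.

Lemma jensen_sqr (T : finType) (w h : T -> R) : is_prob w ->
  (\sum_x w x * h x) ^+ 2 <= \sum_x w x * h x ^+ 2.
Proof.
move=> [w0 w1]; move Es: (\sum_x _) => s.
have : 0 <= \sum_x w x * (h x - s) ^+ 2 by apply: sumr_ge0 => x _; rewrite mulr_ge0 ?sqr_ge0.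
have -> : \sum_x w x * (h x - s) ^+ 2 = \sum_x w x * h x ^+ 2 - s ^+ 2.
  transitivity (\sum_x w x * h x ^+ 2 - 2 * s * (\sum_x w x * h x) + s ^+ 2 * \sum_x w x).
    rewrite !mulr_sumr -sumrB -big_split /=; apply: eq_bigr => x _.
    by ring.
  by rewrite w1 Es; ring.
by rewrite subr_ge0.
Qed.

Lemma jensen_sqr_le (T : finType) (w a h : T -> R) : is_prob w -> (forall x, `|a x| <= 1) ->
  (\sum_x w x * (a x * h x)) ^+ 2 <= \sum_x w x * h x ^+ 2.
Proof.
move=> wprod a1; apply: le_trans (jensen_sqr _ wprod) _; apply: ler_sum => x _.
rewrite ler_wpM2l //; first by case: wprod.
by rewrite exprMn ler_piMl ?sqr_ge0 // -[leLHS]real_normK ?num_real // exprn_ile1.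
Qed.

Section Cut.
Context (V : finType) (u v w : V -> R) (f : V -> V -> V -> R).
Hypotheses (pu : is_prob u) (pv : is_prob v) (pw0 : is_prob w).
Hypothesis f1 : forall x y z, `|f x y z| <= 1.

Lemma normM_le1 (x y : R) : `|x| <= 1 -> `|y| <= 1 -> `|x * y| <= 1.
Proof. by move=> x1 y1; rewrite normrM mulr_ile1. Qed.

Lemma codeg_le1 p q : `|codeg w f p q| <= 1.
Proof. by apply: prob_norm_le => // z; apply: normM_le1. Qed.

(* Three applications of Cauchy-Schwarz, each removing one of the test functions. *)
Lemma cut_le_energy (a b c : V -> R) :
  (forall x, `|a x| <= 1) -> (forall x, `|b x| <= 1) -> (forall x, `|c x| <= 1) ->
  (\sum_x \sum_y \sum_z u x * v y * w z * (a x * b y * c z * f x y z)) ^+ 8 <= cut_energy u v w f.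
Proof.
move=> a1 b1 c1; set S := \sum_x _.
pose k z x y := u x * v y * (a x * b y * f x y z).
pose a2 p : R := a p.1 * a p.2; pose b2 q : R := b q.1 * b q.2.
pose G p := \sum_q wprod v q * (b2 q * codeg w f p q).
pose K (Q : (V * V) * (V * V)) := \sum_p wprod u p * (codeg w f p Q.1 * codeg w f p Q.2).
pose T := \sum_p wprod u p * (a2 p * G p).
pose U := \sum_Q wprod (wprod v) Q * (wprod b2 Q * K Q).
have a21 p : `|a2 p| <= 1 by apply: normM_le1.
have b21 p : `|b2 p| <= 1 by apply: normM_le1.
have ST : S ^+ 2 <= T.
  have -> : S = \sum_z w z * (c z * \sum_x \sum_y k z x y).
    rewrite /S; under eq_bigr => x _ do rewrite exchange_big /=.
    rewrite exchange_big /=; apply: eq_bigr => z _; rewrite mulrA mulr_sumr.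
    apply: eq_bigr => x _; rewrite mulr_sumr; apply: eq_bigr => y _; rewrite /k; ring.
  apply: le_trans (jensen_sqr_le _ pw0 c1) _; rewrite le_eqVlt; apply/orP; left; apply/eqP.
  transitivity (\sum_z \sum_p \sum_q w z * (k z p.1 q.1 * k z p.2 q.2)).
    apply: eq_bigr => z _; rewrite expr2 sumM_pair mulr_sumr; apply: eq_bigr => p _.
    by rewrite sumM_pair mulr_sumr.
  rewrite exchange_big /=; apply: eq_bigr => p _; rewrite exchange_big /=.
  rewrite /G mulr_sumr mulr_sumr; apply: eq_bigr => q _.
  rewrite /codeg !mulr_sumr; apply: eq_bigr => z _; rewrite /k /a2 /b2 /wprod; ring.
have TU : T ^+ 2 <= U.
  apply: le_trans (jensen_sqr_le _ (wprod_prob pu) a21) _.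
  rewrite le_eqVlt; apply/orP; left; apply/eqP; rewrite /U.
  under [RHS]eq_bigr => Q _ do rewrite /K !mulr_sumr.
  rewrite [RHS]exchange_big; apply: eq_bigr => p _ /=.
  rewrite /G expr2 sumM_pair mulr_sumr; apply: eq_bigr => Q _.
  by rewrite /wprod /=; ring.
have UP : U ^+ 2 <= cut_energy u v w f.
  by apply: jensen_sqr_le; [do 2 apply: wprod_prob|move=> Q; apply: normM_le1].
rewrite (_ : 8%N = (2 * 2 * 2)%N) // !exprM.
have T0 : 0 <= T by apply: le_trans ST; rewrite sqr_ge0.
have U0 : 0 <= U by apply: le_trans TU; rewrite sqr_ge0.
have h1 : (S ^+ 2) ^+ 2 <= U.
  by apply: le_trans TU; rewrite lerXn2r ?nnegrE ?sqr_ge0.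
by apply: le_trans UP; rewrite lerXn2r ?nnegrE ?sqr_ge0.
Qed.

(** Converse of [cut_le_energy]. Fix all points of the expanded energy except one triple [x], [y],
    [z] sharing a factor [f x y z]. The other factors then separate into [codeg w f (x, p2) q'],
    [K ((y, q2), q')] and [f p2 q2 z], each bounded and depending on one variable of the triple, so
    the energy is an average of test sums. *)
Lemma cut_energy_le (E : R) :
  (forall a b c : V -> R, (forall x, `|a x| <= 1) -> (forall x, `|b x| <= 1) ->
    (forall x, `|c x| <= 1) ->
    \sum_x \sum_y \sum_z u x * v y * w z * (a x * b y * c z * f x y z) <= E) ->
  cut_energy u v w f <= E.
Proof.
move=> hE.
pose K Q := \sum_p wprod u p * (codeg w f p Q.1 * codeg w f p Q.2).
have K1 Q : `|K Q| <= 1.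
  by apply: prob_norm_le => [|p]; [exact: wprod_prob|apply: normM_le1; exact: codeg_le1].
pose S q2 q' p2 := \sum_x \sum_y \sum_z u x * v y * w z *
  (codeg w f (x, p2) q' * K ((y, q2), q') * f p2 q2 z * f x y z).
have SE q2 q' p2 : S q2 q' p2 <= E.
  by apply: hE => x //; rewrite ?codeg_le1.
have -> : cut_energy u v w f = \sum_q2 v q2 * \sum_q' wprod v q' * \sum_p2 u p2 * S q2 q' p2.
  rewrite /cut_energy sum_pair sum_pair exchange_big /=; apply: eq_bigr => q2 _.
  rewrite exchange_big mulr_sumr; apply: eq_bigr => q' _ /=.
  transitivity (\sum_y \sum_p2 \sum_x \sum_z v q2 * (wprod v q' * (u p2 * (u x * v y * w z *
    (codeg w f (x, p2) q' * K ((y, q2), q') * f p2 q2 z * f x y z))))).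
    apply: eq_bigr => y _;
      rewrite expr2 -/(K (y, q2, q')) {1}/K mulr_suml mulr_sumr sum_pair exchange_big /=.
    apply: eq_bigr => p2 _; apply: eq_bigr => x _.
    rewrite {1}/codeg /= mulr_suml mulr_sumr mulr_suml mulr_sumr; apply: eq_bigr => z _.
    rewrite /wprod /=; ring.
  rewrite exchange_big !mulr_sumr /=; apply: eq_bigr => p2 _.
  rewrite exchange_big !mulr_sumr /=; apply: eq_bigr => x _.
  rewrite !mulr_sumr; apply: eq_bigr => y _.
  by rewrite !mulr_sumr.
by do 3 (apply: prob_le => [|?]; rewrite ?wprod_prob //; try exact: wprod_prob).
Qed.

End Cut.

End CutEnergy.

(** * Random samples and quartic forms *)

Definition empirical (R : archiRealFieldType) (V : finType) (m : nat) (w : 'I_m -> V) (v : V) : R :=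
  m%:R^-1 * \sum_r (w r == v)%:R.

Arguments empirical R {V m}.

Definition quartic_at (R : archiRealFieldType) (V : finType) (k : V -> V -> V -> V -> R)
    (w : V -> R) : R :=
  \sum_x \sum_y \sum_z \sum_t w x * (w y * (w z * (w t * k x y z t))).

(** Agreement is asked for on probability weights only; there a constant is a quartic form too, by
    normalisation. *)
Definition quartic (R : archiRealFieldType) (V : finType) (C : R) (Q : (V -> R) -> R) : Prop :=
  exists k : V -> V -> V -> V -> R, (forall x y z t, `|k x y z t| <= C) /\
    forall w, is_prob w -> Q w = quartic_at k w.

Section Empirical.
Context (R : archiRealFieldType).

Lemma empirical_prob (V : finType) (m : nat) (w : 'I_m -> V) : (0 < m)%N ->
  is_prob (empirical R w).
Proof.
move=> m0; split=> [v|]; first by rewrite mulr_ge0 ?invr_ge0 ?sumr_ge0.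
rewrite -mulr_sumr exchange_big /= (eq_bigr (fun=> 1)) => [|r _].
  by rewrite sumr_const card_ord mulVf // pnatr_eq0 -lt0n.
by rewrite (bigD1 (w r)) //= eqxx big1 ?addr0 // => v /negPf; rewrite eq_sym => ->.
Qed.

Lemma empirical_sum (V : finType) (m : nat) (w : 'I_m -> V) (h : V -> R) :
  \sum_v empirical R w v * h v = m%:R^-1 * \sum_r h (w r).
Proof.
under eq_bigr => v _ do rewrite /empirical -mulrA mulr_suml.
rewrite -mulr_sumr exchange_big /=; congr (_ * _); apply: eq_bigr => r _.
rewrite (bigD1 (w r)) //= eqxx mul1r big1 ?addr0 // => v /negPf.
by rewrite eq_sym => ->; rewrite mul0r.
Qed.

Section Expectation.
Context (V : finType) (w : V -> R) (pw0 : is_prob w) (m : nat).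

Definition pweight (s : {ffun 'I_m -> V}) : R := \prod_r w (s r).

Lemma pweight_prob : is_prob pweight.
Proof.
have [w0 w1] := pw0; split=> [s|]; first by apply: prodr_ge0.
by rewrite /pweight -(bigA_distr_bigA (fun=> w)) /= big1.
Qed.

Definition update (s : {ffun 'I_m -> V}) (r : 'I_m) (x : V) : {ffun 'I_m -> V} :=
  [ffun i => if i == r then x else s i].

Lemma updateE s r x i : update s r x i = if i == r then x else s i.
Proof. by rewrite ffunE. Qed.

(* Resampling one coordinate does not change the distribution: swap the old and the new value. *)
Lemma resample (G : {ffun 'I_m -> V} -> R) (r : 'I_m) :
  \sum_s pweight s * G s = \sum_s pweight s * \sum_x w x * G (update s r x).
Proof.
have [w0 w1] := pw0.
pose h (p : {ffun 'I_m -> V} * V) := (update p.1 r p.2, p.1 r).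
have hK : involutive h.
  move=> [s x]; rewrite /h /= updateE eqxx; congr (_, _).
  by apply/ffunP => i; rewrite !updateE; case: eqP => // ->.
transitivity (\sum_p pweight p.1 * w p.2 * G p.1).
  rewrite sum_pair; apply: eq_bigr => s _ /=.
  by rewrite -mulr_suml -mulr_sumr w1 mulr1.
rewrite (reindex_inj (inv_inj hK)) sum_pair; apply: eq_bigr => s _ /=.
rewrite mulr_sumr; apply: eq_bigr => x _ /=; rewrite mulrA; congr (_ * _).
rewrite /pweight (bigD1 r) //= [in RHS](bigD1 r) //= updateE eqxx.
rewrite (eq_bigr (fun i => w (s i))) => [|i /negPf ir]; last by rewrite updateE ir.
ring.
Qed.

(** Distinct coordinates of a sample are independent, which is seen by resampling the four of them
    in turn. *)
Lemma expect_distinct (k : V -> V -> V -> V -> R) (a b c d : 'I_m) :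
  a != b -> a != c -> a != d -> b != c -> b != d -> c != d ->
  \sum_s pweight s * k (s a) (s b) (s c) (s d) = quartic_at k w.
Proof.
move=> ab ac ad bc bd cd; have [_ p1] := pweight_prob.
rewrite (resample (fun s => k (s a) (s b) (s c) (s d)) a).
under eq_bigr => s _ do under eq_bigr => x _ do
  rewrite !updateE eqxx [b == a]eq_sym (negPf ab) [c == a]eq_sym (negPf ac) [d == a]eq_sym (negPf
    ad).
rewrite (resample (fun s => \sum_x w x * k x (s b) (s c) (s d)) b).
under eq_bigr => s _ do under eq_bigr => y _ do under eq_bigr => x _ do
  rewrite !updateE eqxx [c == b]eq_sym (negPf bc) [d == b]eq_sym (negPf bd).
rewrite (resample (fun s => \sum_y w y * \sum_x w x * k x y (s c) (s d)) c).
under eq_bigr => s _ do under eq_bigr => z _ do under eq_bigr => y _ do under eq_bigr => x _ do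
  rewrite !updateE eqxx [d == c]eq_sym (negPf cd).
rewrite (resample (fun s => \sum_z w z * \sum_y w y * \sum_x w x * k x y z (s d)) d).
under eq_bigr => s _ do under eq_bigr => t _ do rewrite !updateE eqxx.
rewrite -mulr_suml p1 mul1r /quartic_at.
under eq_bigr => t _ do rewrite mulr_sumr.
rewrite exchange_big /=.
under eq_bigr => z _ do under eq_bigr => t _ do rewrite !mulr_sumr.
under eq_bigr => z _ do rewrite exchange_big /=.
rewrite exchange_big /=.
under eq_bigr => y _ do under eq_bigr => z _ do under eq_bigr => t _ do rewrite !mulr_sumr.
under eq_bigr => y _ do under eq_bigr => z _ do rewrite exchange_big /=.
under eq_bigr => y _ do rewrite exchange_big /=.
rewrite exchange_big /=.
do 4 (apply: eq_bigr => ? _); ring.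
Qed.

Lemma quartic_atE (k : V -> V -> V -> V -> R) (u : V -> R) :
  quartic_at k u = \sum_x u x * \sum_y u y * \sum_z u z * \sum_t u t * k x y z t.
Proof.
rewrite /quartic_at; apply: eq_bigr => x _; rewrite mulr_sumr; apply: eq_bigr => y _.
rewrite !mulr_sumr; apply: eq_bigr => z _; rewrite !mulr_sumr; apply: eq_bigr => t _.
by [].
Qed.

Lemma quartic_at_le (k : V -> V -> V -> V -> R) (C : R) : (forall x y z t, `|k x y z t| <= C) ->
  `|quartic_at k w| <= C.
Proof. by move=> kC; rewrite quartic_atE; do 4 (apply: prob_norm_le => // ?). Qed.

(** The form at the empirical weight averages [k] over all index quadruples. Those without
    coincidences have expectation exactly [quartic_at k w]. Each of the six possible coincidences
    holds for [m ^ 3] of the [m ^ 4] quadruples and costs at most [2 * C], whence [12 * C / m]. *)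
Lemma expect_quartic (k : V -> V -> V -> V -> R) (C : R) : (0 < m)%N ->
    (forall x y z t, `|k x y z t| <= C) ->
  \sum_s pweight s * quartic_at k (empirical R s) <= quartic_at k w + 12 * C / m%:R.
Proof.
move=> m0 kC.
have mR : m%:R != 0 :> R by rewrite pnatr_eq0 -lt0n.
have [p0 p1] := pweight_prob.
have /ler_normlP [QC1 QC2] := quartic_at_le kC.
have C0 : 0 <= C by have := quartic_at_le kC; apply: le_trans.
pose E a b c d := \sum_s pweight s * k (s a) (s b) (s c) (s d).
pose col (a b : 'I_m) : R := (a == b)%:R.
have -> : \sum_s pweight s * quartic_at k (empirical R s) =
    m%:R^-1 ^+ 4 * \sum_a \sum_b \sum_c \sum_d E a b c d.
  under eq_bigr => s _ do rewrite quartic_atE.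
  transitivity (\sum_s pweight s * (m%:R^-1 ^+ 4 *
      \sum_a \sum_b \sum_c \sum_d k (s a) (s b) (s c) (s d))).
    apply: eq_bigr => s _; congr (_ * _).
    rewrite empirical_sum exprS -mulrA; congr (_ * _); rewrite mulr_sumr; apply: eq_bigr => a _.
    rewrite empirical_sum exprS -mulrA; congr (_ * _); rewrite mulr_sumr; apply: eq_bigr => b _.
    rewrite empirical_sum exprS -mulrA; congr (_ * _); rewrite mulr_sumr; apply: eq_bigr => c _.
    by rewrite empirical_sum expr1.
  rewrite mulr_sumr; under eq_bigr => s _ do rewrite mulrCA.
  rewrite -!mulr_sumr; congr (_ * _).
  under eq_bigr => s _ do rewrite mulr_sumr.
  rewrite exchange_big /=; apply: eq_bigr => a _.
  under eq_bigr => s _ do rewrite mulr_sumr.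
  rewrite exchange_big /=; apply: eq_bigr => b _.
  under eq_bigr => s _ do rewrite mulr_sumr.
  rewrite exchange_big /=; apply: eq_bigr => c _.
  under eq_bigr => s _ do rewrite mulr_sumr.
  by rewrite exchange_big.
have EC a b c d : E a b c d <= C.
  by apply: prob_le => [|s]; [exact: pweight_prob|apply: le_trans (ler_norm _) (kC _ _ _ _)].
have Eb a b c d : E a b c d <= quartic_at k w + 2 * C *
    (col a b + col a c + col a d + col b c + col b d + col c d).
  have hi : 1 <= col a b + col a c + col a d + col b c + col b d + col c d ->
      E a b c d <= quartic_at k w + 2 * C *
        (col a b + col a c + col a d + col b c + col b d + col c d).
    by move=> h; have := EC a b c d; have := ler_wpM2l C0 h; lra.
  have col0 x y : 0 <= col x y by [].
  have := (col0 a b, col0 a c, col0 a d, (col0 b c, col0 b d, col0 c d)).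
  move=> [[[c1 c2] c3] [[c4 c5] c6]].
  have [/eqP ab|ab] := boolP (a == b); first by apply: hi; move: c2 c3 c4 c5 c6;
    rewrite /col ab eqxx /=; lra.
  have [/eqP ac|ac] := boolP (a == c); first by apply: hi; move: c1 c3 c4 c5 c6;
    rewrite /col ac eqxx /=; lra.
  have [/eqP ad|ad] := boolP (a == d); first by apply: hi; move: c1 c2 c4 c5 c6;
    rewrite /col ad eqxx /=; lra.
  have [/eqP bc|bc] := boolP (b == c); first by apply: hi; move: c1 c2 c3 c5 c6;
    rewrite /col bc eqxx /=; lra.
  have [/eqP bd|bd] := boolP (b == d); first by apply: hi; move: c1 c2 c3 c4 c6;
    rewrite /col bd eqxx /=; lra.
  have [/eqP cd|cd] := boolP (c == d); first by apply: hi; move: c1 c2 c3 c4 c5;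
    rewrite /col cd eqxx /=; lra.
  by rewrite /E expect_distinct // /col (negPf ab) (negPf ac) (negPf ad) (negPf bc) (negPf bd)
    (negPf cd) !addr0 mulr0 addr0.
have colS a : \sum_b col a b = 1.
  rewrite /col (bigD1 a) //= eqxx big1 ?addr0 // => b /negPf.
  by rewrite eq_sym => ->.
have colS' : \sum_a \sum_b col a b = m%:R.
  by rewrite (eq_bigr (fun=> 1)) ?sumr_const ?card_ord.
have cst (x : R) : \sum_(a < m) x = m%:R * x by rewrite sumr_const card_ord mulr_natl.
have : \sum_a \sum_b \sum_c \sum_d E a b c d <=
    m%:R ^+ 4 * quartic_at k w + 2 * C * (6 * m%:R ^+ 3).
  apply: (@le_trans _ _ (\sum_a \sum_b \sum_c \sum_d (quartic_at k w + 2 * C *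
    (col a b + col a c + col a d + col b c + col b d + col c d)))).
    by do 4 (apply: ler_sum => ? _).
  rewrite le_eqVlt; apply/orP; left; apply/eqP.
  have S4 a b c : \sum_d (quartic_at k w + 2 * C *
      (col a b + col a c + col a d + col b c + col b d + col c d)) =
      m%:R * quartic_at k w + 2 * C * (m%:R * (col a b + col a c + col b c) + 3).
    rewrite big_split cst -mulr_sumr; congr (_ + _ * _).
    by rewrite !big_split /= !cst !colS; ring.
  under eq_bigr => a _ do under eq_bigr => b _ do under eq_bigr => c _ do rewrite S4.
  have S3 a b : \sum_c (m%:R * quartic_at k w + 2 * C * (m%:R * (col a b + col a c + col b c) +
    3)) =
      m%:R * (m%:R * quartic_at k w) + 2 * C * (m%:R * (m%:R * col a b) + 5 * m%:R).
    rewrite big_split cst -mulr_sumr; congr (_ + _ * _).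
    by rewrite big_split -mulr_sumr !big_split /= !cst !colS; ring.
  under eq_bigr => a _ do under eq_bigr => b _ do rewrite S3.
  have S2 a : \sum_b (m%:R * (m%:R * quartic_at k w) +
      2 * C * (m%:R * (m%:R * col a b) + 5 * m%:R)) =
      m%:R ^+ 3 * quartic_at k w + 2 * C * (6 * m%:R ^+ 2).
    rewrite big_split cst -mulr_sumr big_split -!mulr_sumr colS /= cst; ring.
  by under eq_bigr => a _ do rewrite S2; rewrite cst; ring.
move=> h; have i4 : 0 <= m%:R^-1 ^+ 4 :> R by rewrite exprn_ge0 // invr_ge0.
apply: le_trans (ler_wpM2l i4 h) _; rewrite le_eqVlt; apply/orP; left; apply/eqP.
by field.
Qed.

(** First moment method. An upper bound suffices, since [Q] will be an energy that has to stay
    small. *)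
Lemma exists_sample (Q : (V -> R) -> R) (C : R) : (0 < m)%N -> quartic C Q ->
  exists s : 'I_m -> V, Q (empirical R s) <= Q w + 12 * C / m%:R.
Proof.
move=> m0 [k [kC QE]]; have := expect_quartic m0 kC; rewrite -QE // => hE.
have [p0 p1] := pweight_prob.
case: (boolP [exists s : {ffun 'I_m -> V}, Q (empirical R s) <= Q w + 12 * C / m%:R]).
  by move=> /existsP [s hs]; exists s.
move=> /existsPn no; exfalso.
have : \sum_s pweight s * (Q w + 12 * C / m%:R) < \sum_s pweight s * Q (empirical R s).
  have [s0 ps0] : exists s, 0 < pweight s.
    apply/existsP; apply: contraT => /existsPn n0.
    move: p1; rewrite big1 => [/eqP|s _]; first by rewrite eq_sym oner_eq0.
    by apply/eqP; rewrite eq_le p0 andbT leNgt n0.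
  rewrite (bigD1 s0) //= [ltRHS](bigD1 s0) //= ltr_leD //.
    by rewrite ltr_pM2l // ltNge no.
  by apply: ler_sum => s _; rewrite ler_wpM2l // ltW // ltNge no.
rewrite -mulr_suml p1 mul1r ltNge => /negP; apply.
apply: le_trans hE; apply: ler_sum => s _; rewrite QE //; exact: empirical_prob.
Qed.

End Expectation.
End Empirical.

Section SamplingEnergy.
Context (R : archiRealFieldType).

Section PhiQuartic.
Context (V : finType) (f : V -> V -> V -> R).
Hypothesis f1 : forall x y z, `|f x y z| <= 1.

(** The eight factors of the expanded energy. [P], [Q] and [Z] hold four points each, from the
    first, second and third part respectively, which exhibits degree four in every weight. *)
Definition energy_kernel (Q P Z : (V * V) * (V * V)) : R :=
  let g p q z := f p.1 q.1 z * f p.2 q.2 z in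
  (g P.1 Q.1 Z.1.1 * g P.1 Q.2 Z.1.2) * (g P.2 Q.1 Z.2.1 * g P.2 Q.2 Z.2.2).

Lemma energy_kernel_le1 Q P Z : `|energy_kernel Q P Z| <= 1.
Proof. by do 3 (apply: normM_le1). Qed.

Lemma cut_energy_expand (u v w : V -> R) :
  cut_energy u v w f = \sum_Q wprod (wprod v) Q * \sum_P wprod (wprod u) P *
    \sum_Z wprod (wprod w) Z * energy_kernel Q P Z.
Proof.
apply: eq_bigr => Q _; congr (_ * _).
rewrite expr2 sumM_pair; apply: eq_bigr => P _.
have E p : codeg w f p Q.1 * codeg w f p Q.2 =
    \sum_z wprod w z * (f p.1 Q.1.1 z.1 * f p.2 Q.1.2 z.1 * (f p.1 Q.2.1 z.2 * f p.2 Q.2.2 z.2)).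
  by rewrite sumM_pair; apply: eq_bigr => z _; rewrite /wprod; ring.
rewrite !E mulrACA sumM_pair; congr (_ * _).
by apply: eq_bigr => Z _; rewrite /energy_kernel /wprod /=; ring.
Qed.

Lemma quartic_pair (k : (V * V) * (V * V) -> R) (u : V -> R) :
  \sum_P wprod (wprod u) P * k P = quartic_at (fun x y z t => k ((x, y), (z, t))) u.
Proof.
rewrite !sum_pair; apply: eq_bigr => x _; apply: eq_bigr => y _.
rewrite sum_pair; apply: eq_bigr => z _; apply: eq_bigr => t _; rewrite /wprod /=; ring.
Qed.

Lemma cut_energy_quartic1 (v w : V -> R) : is_prob v -> is_prob w ->
  quartic 1 (fun u => cut_energy u v w f).
Proof.
move=> pv pw0.
exists (fun x y z t => \sum_Q wprod (wprod v) Q * \sum_Z wprod (wprod w) Z *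
  energy_kernel Q ((x, y), (z, t)) Z).
split=> [x y z t|u pu].
  by do 2 (apply: prob_norm_le => [|?]; first by do 2 apply: wprod_prob); exact: energy_kernel_le1.
rewrite cut_energy_expand -(quartic_pair (fun P => \sum_Q wprod (wprod v) Q *
  \sum_Z wprod (wprod w) Z * energy_kernel Q P Z)).
under eq_bigr => Q _ do rewrite mulr_sumr.
rewrite exchange_big /=; apply: eq_bigr => P _; rewrite mulr_sumr.
by apply: eq_bigr => Q _; rewrite mulrCA.
Qed.

Lemma cut_energy_quartic2 (u w : V -> R) : is_prob u -> is_prob w ->
  quartic 1 (fun v => cut_energy u v w f).
Proof.
move=> pu pw0.
exists (fun x y z t => \sum_P wprod (wprod u) P * \sum_Z wprod (wprod w) Z *
  energy_kernel ((x, y), (z, t)) P Z).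
split=> [x y z t|v pv].
  by do 2 (apply: prob_norm_le => [|?]; first by do 2 apply: wprod_prob); exact: energy_kernel_le1.
by rewrite cut_energy_expand -(quartic_pair (fun Q => \sum_P wprod (wprod u) P *
  \sum_Z wprod (wprod w) Z * energy_kernel Q P Z)).
Qed.

Lemma cut_energy_quartic3 (u v : V -> R) : is_prob u -> is_prob v ->
  quartic 1 (fun w => cut_energy u v w f).
Proof.
move=> pu pv.
exists (fun x y z t => \sum_Q wprod (wprod v) Q * \sum_P wprod (wprod u) P *
  energy_kernel Q P ((x, y), (z, t))).
split=> [x y z t|w pw0].
  by do 2 (apply: prob_norm_le => [|?]; first by do 2 apply: wprod_prob); exact: energy_kernel_le1.
rewrite cut_energy_expand -(quartic_pair (fun Z => \sum_Q wprod (wprod v) Q *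
  \sum_P wprod (wprod u) P * energy_kernel Q P Z)).
under eq_bigr => Q _.
  under eq_bigr => P _ do rewrite mulr_sumr.
  rewrite exchange_big mulr_sumr /=; over.
rewrite exchange_big /=; apply: eq_bigr => Z _; rewrite mulr_sumr; apply: eq_bigr => Q _.
rewrite mulrCA; congr (_ * _); rewrite mulr_sumr.
by apply: eq_bigr => P _; rewrite mulrCA.
Qed.

Lemma cut_energy_le1 (u v w : V -> R) : is_prob u -> is_prob v -> is_prob w ->
  `|cut_energy u v w f| <= 1.
Proof.
move=> pu pv pw0; rewrite cut_energy_expand.
by do 3 (apply: prob_norm_le => [|?]; first by do 2 apply: wprod_prob); exact: energy_kernel_le1.
Qed.

Lemma cut_energy_ge0 (u v w : V -> R) : is_prob v -> 0 <= cut_energy u v w f.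
Proof.
move=> pv; apply: sumr_ge0 => Q _; rewrite mulr_ge0 ?sqr_ge0 //.
by case: (wprod_prob (wprod_prob pv)).
Qed.

End PhiQuartic.

Lemma quartic_cst (V : finType) (c : R) : `|c| <= 1 -> quartic 1 (fun _ : V -> R => c).
Proof.
move=> c1; exists (fun _ _ _ _ => c); split=> // w [_ w1]; rewrite quartic_atE.
by do ?rewrite -mulr_suml w1 mul1r.
Qed.

Lemma quartic_sum (V T : finType) (Q : T -> (V -> R) -> R) :
  (forall t, quartic 1 (Q t)) -> quartic #|T|%:R (fun w => \sum_t Q t w).
Proof.
move=> qQ; have [k kP] := fin_all_exists qQ.
exists (fun x y z s => \sum_t k t x y z s); split=> [x y z s|w pw0].
  apply: le_trans (ler_norm_sum _ _ _) _; rewrite -sum1_card natr_sum; apply: ler_sum => t _.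
  by case: (kP t).
rewrite (eq_bigr (fun t => quartic_at (k t) w)) => [|t _]; last by case: (kP t) => _ ->.
rewrite /quartic_at exchange_big /=; apply: eq_bigr => x _.
rewrite exchange_big /=; apply: eq_bigr => y _.
rewrite exchange_big /=; apply: eq_bigr => z _.
rewrite exchange_big /=; apply: eq_bigr => s _.
by rewrite !mulr_sumr.
Qed.

(** The weights are replaced by samples one part at a time. As the indices of a triple are distinct,
    the total energy is quartic in each single weight. Working with the sum over all triples makes
    the same samples serve every triple. *)
Lemma exists_sample_energy (I V T : finType) (ci cj cl : T -> I) (f : T -> V -> V -> V -> R)
    (u : I -> V -> R) (m : nat) : (0 < m)%N ->
    (forall t, [/\ ci t != cj t, cj t != cl t & ci t != cl t]) ->
    (forall t x y z, `|f t x y z| <= 1) -> (forall i, is_prob (u i)) ->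
  exists s : I -> 'I_m -> V,
    \sum_t cut_energy (empirical R (s (ci t))) (empirical R (s (cj t))) (empirical R (s (cl t)))
      (f t) <=
    \sum_t cut_energy (u (ci t)) (u (cj t)) (u (cl t)) (f t) + #|I|%:R * (12 * #|T|%:R / m%:R).
Proof.
move=> m0 dist f1 pu.
pose Psi (u : I -> V -> R) := \sum_t cut_energy (u (ci t)) (u (cj t)) (u (cl t)) (f t).
pose set1 (u : I -> V -> R) i w j := if j == i then w else u j.
have Psi_quartic (u' : I -> V -> R) i : (forall j, is_prob (u' j)) ->
    quartic #|T|%:R (fun w => Psi (set1 u' i w)).
  move=> pu'; apply: (quartic_sum (Q :=
    fun t w => cut_energy (set1 u' i w (ci t)) (set1 u' i w (cj t))
    (set1 u' i w (cl t)) (f t))) => t; rewrite /set1.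
  have [dij djl dil] := dist t.
  have [<-|_] := eqVneq (ci t) i.
    by rewrite eq_sym (negPf dij) eq_sym (negPf dil); exact: cut_energy_quartic1.
  have [<-|_] := eqVneq (cj t) i.
    by rewrite eq_sym (negPf djl); exact: cut_energy_quartic2.
  have [_|_] := eqVneq (cl t) i; first exact: cut_energy_quartic3.
  by apply: quartic_cst; exact: cut_energy_le1.
suff H (L : seq I) : exists (u' : I -> V -> R) (s : I -> 'I_m -> V),
    [/\ forall j, is_prob (u' j), forall j, j \in L -> u' j = empirical R (s j) &
    Psi u' <= Psi u + (size L)%:R * (12 * #|T|%:R / m%:R)].
  have [u' [s [pu' es le]]] := H (enum I).
  exists s; rewrite -cardE in le; apply: le_trans le; rewrite le_eqVlt; apply/orP; left; apply/eqP.
  by apply: eq_bigr => t _; rewrite !es ?mem_enum.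
elim: L => [|i L [u' [s [pu' es le]]]].
  (* The initial samples are arbitrary but need a point of [V]. If [V] is empty then so is [I],
     since no probability weight exists. *)
  have [|/existsPn V0] := boolP [exists x : V, true].
    move=> /existsP [x _]; exists u, (fun _ _ => x); split=> //.
    by rewrite mul0r addr0.
  have [/existsP [i _]|/existsPn I0] := boolP [exists i : I, true].
    have [_] := pu i; rewrite big1 => [/eqP|x _]; first by rewrite eq_sym oner_eq0.
    by have := V0 x.
  exists u, (fun i => False_rect _ (elimN idP (I0 i) isT)); split=> //.
  by rewrite mul0r addr0.
have [w hw] := exists_sample (pu' i) m0 (Psi_quartic u' i pu').
exists (set1 u' i (empirical R w)), (fun j => if j == i then w else s j); split=> [j|j|].
- by rewrite /set1; case: eqP => // _; exact: empirical_prob.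
- by rewrite /set1 inE; case: eqP => //= _; exact: es.
have E : Psi (set1 u' i (u' i)) = Psi u'.
  by apply: eq_bigr => t _; congr cut_energy; rewrite /set1; case: eqP => [->|].
rewrite E in hw; move: hw le; rewrite /= -[(size L).+1%:R]natr1; lra.
Qed.

End SamplingEnergy.

(** * Triangle counting, tail sums and Ramsey's theorem *)

Section Counting.
Context (R : archiRealFieldType).

(** Telescoping: [g1 g2 g3 - p1 p2 p3 = g1 g2 (g3 - p3) + p3 g1 (g2 - p2) + p3 p2 (g1 - p1)]. In the
    first term, fixing [x] makes [g1] and [g2] select subsets of [B] and [C]; in the second, fixing
    [y] makes [g1] select a subset of [A]. So cut estimates for the three pairs suffice. *)
Lemma triangle_count (V : finType) (u v w : V -> R) (A B C : {set V})
    (g1 g2 g3 : V -> V -> bool) (p1 p2 p3 E1 E2 E3 : R) :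
  (forall x, 0 <= u x) -> (forall x, 0 <= v x) -> (forall x, 0 <= w x) ->
  0 <= p2 <= 1 -> 0 <= p3 <= 1 ->
  (forall X Y : {set V}, X \subset A -> Y \subset B ->
    `|\sum_(x in X) \sum_(y in Y) u x * v y * ((g1 x y)%:R - p1)| <= E1) ->
  (forall X Z : {set V}, X \subset A -> Z \subset C ->
    `|\sum_(x in X) \sum_(z in Z) u x * w z * ((g2 x z)%:R - p2)| <= E2) ->
  (forall Y Z : {set V}, Y \subset B -> Z \subset C ->
    `|\sum_(y in Y) \sum_(z in Z) v y * w z * ((g3 y z)%:R - p3)| <= E3) ->
  `|\sum_(x in A) \sum_(y in B) \sum_(z in C)
      u x * v y * w z * [&& g1 x y, g2 x z & g3 y z]%:R
    - p1 * p2 * p3 * (mass u A * mass v B * mass w C)|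
  <= E1 * mass w C + E2 * mass v B + E3 * mass u A.
Proof.
move=> u0 v0 w0 /andP[p20 p21] /andP[p30 p31] h1 h2 h3.
pose D3 x := \sum_(y in [set y in B | g1 x y]) \sum_(z in [set z in C | g2 x z])
  v y * w z * ((g3 y z)%:R - p3).
pose D2 y := \sum_(x in [set x in A | g1 x y]) \sum_(z in C) u x * w z * ((g2 x z)%:R - p2).
pose D1 := \sum_(x in A) \sum_(y in B) u x * v y * ((g1 x y)%:R - p1).
have E10 : 0 <= E1 by apply: le_trans (h1 _ _ (subxx _) (subxx _)).
have E20 : 0 <= E2 by apply: le_trans (h2 _ _ (subxx _) (subxx _)).
have -> : \sum_(x in A) \sum_(y in B) \sum_(z in C)
      u x * v y * w z * [&& g1 x y, g2 x z & g3 y z]%:R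
    - p1 * p2 * p3 * (mass u A * mass v B * mass w C) =
    \sum_(x in A) u x * D3 x + p3 * (\sum_(y in B) v y * D2 y) + p3 * p2 * (D1 * mass w C).
  have T3 : \sum_(x in A) u x * D3 x = \sum_(x in A) \sum_(y in B) \sum_(z in C)
      u x * v y * w z * ((g1 x y)%:R * (g2 x z)%:R * ((g3 y z)%:R - p3)).
    apply: eq_bigr => x _; rewrite /D3 mulr_sumr big_set big_mkcondr /=.
    apply: eq_bigr => y _; case: (g1 x y); last first.
      by rewrite big1 // => z _; rewrite !mul0r mulr0.
    rewrite mulr_sumr big_set big_mkcondr /=; apply: eq_bigr => z _.
    by case: (g2 x z) => /=; [ring|rewrite mul1r !mul0r mulr0].
  have T2 : \sum_(y in B) v y * D2 y = \sum_(x in A) \sum_(y in B) \sum_(z in C)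
      u x * v y * w z * ((g1 x y)%:R * ((g2 x z)%:R - p2)).
    rewrite [RHS]exchange_big /=.
    apply: eq_bigr => y _; rewrite /D2 mulr_sumr big_set big_mkcondr /=.
    apply: eq_bigr => x _; case: (g1 x y); last first.
      by rewrite big1 // => z _; rewrite !mul0r mulr0.
    by rewrite mulr_sumr; apply: eq_bigr => z _ /=; ring.
  have T1 : D1 * mass w C = \sum_(x in A) \sum_(y in B) \sum_(z in C)
      u x * v y * w z * ((g1 x y)%:R - p1).
    rewrite /D1 mulr_suml; apply: eq_bigr => x _; rewrite mulr_suml; apply: eq_bigr => y _.
    by rewrite /mass mulr_sumr; apply: eq_bigr => z _; ring.
  have T0 : mass u A * mass v B * mass w C = \sum_(x in A) \sum_(y in B) \sum_(z in C)
      u x * v y * w z.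
    rewrite -mulrA /mass mulr_suml; apply: eq_bigr => x _; rewrite mulr_suml mulr_sumr.
    by apply: eq_bigr => y _; rewrite !mulr_sumr; apply: eq_bigr => z _; rewrite mulrA.
  rewrite T0 T1 T2 T3 !mulr_sumr -sumrB -!big_split; apply: eq_bigr => x _ /=.
  rewrite !mulr_sumr -sumrB -!big_split; apply: eq_bigr => y _ /=.
  rewrite !mulr_sumr -sumrB -!big_split; apply: eq_bigr => z _ /=.
  by case: (g1 x y); case: (g2 x z); case: (g3 y z) => /=; ring.
have sub3 x : `|D3 x| <= E3.
  by apply: h3; apply/subsetP => y; rewrite inE => /andP[].
have sub2 y : `|D2 y| <= E2.
  by apply: h2 => //; apply/subsetP => x; rewrite inE => /andP[].
have b3 : `|\sum_(x in A) u x * D3 x| <= E3 * mass u A.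
  apply: le_trans (ler_norm_sum _ _ _) _; rewrite /mass mulr_sumr; apply: ler_sum => x _.
  by rewrite normrM ger0_norm // mulrC ler_wpM2r.
have b2 : `|\sum_(y in B) v y * D2 y| <= E2 * mass v B.
  apply: le_trans (ler_norm_sum _ _ _) _; rewrite /mass mulr_sumr; apply: ler_sum => x _.
  by rewrite normrM ger0_norm // mulrC ler_wpM2r.
have b1 : `|D1 * mass w C| <= E1 * mass w C.
  by rewrite normrM (ger0_norm (mass_ge0 C w0)) ler_wpM2r ?mass_ge0 //; exact: h1.
apply: le_trans (ler_normD _ _) _; apply: le_trans (lerD (ler_normD _ _) (lexx _)) _.
have c2 : `|p3 * (\sum_(y in B) v y * D2 y)| <= E2 * mass v B.
  by rewrite normrM ger0_norm // (le_trans _ b2) // ler_piMl.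
have c1 : `|p3 * p2 * (D1 * mass w C)| <= E1 * mass w C.
  by rewrite normrM ger0_norm ?mulr_ge0 // (le_trans _ b1) // ler_piMl // mulr_ile1.
lra.
Qed.

(** Peel off the first entry [b], with tail sum [S]: of [(b + S) ^+ 3] only [3 b^2 S] is thrown
    away. The cubes are kept because they provide the gap below 1/3. *)
Lemma tail_square_le (N : nat) (a : 'I_N -> R) : (forall j, 0 <= a j) ->
  3 * (\sum_j a j * (\sum_(i < N | (j < i)%N) a i) ^+ 2) + \sum_j a j ^+ 3 <= (\sum_j a j) ^+ 3.
Proof.
elim: N a => [|N IH] a a0; first by rewrite !big_ord0 mulr0 addr0 expr0n.
have := IH (fun j => a (lift ord0 j)) (fun j => a0 _).
rewrite [in X in _ -> 3 * X + _ <= _]big_ord_recl [in X in _ -> _ + X <= _]big_ord_recl.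
rewrite [in X in _ -> _ <= X ^+ 3]big_ord_recl.
rewrite [\sum_(i < N.+1 | (@ord0 N < i)%N) a i]big_mkcond big_ord_recl /= add0r.
set S := \sum_j a (lift ord0 j).
rewrite [in X in _ -> 3 * (_ + X) + _ <= _](eq_bigr (fun j => a (lift ord0 j) *
  (\sum_(i < N | (j < i)%N) a (lift ord0 i)) ^+ 2)); last first.
  by move=> j _; rewrite big_mkcond big_ord_recl /= add0r -big_mkcond.
have S0 : 0 <= S by apply: sumr_ge0.
have := a0 ord0; move: (a ord0) => b b0.
have : 0 <= b ^+ 2 * S by rewrite mulr_ge0 ?sqr_ge0.
move=> h h1.
have -> : (b + S) ^+ 3 = b ^+ 3 + 3 * (b ^+ 2 * S) + 3 * (b * S ^+ 2) + S ^+ 3 by ring.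
move: h h1; lra.
Qed.

(** In the same induction the lost terms [b^3 + 3 b^2 S] are at most [M (b^2 + 3 b S)], which is
    below the growth [4 M (b^2 + 2 b S)] of the error. It serves twice in the lower bound: for the
    colour weights and for the sizes of blocks. *)
Lemma tail_square_ge (N : nat) (a : 'I_N -> R) (M : R) : (forall j, 0 <= a j <= M) ->
  (\sum_j a j) ^+ 3 <=
  3 * (\sum_j a j * (\sum_(i < N | (j < i)%N) a i) ^+ 2) + 4 * M * (\sum_j a j) ^+ 2.
Proof.
elim: N a => [|N IH] a aM; first by rewrite !big_ord0 !expr0n !mulr0 addr0.
have := IH (fun j => a (lift ord0 j)) (fun j => aM _).
rewrite [in X in _ -> _ <= 3 * X + _]big_ord_recl [in X in _ -> _ <= _ + _ * X ^+ 2]big_ord_recl.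
rewrite [in X in _ -> X ^+ 3 <= _]big_ord_recl.
rewrite [\sum_(i < N.+1 | (@ord0 N < i)%N) a i]big_mkcond big_ord_recl /= add0r.
set S := \sum_j a (lift ord0 j).
rewrite [in X in _ -> _ <= 3 * (_ + X) + _](eq_bigr (fun j => a (lift ord0 j) *
  (\sum_(i < N | (j < i)%N) a (lift ord0 i)) ^+ 2)); last first.
  by move=> j _; rewrite big_mkcond big_ord_recl /= add0r -big_mkcond.
have S0 : 0 <= S by apply: sumr_ge0 => j _; case/andP: (aM (lift ord0 j)).
have /andP := aM ord0; move: (a ord0) => b [b0 bM] h.
have h1 : b ^+ 2 * b <= b ^+ 2 * M by rewrite ler_wpM2l ?sqr_ge0.
have h2 : b * S * b <= b * S * M by rewrite ler_wpM2l ?mulr_ge0.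
have h3 : 0 <= M * b ^+ 2 by rewrite mulr_ge0 ?sqr_ge0 //; lra.
have h4 : 0 <= M * (b * S) by rewrite !mulr_ge0 //; lra.
have -> : (b + S) ^+ 3 = b ^+ 2 * b + 3 * (b * S * b) + 3 * (b * S ^+ 2) + S ^+ 3 by ring.
have -> : 4 * M * (b + S) ^+ 2 = 4 * (M * b ^+ 2) + 8 * (M * (b * S)) + 4 * M * S ^+ 2 by ring.
move: h h1 h2 h3 h4; rewrite [b ^+ 2 * M]mulrC [b * S * M]mulrC; lra.
Qed.

End Counting.

Lemma pigeonhole_filter (T : Type) (L : finType) (c : T -> L) (n : nat) (s : seq T) :
  (0 < #|L|)%N -> (#|L| * n <= size s)%N -> exists l, (n <= size [seq x <- s | c x == l])%N.
Proof.
move=> L0 h; apply/existsP; apply: contraT => /existsPn no.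
have : (\sum_l size [seq x <- s | c x == l] = size s)%N.
  elim: s {h no} => [|x s IH] /=; first by rewrite big1.
  rewrite -[in RHS]IH -add1n (eq_bigr (fun l => (c x == l) + size [seq x <- s | c x == l]))%N.
    rewrite big_split /=; congr (_ + _)%N.
    by rewrite (bigD1 (c x)) //= eqxx big1 // => l /negPf; rewrite eq_sym => ->.
  by move=> l _; case: (c x == l).
move=> hs; move: h; rewrite -hs leqNgt => /negP []; case/card_gt0P: L0 => l0 _.
apply: (@leq_trans (\sum_(l : L) size [seq x <- s | c x == l]).+1) => //.
rewrite -sum_nat_const (bigD1 l0) //= [in leqRHS](bigD1 l0) //= -addSn.
apply: leq_add; first by rewrite ltnNge no.
by apply: leq_sum => l _; rewrite ltnW // ltnNge no.
Qed.

(** Every kept element is stored with the common colour of its pairs with later elements; [ramsey]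
    then applies the pigeonhole principle to these labels. *)
Lemma end_homogeneous (L : finType) (n : nat) : (0 < #|L|)%N -> exists N : nat,
  forall (T : eqType) (c : T -> T -> L) (s : seq T), (N <= size s)%N ->
  exists s' : seq (T * L), [/\ subseq (map fst s') s, size s' = n &
    pairwise (fun p q => c p.1 q.1 == p.2) s'].
Proof.
move=> L0; elim: n => [|n [N IH]]; first by exists 0%N => T c s _; exists [::]; rewrite sub0seq.
exists (#|L| * N).+1 => T c [//|x s] /= hs.
have [l hl] := @pigeonhole_filter _ L (c x) N s L0 hs.
have [s' [sub <- hp]] := IH T c _ hl.
exists ((x, l) :: s'); split=> //=.
  by rewrite eqxx; apply: subseq_trans sub _; exact: filter_subseq.
rewrite hp andbT; apply/allP => p ps'.
have : p.1 \in [seq y <- s | c x y == l] by apply: (mem_subseq sub); exact: map_f.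
by rewrite mem_filter => /andP[].
Qed.

Lemma ramsey (L : finType) (n : nat) : (0 < #|L|)%N -> exists N : nat,
  forall (T : eqType) (c : T -> T -> L) (s : seq T), (N <= size s)%N ->
  exists (l : L) (s' : seq T), [/\ subseq s' s, size s' = n & pairwise (fun x y => c x y == l) s'].
Proof.
move=> L0; have [N HN] := end_homogeneous (#|L| * n) L0.
exists N => T c s hs; have [s' [sub sz hp]] := HN T c s hs.
have := @pigeonhole_filter _ L snd n s' L0; rewrite sz => /(_ (leqnn _)) [l hl].
exists l, (map fst (take n [seq p <- s' | p.2 == l])); split.
- apply: subseq_trans sub; apply: map_subseq.
  by apply: subseq_trans (take_subseq _ _) (filter_subseq _ _).
- by rewrite size_map size_takel.
rewrite pairwise_map.
have : pairwise (fun p q => c p.1 q.1 == p.2) (take n [seq p <- s' | p.2 == l]).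
  by apply: subseq_pairwise hp; apply: subseq_trans (take_subseq _ _) (filter_subseq _ _).
apply: (@sub_in_pairwise _ [pred p | p.2 == l]) => [p q /eqP pl _ /=|]; first by rewrite pl.
by apply/allP => p /mem_take; rewrite mem_filter => /andP[].
Qed.

Lemma triple_setE (T : finType) (e : {set T}) (x y z : T) : #|e| = 3%N ->
  ([set x; y; z] == e) = [&& x \in e, y \in e :\ x & z \in e :\ x :\ y].
Proof.
move=> e3; apply/eqP/and3P => [E|[xe]].
  have u : (#|[set x; y; z]| = 3)%N by rewrite E.
  move: u; rewrite setUC cardsU1 cards2 -E !inE !eqxx !orbT /= negb_or.
  by rewrite [y == x]eq_sym; case: (x == y); case: (z == x); case: (z == y).
rewrite !inE => /andP[yx ye] /and3P[zy zx ze].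
apply/eqP; rewrite eqEcard e3; apply/andP; split.
  by apply/subsetP => t; rewrite !inE => /orP[/orP[]|] /eqP->.
by rewrite setUC cardsU1 cards2 !inE negb_or zx zy eq_sym yx.
Qed.

Lemma sum_ordered_triples (T : finType) (E : {set {set T}}) (U : {set T}) :
  (forall e, e \in E -> #|e| = 3%N) ->
  (\sum_(x in U) \sum_(y in U) \sum_(z in U) ([set x; y; z] \in E) =
   6 * #|[set e in E | e \subset U]|)%N.
Proof.
move=> E3; pose EU := [set e in E | e \subset U].
have six e : e \in EU -> (\sum_(x in U) \sum_(y in U) \sum_(z in U) ([set x; y; z] == e) = 6)%N.
  rewrite inE => /andP[/E3 e3 /subsetP eU].
  transitivity (\sum_(x in e) \sum_(y in e :\ x) \sum_(z in e :\ x :\ y) 1)%N; last first.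
    rewrite (eq_bigr (fun=> 2)%N) => [|x xe]; first by rewrite sum_nat_const e3.
    have c2 : #|e :\ x| = 2%N by move: e3; rewrite (cardsD1 x) xe add1n => -[].
    rewrite (eq_bigr (fun=> 1)%N) => [|y ye]; first by rewrite sum_nat_const c2.
    by rewrite sum_nat_const muln1; move: c2; rewrite (cardsD1 y) ye add1n => -[].
  rewrite big_mkcond [RHS]big_mkcond; apply: eq_bigr => x _ /=.
  case xe : (x \in e); last first.
    case: (x \in U) => //; rewrite big1 // => y _; rewrite big1 // => z _.
    by rewrite triple_setE // xe.
  rewrite eU // big_mkcond [RHS]big_mkcond; apply: eq_bigr => y _ /=.
  case ye : (y \in e :\ x); last first.
    case: (y \in U) => //; rewrite big1 // => z _.
    by rewrite triple_setE // ye andbF.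
  rewrite eU; last by move: ye; rewrite inE => /andP[].
  rewrite big_mkcond [RHS]big_mkcond; apply: eq_bigr => z _ /=.
  rewrite triple_setE // xe ye /=; case ze : (z \in e :\ x :\ y); rewrite ?ze ?if_same //.
  by rewrite eU //; move: ze; rewrite !inE => /and3P[].
rewrite mulnC -sum_nat_const -(eq_bigr _ six).
transitivity (\sum_(x in U) \sum_(y in U) \sum_(z in U) \sum_(e in EU) ([set x; y; z] == e))%N.
  apply: eq_bigr => x xU; apply: eq_bigr => y yU; apply: eq_bigr => z zU.
  have sU : [set x; y; z] \subset U by apply/subsetP => t; rewrite !inE => /orP[/orP[]|] /eqP->.
  case h : (_ \in E); last first.
    rewrite big1 // => e; rewrite inE => /andP[eE _]; case: eqP => // he.
    by rewrite he eE in h.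
  rewrite (bigD1 [set x; y; z]) ?inE ?h //= eqxx big1 // => e /andP[_ /negPf].
  by rewrite eq_sym => ->.
rewrite [RHS]exchange_big /=; apply: eq_bigr => x xU.
rewrite [RHS]exchange_big /=; apply: eq_bigr => y yU.
by rewrite [RHS]exchange_big /=.
Qed.

(** * Upper bound *)

Definition pattern (V : Type) (k : nat) (o : rel V) (phi : V -> V -> 'I_k) (b a c : V) : bool :=
  [&& o b a, o b c, (phi a c < phi b a)%N & (phi a c < phi b c)%N].

(* The palette of the construction: every edge {b, a, c} has a source b, and the colour of the
   pair ac is strictly smaller than those of ba and bc. The orientation o need not be a linear
   order; allowing all orientations does not increase the density. *)
Definition admissible_on (k : nat) (V : finType) (E : {set {set V}}) (W : {set V}) : Prop :=
  exists (o : rel V) (phi : V -> V -> 'I_k),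
  [/\ forall x y, phi x y = phi y x, forall x y, o x y -> ~~ o y x &
    forall x y z, x \in W -> y \in W -> z \in W -> [set x; y; z] \in E ->
      [|| pattern o phi x y z, pattern o phi y x z | pattern o phi z x y]].

Section Pattern.
Context (R : archiRealFieldType).

(** The cube lies above its tangent at [a = 1/k]: [x^3 - 3 a^2 x + 2 a^3 = (x - a)^2 (x + 2 a)]. *)
Lemma sum_cube_ge (k : nat) (q : 'I_k -> R) : (forall s, 0 <= q s) -> \sum_s q s = 1 ->
  k%:R ^- 2 <= \sum_s q s ^+ 3.
Proof.
case: k q => [|k] q q0 q1; first by move: q1; rewrite big_ord0 => /eqP; rewrite eq_sym oner_eq0.
set a : R := k.+1%:R^-1; have a0 : 0 < a by rewrite invr_gt0.
have -> : k.+1%:R ^- 2 = \sum_s (3 * a ^+ 2 * q s - 2 * a ^+ 3).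
  rewrite sumrB -mulr_sumr q1 sumr_const card_ord -mulr_natl /a; field.
  by rewrite nat1r pnatr_eq0.
apply: ler_sum => s _; rewrite -subr_ge0.
have -> : q s ^+ 3 - (3 * a ^+ 2 * q s - 2 * a ^+ 3) = (q s - a) ^+ 2 * (q s + 2 * a) by ring.
by rewrite mulr_ge0 ?sqr_ge0 // addr_ge0 // mulr_ge0 // ltW.
Qed.

Section PatternBound.
Context (k : nat) (V : finType) (E : {set {set V}}) (W : {set V}).
Context (o : rel V) (phi : V -> V -> 'I_k).
Hypothesis phi_sym : forall x y, phi x y = phi y x.
Hypothesis o_asym : forall x y, o x y -> ~~ o y x.
Hypothesis patternP : forall x y z, x \in W -> y \in W -> z \in W -> [set x; y; z] \in E ->
  [|| pattern o phi x y z, pattern o phi y x z | pattern o phi z x y].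

(** One colour for orientation and palette colour together. The value [false] means a reversed or an
    unoriented pair; the resulting overcount is harmless in an upper bound. *)
Definition colour (x y : V) : bool * 'I_k := (o x y, phi x y).

Lemma colour_set (u v : V -> R) (X Y : {set V}) (d : bool * 'I_k -> R) (e : R)
    (S : {set bool * 'I_k}) : 0 <= e ->
  (forall s, `|\sum_(x in X) \sum_(y in Y) u x * v y * ((colour x y == s)%:R - d s)| <= e) ->
  `|\sum_(x in X) \sum_(y in Y) u x * v y * ((colour x y \in S)%:R - \sum_(s in S) d s)|
    <= 2 * k%:R * e.
Proof.
move=> e0 h.
have -> : \sum_(x in X) \sum_(y in Y) u x * v y * ((colour x y \in S)%:R - \sum_(s in S) d s) =
   \sum_(s in S) \sum_(x in X) \sum_(y in Y) u x * v y * ((colour x y == s)%:R - d s).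
  rewrite [RHS]exchange_big /=; apply: eq_bigr => x _.
  rewrite [RHS]exchange_big /=; apply: eq_bigr => y _.
  rewrite -mulr_sumr sumrB; congr (_ * (_ - _)).
  case: (boolP (colour x y \in S)) => hS.
    rewrite (bigD1 (colour x y)) //= eqxx big1 ?addr0 // => s /andP[_ /negPf].
    by rewrite eq_sym => ->.
  by rewrite big1 // => s sS; case: eqP => // hs; rewrite hs sS in hS.
apply: le_trans (ler_norm_sum _ _ _) _.
apply: le_trans (ler_sum _ (fun s _ => h s)) _.
rewrite sumr_const -[_ *+ #|_|]mulr_natl ler_wpM2r // -natrM ler_nat.
by apply: leq_trans (max_card _) _; rewrite card_prod card_bool card_ord.
Qed.

(** Sort the edges by the colour [s] of the base pair and by the part containing the source: this
    gives [3 * k] triangle counts. Each pair in a count has error [2 * k * e], so a count has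
    [6 * k * e] and the total is [18 * k ^ 2 * e]. The weights vanish outside [W], where nothing is
    known about edges. One density vector [d] for all three pairs is essential for the final
    inequality. *)
Lemma pattern_bound (u v w : V -> R) (A B C : {set V}) (d : bool * 'I_k -> R) (e : R) :
  0 <= e -> (forall x, 0 <= u x) -> (forall x, 0 <= v x) -> (forall x, 0 <= w x) ->
  (forall x, x \notin W -> u x = 0) -> (forall x, x \notin W -> v x = 0) ->
  (forall x, x \notin W -> w x = 0) ->
  (forall s, 0 <= d s) -> \sum_s d s = 1 ->
  (forall s (X Y : {set V}), X \subset A -> Y \subset B ->
    `|\sum_(x in X) \sum_(y in Y) u x * v y * ((colour x y == s)%:R - d s)|
       <= e * (mass u A * mass v B)) ->
  (forall s (X Y : {set V}), X \subset A -> Y \subset C ->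
    `|\sum_(x in X) \sum_(y in Y) u x * w y * ((colour x y == s)%:R - d s)|
       <= e * (mass u A * mass w C)) ->
  (forall s (X Y : {set V}), X \subset B -> Y \subset C ->
    `|\sum_(x in X) \sum_(y in Y) v x * w y * ((colour x y == s)%:R - d s)|
       <= e * (mass v B * mass w C)) ->
  box3 u v w (fun x y z => ([set x; y; z] \in E)%:R) A B C <=
    ((1 - k%:R ^- 2) / 3 + 18 * k%:R ^+ 2 * e) * (mass u A * mass v B * mass w C).
Proof.
move=> e0 u0 v0 w0 uW vW wW d0 d1 h1 h2 h3.
pose Sp (b : bool) (s : 'I_k) := [set c : bool * 'I_k | (c.1 == b) && (s < c.2)%N].
pose Se (s : 'I_k) := [set c : bool * 'I_k | c.2 == s].
pose D (S : {set bool * 'I_k}) := \sum_(c in S) d c.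
have D01 S : 0 <= D S <= 1.
  by rewrite sumr_ge0 //= -d1 [leRHS](bigID [pred c | c \in S]) /= lerDl sumr_ge0.
have mA := mass_ge0 A u0; have mB := mass_ge0 B v0; have mC := mass_ge0 C w0.
pose M := mass u A * mass v B * mass w C.
have M0 : 0 <= M by rewrite !mulr_ge0.
pose T (S1 S2 S3 : {set bool * 'I_k}) := \sum_(x in A) \sum_(y in B) \sum_(z in C)
  u x * v y * w z * [&& colour x y \in S1, colour x z \in S2 & colour y z \in S3]%:R.
have TB S1 S2 S3 : T S1 S2 S3 <= (D S1 * D S2 * D S3 + 6 * k%:R * e) * M.
  have := @triangle_count R V u v w A B C (fun x y => colour x y \in S1)
    (fun x y => colour x y \in S2) (fun x y => colour x y \in S3) (D S1) (D S2) (D S3)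
    (2 * k%:R * (e * (mass u A * mass v B))) (2 * k%:R * (e * (mass u A * mass w C)))
    (2 * k%:R * (e * (mass v B * mass w C))) u0 v0 w0 (D01 _) (D01 _).
  rewrite -/(T _ _ _) => /(_ _ _ _)/le_trans H.
  have {}H : `|T S1 S2 S3 - D S1 * D S2 * D S3 * M| <= 6 * k%:R * e * M.
    apply: H; last by rewrite /M le_eqVlt; apply/orP; left; apply/eqP; ring.
    - by move=> X Y XA YB; apply: colour_set => [|s]; [rewrite !mulr_ge0|exact: h1].
    - by move=> X Y XA YB; apply: colour_set => [|s]; [rewrite !mulr_ge0|exact: h2].
    - by move=> X Y XA YB; apply: colour_set => [|s]; [rewrite !mulr_ge0|exact: h3].
  by move: H => /ler_normlP[_]; rewrite mulrDl; lra.
have split : box3 u v w (fun x y z => ([set x; y; z] \in E)%:R) A B C <=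
    \sum_s (T (Sp true s) (Sp true s) (Se s) + T (Sp false s) (Se s) (Sp true s)
            + T (Se s) (Sp false s) (Sp false s)).
  rewrite !big_split /= ![\sum_s T _ _ _]exchange_big /= -!big_split; apply: ler_sum => x _ /=.
  rewrite ![\sum_s \sum_(y in B) _]exchange_big /= -!big_split; apply: ler_sum => y _ /=.
  rewrite ![\sum_s \sum_(z in C) _]exchange_big /= -!big_split; apply: ler_sum => z _ /=.
  rewrite -!mulr_sumr -!mulrDr.
  have [xW|/uW->] := boolP (x \in W); last by rewrite !mul0r.
  have [yW|/vW->] := boolP (y \in W); last by rewrite mulr0 !mul0r.
  have [zW|/wW->] := boolP (z \in W); last by rewrite mulr0 !mul0r.
  apply: ler_wpM2l; first by rewrite !mulr_ge0.
  case: (boolP (_ \in E)) => [|_]; last by rewrite !addr_ge0 // sumr_ge0.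
  move=> /(patternP xW yW zW); rewrite /pattern.
  have tot (P : 'I_k -> bool) s : P s -> 1 <= \sum_t (P t)%:R :> R.
    by move=> Ps; rewrite (bigD1 s) //= Ps lerDl sumr_ge0.
  case/or3P => /and4P[a1 a2 l1 l2].
  - rewrite -[leLHS]addr0 -[leLHS]addr0; apply: lerD; first apply: lerD; try exact: sumr_ge0.
    by apply: (tot _ (phi y z)); rewrite !inE /= a1 a2 l1 l2 !eqxx.
  - rewrite -[leLHS]add0r -[leLHS]addr0; apply: lerD; first apply: lerD; try exact: sumr_ge0.
    apply: (tot _ (phi x z)); rewrite !inE /= (negPf (o_asym a1)) a2 !eqxx /=.
    by rewrite [phi x y]phi_sym l1 l2.
  - rewrite -[leLHS]add0r -[X in X + _ <= _]addr0; apply: lerD; first apply: lerD;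
    try exact: sumr_ge0.
    apply: (tot _ (phi x y)); rewrite !inE /= (negPf (o_asym a1)) (negPf (o_asym a2)) !eqxx /=.
    by rewrite [phi x z]phi_sym [phi y z]phi_sym l1 l2.
apply: le_trans split _.
pose q (s : 'I_k) := d (true, s) + d (false, s).
have q0 s : 0 <= q s by rewrite addr_ge0.
have q1 : \sum_s q s = 1.
  by rewrite -d1 sum_pair big_bool /= -big_split.
have DSe s : D (Se s) = q s.
  rewrite /D /q big_set /= big_mkcond sum_pair big_bool /=.
  by congr (_ + _); rewrite -big_mkcond big_pred1_eq.
have DSp s : D (Sp true s) + D (Sp false s) = \sum_(i < k | (s < i)%N) q i.
  rewrite /D /q !big_set /= ![\sum_(i | _ && _) _]big_mkcond !sum_pair !big_bool /=.
by rewrite !big1_eq addr0 add0r big_split /= -!big_mkcond.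
(* For q the colour density and F, G the forward and backward densities above colour s, the
   three possible sources contribute q F^2 + q F G + q G^2 <= q (F + G)^2. *)
apply: (@le_trans _ _ (\sum_s ((q s * (\sum_(i < k | (s < i)%N) q i) ^+ 2) + 18 * k%:R * e) * M)).
  apply: ler_sum => s _; have := TB (Sp true s) (Sp true s) (Se s).
  have := TB (Sp false s) (Se s) (Sp true s); have := TB (Se s) (Sp false s) (Sp false s).
  rewrite -DSp DSe; have /andP[f0 _] := D01 (Sp true s); have /andP[b0 _] := D01 (Sp false s).
  move: f0 b0; set F := D (Sp true s); set G := D (Sp false s) => F0 G0.
  have : 0 <= q s * (F * G) * M by rewrite !mulr_ge0.
  move: (T _ _ _) (T _ _ _) (T _ _ _) => t1 t2 t3.
  rewrite !(mulrDl _ _ M) => h p1 p2 p3.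
  have -> : q s * (F + G) ^+ 2 * M =
    F * F * q s * M + G * q s * F * M + q s * G * G * M + q s * (F * G) * M by ring.
  move: h p1 p2 p3; lra.
rewrite -mulr_suml ler_wpM2r // big_split /= sumr_const card_ord.
rewrite -[(18 * k%:R * e) *+ k]mulr_natl.
have := tail_square_le q0; rewrite q1 expr1n; have := sum_cube_ge q0 q1.
have -> : k%:R * (18 * k%:R * e) = 18 * k%:R ^+ 2 * e by ring.
lra.
Qed.

End PatternBound.
End Pattern.

(** * Parts with nearly equal colour densities *)

Section ColourParts.
Context (R : archiRealFieldType).

Lemma pair_density_shift (V : finType) (u v : V -> R) (h : V -> V -> R) (A B X Y : {set V})
    (p d a b : R) :
  (forall x, 0 <= u x) -> (forall x, 0 <= v x) -> X \subset A -> Y \subset B ->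
  `|\sum_(x in X) \sum_(y in Y) u x * v y * (h x y - p)| <= a * (mass u A * mass v B) ->
  `|p - d| <= b ->
  `|\sum_(x in X) \sum_(y in Y) u x * v y * (h x y - d)| <= (a + b) * (mass u A * mass v B).
Proof.
move=> u0 v0 XA YB h1 pd; rewrite mulrDl.
have -> : \sum_(x in X) \sum_(y in Y) u x * v y * (h x y - d) =
    \sum_(x in X) \sum_(y in Y) u x * v y * (h x y - p) + (p - d) * (mass u X * mass v Y).
  rewrite /mass big_distrlr /= mulr_sumr -big_split; apply: eq_bigr => x _ /=.
  by rewrite mulr_sumr -big_split; apply: eq_bigr => y _ /=; ring.
apply: le_trans (ler_normD _ _) _; apply: lerD => //.
have m0 : 0 <= mass u X * mass v Y by rewrite mulr_ge0 ?mass_ge0.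
by rewrite normrM (ger0_norm m0) ler_pM // ler_pM ?mass_ge0 ?mass_sub.
Qed.

Lemma truncn_eq_dist (M : nat) (p q : R) : (0 < M)%N -> 0 <= p -> 0 <= q ->
  Num.truncn (p * M%:R) = Num.truncn (q * M%:R) -> `|p - q| <= M%:R^-1.
Proof.
move=> M0 p0 q0 E.
have MR : 0 < M%:R :> R by rewrite ltr0n.
have /andP[p1 p2] := truncn_itv (mulr_ge0 p0 (ltW MR)).
have /andP[q1 q2] := truncn_itv (mulr_ge0 q0 (ltW MR)).
rewrite -E in q1 q2; move: p2 q2; rewrite -natr1 => p2 q2.
rewrite -[M%:R^-1]mul1r ler_pdivlMr // -[X in _ * X](ger0_norm (ltW MR)) -normrM mulrBl.
rewrite ler_norml; lra.
Qed.

Lemma pairwise_sorted (t : nat) (r : rel 'I_t) (T : seq 'I_t) :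
  subseq T (enum 'I_t) -> pairwise r T ->
  forall i j, i \in T -> j \in T -> (i < j)%N -> r i j.
Proof.
move=> sT.
have : pairwise (fun i j : 'I_t => i < j)%N T.
  apply: subseq_pairwise sT _.
  have : pairwise (fun i j => i < j)%N (map val (enum 'I_t)).
    by rewrite val_enum_ord; rewrite -(sorted_pairwise ltn_trans) iota_ltn_sorted.
  by rewrite pairwise_map.
elim: T {sT} => [//|x T IH] /= /andP[/allP xT pT] /andP[/allP rx pr] i j.
rewrite !inE => /orP[/eqP->|iT] /orP[/eqP->|jT] ij.
- by rewrite ltnn in ij.
- exact: rx.
- by have := ltn_trans ij (xT _ iT); rewrite ltnn.
- exact: IH.
Qed.

Lemma box3_cst3 (V : finType) (u v w : V -> R) (h : V -> V -> R) (X Y Z : {set V}) :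
  box3 u v w (fun x y _ => h x y) X Y Z =
  (\sum_(x in X) \sum_(y in Y) u x * v y * h x y) * mass w Z.
Proof.
rewrite /box3 mulr_suml; apply: eq_bigr => x _; rewrite mulr_suml; apply: eq_bigr => y _.
by rewrite /mass mulr_sumr; apply: eq_bigr => z _; ring.
Qed.

(** Once all pairs of parts are regular for every colour, their density vectors rounded to multiples
    of [1/M] form a finite set of Ramsey colours. Both [t] and [c] are fixed before the vertex set,
    since they determine the size and the accuracy of the sample. *)
Lemma colour_parts (k : nat) (e : R) (n : nat) : (0 < k)%N -> 0 < e ->
  exists (t : nat) (c : R), 0 < c <= 1 /\
  forall (V : finType) (E : {set {set V}}) (W : {set V}) (u : 'I_t -> V -> R),
    (forall i, is_prob (u i)) -> (forall i x, x \notin W -> u i x = 0) ->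
    admissible_on k E W ->
  exists T : seq 'I_t, [/\ subseq T (enum 'I_t), size T = n &
    forall i j l, i \in T -> j \in T -> l \in T -> (i < j)%N -> (j < l)%N ->
    exists A B C : {set V}, [/\ c <= mass (u i) A, c <= mass (u j) B, c <= mass (u l) C &
      box3 (u i) (u j) (u l) (fun x y z => ([set x; y; z] \in E)%:R) A B C <=
      ((1 - k%:R ^- 2) / 3 + 18 * k%:R ^+ 2 * e) *
        (mass (u i) A * mass (u j) B * mass (u l) C)]].
Proof.
move=> k0 e0.
pose M := (Num.bound (2 / e)).+1.
have M0 : (0 < M)%N by [].
have Me : M%:R^-1 <= e / 2.
  rewrite -[leRHS]invrK lef_pV2 ?posrE ?ltr0n ?invr_gt0 ?divr_gt0 // invf_div.
  apply: le_trans (ltW (archi_boundP _)) _; first by rewrite divr_ge0 // ltW.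
  by rewrite ler_nat.
pose L := {ffun bool * 'I_k -> 'I_M.+1} : finType.
have L0 : (0 < #|L|)%N by rewrite card_ffun expn_gt0 card_ord.
have [t ram] := ramsey n L0.
pose Q := ({p : 'I_t * 'I_t | (p.1 < p.2)%N} * (bool * 'I_k))%type : finType.
have e40 : 0 < e / 4 by rewrite divr_gt0.
have [c [c01 reg]] := regularity #|Q| e40.
exists t, c; split=> // V E W u pu uW [ o [phi [phi_sym o_asym patP]]].
(* Regularity of pairs is deduced from that of triples by a dummy third part [None] of constant
   weight 1, on which [f] does not depend. *)
pose u' (i : option 'I_t) (x : V) : R := if i is Some j then u j x else 1.
have u'0 i x : 0 <= u' i x by case: i => [i|] //=; case: (pu i).
pose f (q : Q) x y (z : V) : R := (colour o phi x y == q.2)%:R.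
have f01 q x y z : 0 <= f q x y z <= 1 by rewrite ler0n lern1 leq_b1.
have dist (q : Q) : [/\ Some (val q.1).1 != Some (val q.1).2, Some (val q.1).2 != None &
    Some (val q.1).1 != None].
  split=> //; apply/eqP => -[E0]; have := valP q.1.
  by rewrite /= E0 ltnn.
have [B [BP regB]] := reg _ V Q u' (fun q => Some (val q.1).1) (fun q => Some (val q.1).2)
  (fun=> None) f u'0 f01 dist (enum Q) (eq_leq (esym (cardE Q))) (fun=> setT).
have [P PP] := fin_all_exists (fun q => regB q (mem_enum Q q)).
(* Only pairs with [i < j] carry information; the default label is harmless because [T] is a
   subsequence of the increasing enumeration. *)
pose lab (i j : 'I_t) : L := if insub (i, j) is Some p
  then [ffun s => inord (Num.truncn (P (p, s) * M%:R))] else [ffun=> ord0].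
have [l0 [T [sT szT pT]]] := ram _ lab (enum 'I_t) (eq_leq (esym (size_enum_ord t))).
exists T; split=> // i j l iT jT lT ij jl.
have il := ltn_trans ij jl.
have mass_setT a : mass (u a) setT = 1.
  by case: (pu a) => _ <-; apply: eq_bigl => x; rewrite inE.
have mB a : c <= mass (u a) (B (Some a)).
  by have [_] := BP (Some a); rewrite -[mass (u' _) setT]/(mass (u a) setT) mass_setT mulr1.
have c0 : 0 < c by case/andP: c01.
have mBN : 0 < mass (u' None) (B None).
  have [_] := BP None; apply: lt_le_trans;
    rewrite mulr_gt0 // /mass sumr_const -mulr_natl mulr1 ltr0n.
  rewrite cardsT; apply/card_gt0P.
  have [_] := pu i; case: (pickP (fun _ : V => true)) => [x _ _|V0]; first by exists x.
  by rewrite big1 => [/eqP|x]; [rewrite eq_sym oner_eq0|have := V0 x].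
pose pr (a b : 'I_t) (ab : (a < b)%N) : {p : 'I_t * 'I_t | (p.1 < p.2)%N} := exist _ (a, b) ab.
have pairB (a b : 'I_t) (ab : (a < b)%N) s (X Y : {set V}) : X \subset B (Some a) ->
  Y \subset B (Some b) ->
    `|\sum_(x in X) \sum_(y in Y) u a x * u b y * ((colour o phi x y == s)%:R - P (pr a b ab, s))|
      <= e / 4 * (mass (u a) (B (Some a)) * mass (u b) (B (Some b))).
  move=> XB YB; have [_ /(_ X Y (B None) XB YB (subxx _))] := PP (pr a b ab, s).
  rewrite box3_cst3 mulrA -mulrBl normrM [leRHS]mulrA (ger0_norm (ltW mBN)) ler_pM2r //.
  congr (`|_| <= _); rewrite /= /mass big_distrlr /= mulr_sumr -sumrB; apply: eq_bigr => x _.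
  by rewrite mulr_sumr -sumrB; apply: eq_bigr => y _; ring.
have P01 q : 0 <= P q <= 1 by case: (PP q).
have labE (a b : 'I_t) (ab : (a < b)%N) : a \in T -> b \in T -> forall s,
    Num.truncn (P (pr a b ab, s) * M%:R) = l0 s.
  move=> aT bT s; have /eqP <- := pairwise_sorted sT pT aT bT ab.
  rewrite /lab; have -> : insub (a, b) = Some (pr a b ab) by rewrite insubT.
  rewrite ffunE inordK // truncn_lt_nat ?mulr_ge0 //; last by case/andP: (P01 (pr a b ab, s)).
  apply: (@le_lt_trans _ _ M%:R); last by rewrite ltr_nat.
  by rewrite ler_piMl //; case/andP: (P01 (pr a b ab, s)).
have mp a : 0 < mass (u a) (B (Some a)) by exact: lt_le_trans (mB a).
set mi := mass (u i) (B (Some i)); set mj := mass (u j) (B (Some j)).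
have mij : 0 < mi * mj by rewrite mulr_gt0 ?mp.
have u0 a x : 0 <= u a x by case: (pu a).
(* The true densities of the pair [i], [j] are taken rather than the regularity constants [P]: they
   sum to exactly 1. *)
pose d s := (\sum_(x in B (Some i)) \sum_(y in B (Some j))
  u i x * u j y * (colour o phi x y == s)%:R) / (mi * mj).
have d0 s : 0 <= d s.
  by rewrite divr_ge0 ?(ltW mij) //; do 2 (apply: sumr_ge0 => ? _); rewrite !mulr_ge0.
have d1 : \sum_s d s = 1.
  rewrite -mulr_suml; apply: (canLR (mulfK (lt0r_neq0 mij))); rewrite mul1r /mi /mj /mass.
  rewrite big_distrlr exchange_big /=; apply: eq_bigr => x _.
  rewrite exchange_big /=; apply: eq_bigr => y _.
  rewrite (bigD1 (colour o phi x y)) //= eqxx mulr1 big1 ?addr0 // => s /negPf.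
  by rewrite eq_sym => ->; rewrite mulr0.
have dij s : `|P (pr i j ij, s) - d s| <= e / 4.
  have := pairB i j ij s _ _ (subxx _) (subxx _).
  have -> : \sum_(x in B (Some i)) \sum_(y in B (Some j))
      u i x * u j y * ((colour o phi x y == s)%:R - P (pr i j ij, s)) =
      (d s - P (pr i j ij, s)) * (mi * mj).
    rewrite mulrBl divfK ?lt0r_neq0 // /mi /mj /mass [in RHS]big_distrlr /= mulr_sumr -sumrB.
    by apply: eq_bigr => x _; rewrite mulr_sumr -sumrB; apply: eq_bigr => y _; ring.
  by rewrite normrM (ger0_norm (ltW mij)) ler_pM2r // distrC.
(* [e / 2] for the rounding, since [1/M <= e / 2], and [e / 4] for replacing [P] by [d] on the pair
   [i], [j]; the last [e / 4] of the budget is the regularity error. *)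
have dab (a b : 'I_t) (ab : (a < b)%N) s : a \in T -> b \in T ->
  `|P (pr a b ab, s) - d s| <= 3 * e / 4.
  move=> aT bT.
  have /andP[p0 _] := P01 (pr a b ab, s); have /andP[q0 _] := P01 (pr i j ij, s).
  have := truncn_eq_dist M0 p0 q0; rewrite (labE a b) // (labE i j) // => /(_ erefl) h.
  have := ler_distD (P (pr i j ij, s)) (P (pr a b ab, s)) (d s); have := dij s; lra.
have pairD (a b : 'I_t) (ab : (a < b)%N) s (X Y : {set V}) : a \in T -> b \in T ->
    X \subset B (Some a) -> Y \subset B (Some b) ->
    `|\sum_(x in X) \sum_(y in Y) u a x * u b y * ((colour o phi x y == s)%:R - d s)|
      <= e * (mass (u a) (B (Some a)) * mass (u b) (B (Some b))).
  move=> aT bT XB YB; have := pairB a b ab s X Y XB YB.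
  move=> /(pair_density_shift (u0 a) (u0 b) XB YB)/(_ (dab a b ab s aT bT)).
  by rewrite (_ : e / 4 + 3 * e / 4 = e) //; field.
exists (B (Some i)), (B (Some j)), (B (Some l)); split=> //.
apply: (pattern_bound phi_sym o_asym patP (ltW e0) (u0 i) (u0 j) (u0 l) (uW i) (uW j) (uW l) d0 d1).
- by move=> s X Y XB YB; exact: (pairD i j).
- by move=> s X Y XB YB; exact: (pairD i l).
- by move=> s X Y XB YB; exact: (pairD j l).
Qed.

End ColourParts.

(** * Trimming the parts and averaging *)

Definition density3 (R : archiRealFieldType) (V : finType) (f : V -> V -> V ->
  R) (X Y Z : {set V}) : R :=
  box3 (fun=> 1) (fun=> 1) (fun=> 1) f X Y Z / (#|X|%:R * #|Y|%:R * #|Z|%:R).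

Definition set_average (R : archiRealFieldType) (V : finType) (Q : {set V} -> R) : Prop :=
  exists h : V -> R, forall X : {set V}, (0 < #|X|)%N -> Q X = (\sum_(x in X) h x) / #|X|%:R.

Section Averaging.
Context (R : archiRealFieldType).

(** Deleting an element whose value is at least the average does not raise the average. *)
Lemma subset_avg (V : finType) (h : V -> R) (s : nat) (A : {set V}) :
  (0 < s)%N -> (s <= #|A|)%N -> exists X : {set V}, [/\ X \subset A, #|X| = s &
    (\sum_(x in X) h x) / s%:R <= (\sum_(x in A) h x) / #|A|%:R].
Proof.
move=> s0; move: {2}(#|A| - s)%N (erefl (#|A| - s)%N) => n.
elim: n A => [|n IH] A hn sA.
  have As : #|A| = s by apply/eqP; rewrite eqn_leq sA andbT -subn_eq0 hn.
  by exists A; rewrite As.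
set S := \sum_(x in A) h x.
have a0 : 0 < #|A|%:R :> R by rewrite ltr0n (leq_trans s0).
have [x xA hx] : exists2 x, x \in A & S / #|A|%:R <= h x.
  case: (pickP [pred x in A | S / #|A|%:R <= h x]) => [x /andP[xA hx]|no]; first by exists x.
  exfalso; have : S < \sum_(x in A) S / #|A|%:R.
    have /card_gt0P [y yA] : (0 < #|A|)%N by apply: leq_trans sA.
    rewrite {1}/S (bigD1 y) //= [ltRHS](bigD1 y) //= ltr_leD //.
      by have := no y; rewrite /= yA /= => /negbT; rewrite -ltNge.
    apply: ler_sum => z /andP[zA _].
    by have := no z; rewrite /= zA /= => /negbT; rewrite -ltNge => /ltW.
  by rewrite sumr_const -[_ *+ #|A|]mulr_natr divfK ?ltxx // lt0r_neq0.
have cA : #|A| = #|A :\ x|.+1 by rewrite (cardsD1 x) xA.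
have sA' : (s <= #|A :\ x|)%N by lia.
have [|X [XA Xs hX]] := IH (A :\ x) _ sA'; first by lia.
exists X; split=> //; first exact: subset_trans XA (subsetDl _ _).
apply: le_trans hX _.
have a'0 : 0 < #|A :\ x|%:R :> R by rewrite ltr0n; lia.
have SE : S = h x + \sum_(y in A :\ x) h y by rewrite /S (big_setD1 x).
rewrite ler_pdivrMr // mulrAC ler_pdivlMr //.
move: hx; rewrite ler_pdivrMr // SE cA -natr1; set T := \sum_(y in _) _.
move: a'0; set a := #|_|%:R; move=> a'0; lra.
Qed.

Lemma set_average_cst (V : finType) (c : R) : set_average (fun _ : {set V} => c).
Proof.
exists (fun=> c) => X X0; rewrite sumr_const -[_ *+ #|X|]mulr_natr mulfK //.
by rewrite pnatr_eq0 -lt0n.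
Qed.

Lemma set_average_sum (V T : finType) (Q : T -> {set V} -> R) :
  (forall t, set_average (Q t)) -> set_average (fun X => \sum_t Q t X).
Proof.
move=> qQ; have [h hP] := fin_all_exists qQ.
exists (fun x => \sum_t h t x) => X X0; rewrite exchange_big mulr_suml.
by apply: eq_bigr => t _; rewrite hP.
Qed.

Section Dens.
Context (V : finType) (f : V -> V -> V -> R).

Lemma density3_average1 Y Z : set_average (fun X => density3 f X Y Z).
Proof.
exists (fun x => (\sum_(y in Y) \sum_(z in Z) f x y z) / (#|Y|%:R * #|Z|%:R)) => X X0.
rewrite /density3 -mulr_suml -[RHS]mulrA -invfM; congr (_ / _); last by ring.
apply: eq_bigr => x _; apply: eq_bigr => y _; apply: eq_bigr => z _; ring.
Qed.

Lemma density3_average2 X Z : set_average (fun Y => density3 f X Y Z).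
Proof.
exists (fun y => (\sum_(x in X) \sum_(z in Z) f x y z) / (#|X|%:R * #|Z|%:R)) => Y Y0.
rewrite /density3 -mulr_suml -[RHS]mulrA -invfM; congr (_ / _); last by ring.
rewrite /box3 exchange_big.
apply: eq_bigr => x _; apply: eq_bigr => y _; apply: eq_bigr => z _; ring.
Qed.

Lemma density3_average3 X Y : set_average (fun Z => density3 f X Y Z).
Proof.
exists (fun z => (\sum_(x in X) \sum_(y in Y) f x y z) / (#|X|%:R * #|Y|%:R)) => Z Z0.
rewrite /density3 -mulr_suml -[RHS]mulrA -invfM; congr (_ / _).
rewrite /box3 [RHS]exchange_big /=; apply: eq_bigr => x _; rewrite [RHS]exchange_big /=.
apply: eq_bigr => y _; apply: eq_bigr => z _; ring.
Qed.

End Dens.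

(* The total density is affine in each part separately, so the parts can be trimmed one at a
  time. *)
Lemma equalize (I V T : finType) (ci cj cl : T -> I) (f : T -> V -> V -> V -> R)
    (A : I -> {set V}) (s : nat) : (0 < s)%N ->
    (forall t, [/\ ci t != cj t, cj t != cl t & ci t != cl t] \/ forall x y z, f t x y z = 0) ->
    (forall i, (s <= #|A i|)%N) ->
  exists A' : I -> {set V}, [/\ forall i, A' i \subset A i, forall i, #|A' i| = s &
    \sum_t density3 (f t) (A' (ci t)) (A' (cj t)) (A' (cl t)) <=
    \sum_t density3 (f t) (A (ci t)) (A (cj t)) (A (cl t))].
Proof.
move=> s0 dist sA.
pose Psi (B : I -> {set V}) := \sum_t density3 (f t) (B (ci t)) (B (cj t)) (B (cl t)).
pose set1 (B : I -> {set V}) i X j := if j == i then X else B j.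
have Psi_avg (B : I -> {set V}) i : set_average (fun X => Psi (set1 B i X)).
  apply: (set_average_sum (Q := fun t X => density3 (f t) (set1 B i X (ci t)) (set1 B i X (cj t))
    (set1 B i X (cl t)))) => t; rewrite /set1.
  have [[dij djl dil]|f0] := dist t; last first.
    exists (fun=> 0) => X _; rewrite big1 // mul0r /density3 /box3 big1 ?mul0r // => x _.
    by rewrite big1 // => y _; rewrite big1 // => z _; rewrite f0 mulr0.
  have [<-|_] := eqVneq (ci t) i.
    by rewrite eq_sym (negPf dij) eq_sym (negPf dil); exact: density3_average1.
  have [<-|_] := eqVneq (cj t) i.
    by rewrite eq_sym (negPf djl); exact: density3_average2.
  have [_|_] := eqVneq (cl t) i; first exact: density3_average3.
  exact: set_average_cst.
suff H (L : seq I) : exists A' : I -> {set V},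
    [/\ forall j, A' j \subset A j, forall j, (s <= #|A' j|)%N,
        forall j, j \in L -> #|A' j| = s & Psi A' <= Psi A].
  by have [A' [h1 _ h2 h3]] := H (enum I); exists A'; split=> // i; apply: h2; rewrite mem_enum.
elim: L => [|i L [A' [sub sA' eA' le]]]; first by exists A.
have [h hP] := Psi_avg A' i.
have [X [XA Xs hX]] := subset_avg h s0 (sA' i).
exists (set1 A' i X); split=> [j|j|j|].
- by rewrite /set1; case: eqP => // ->; apply: subset_trans XA _.
- by rewrite /set1; case: eqP => // _; rewrite Xs.
- by rewrite /set1 inE; case: eqP => //= _; exact: eA'.
apply: le_trans le; rewrite hP ?Xs //.
have E : Psi (set1 A' i (A' i)) = Psi A'.
  by apply: eq_bigr => t _; congr density3; rewrite /set1; case: eqP => [->|].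
by rewrite -E hP // (leq_trans s0).
Qed.

Definition edge_ind (V : finType) (E : {set {set V}}) (x y z : V) : R := ([set x; y; z] \in E)%:R.

(** After trimming, all triples of parts have equal weight in the union [U], and [U] is large enough
    for the density hypothesis. Trimming may spoil the bound [q] for a single triple of parts but
    not for the sum, and only the sum matters. In [6 / n], one 3 accounts for triples meeting a part
    twice, the other for the term [3 * #|U|%:R ^+ 2]. Setting [f] to zero on repeated indices keeps
    the sum affine in each part. *)
Lemma averaging (I V : finType) (E : {set {set V}}) (A : I -> {set V}) (T : {set I})
    (s n : nat) (d q : R) :
  #|T| = n -> (0 < n)%N -> (0 < s)%N -> 0 <= q -> d <= 1 ->
  (forall i j, i != j -> [disjoint A i & A j]) -> (forall i, (s <= #|A i|)%N) ->
  (forall i j l, i \in T -> j \in T -> l \in T -> i != j -> j != l -> i != l ->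
     density3 (edge_ind E) (A i) (A j) (A l) <= q) ->
  (forall U : {set V}, (n * s <= #|U|)%N ->
     d * (#|U|%:R ^+ 3 - 3 * #|U|%:R ^+ 2) <=
     \sum_(x in U) \sum_(y in U) \sum_(z in U) edge_ind E x y z) ->
  d - q <= 6 / n%:R.
Proof.
move=> Tn n0 s0 q0 d1 dis sA hq hU.
pose D (t : I * I * I) := [&& t.1.1 \in T, t.1.2 \in T, t.2 \in T, t.1.1 != t.1.2,
  t.1.2 != t.2 & t.1.1 != t.2].
pose f (t : I * I * I) x y z : R := if D t then edge_ind E x y z else 0.
have dist (t : I * I * I) : [/\ t.1.1 != t.1.2, t.1.2 != t.2 & t.1.1 != t.2] \/
    forall x y z, f t x y z = 0.
  rewrite /f; case: (boolP (D t)); last by right.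
  by case/and5P => _ _ _ ? /andP[? ?]; left.
have [A' [sub cA' le]] := equalize s0 dist sA.
have le_q : \sum_t density3 (f t) (A' t.1.1) (A' t.1.2) (A' t.2) <= n%:R ^+ 3 * q.
  apply: le_trans le _.
  apply: (@le_trans _ _ (\sum_(t : I * I * I | [&& t.1.1 \in T, t.1.2 \in T & t.2 \in T]) q)).
    rewrite [leRHS]big_mkcond; apply: ler_sum => t _ /=.
    case: (boolP (D t)) => [Dt|nD].
      case/and5P: (Dt) => t1 t2 t3 h1 /andP[h2 h3]; rewrite t1 t2 t3 /=.
      by rewrite /density3 /box3 /f Dt; apply: hq.
    rewrite /density3 /box3 big1 ?mul0r; first by case: ifP.
    move=> x _; rewrite big1 // => y _; rewrite big1 // => z _.
    by rewrite /f (negPf nD) mulr0.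
  rewrite sumr_const -[_ *+ _]mulr_natl; apply: ler_wpM2r => //.
  rewrite -natrX ler_nat.
  apply: (@leq_trans #|setX (setX T T) T|); last by rewrite !cardsX Tn !expnS expn0; lia.
  by apply/subset_leq_card/subsetP => -[[a b] c] /and3P[/= aT bT cT]; rewrite !inE /= aT bT cT.
pose F i := if i \in T then A' i else set0.
have disF i j : i != j -> [disjoint F i & F j].
  move=> ij; rewrite /F; case: ifP => _; last by rewrite disjoints_subset sub0set.
  case: ifP => _; last by rewrite disjoint_sym disjoints_subset sub0set.
  by apply: disjointWl (sub i) _; apply: disjointWr (sub j) _; exact: dis.
pose U := \bigcup_i F i.
have sumU (h : V -> R) : \sum_(x in U) h x = \sum_(i in T) \sum_(x in A' i) h x.
  rewrite (partition_disjoint_bigcup +%R h disF) [RHS]big_mkcond; apply: eq_bigr => i _.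
  by rewrite /F; case: ifP => // _; rewrite big_set0.
have cU : #|U|%:R = n%:R * s%:R :> R.
  rewrite -sum1_card natr_sum (sumU (fun=> 1)) (eq_bigr (fun=> s%:R)) => [|i _].
    by rewrite sumr_const Tn mulr_natl.
  by rewrite sumr_const cA'.
have cUn : #|U| = (n * s)%N by apply/eqP; rewrite -(eqr_nat R) natrM cU.
have := hU U; rewrite cUn leqnn natrM => /(_ isT) {}hU.
have s3 : 0 < s%:R ^+ 3 :> R by rewrite exprn_gt0 // ltr0n.
have up : \sum_(x in U) \sum_(y in U) \sum_(z in U) edge_ind E x y z <=
    s%:R ^+ 3 * (n%:R ^+ 3 * q + 3 * n%:R ^+ 2).
  rewrite sumU; under eq_bigr => i _ do under eq_bigr => x _ do rewrite sumU.
  under eq_bigr => i _ do rewrite exchange_big.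
  under eq_bigr => i _ do under eq_bigr => j _ do under eq_bigr => x _ do
    under eq_bigr => y _ do rewrite sumU.
  under eq_bigr => i _ do under eq_bigr => j _ do under eq_bigr => x _ do rewrite exchange_big.
  under eq_bigr => i _ do under eq_bigr => j _ do rewrite exchange_big /=.
  pose col (a b : I) : R := (a == b)%:R.
  apply: (@le_trans _ _ (\sum_(i in T) \sum_(j in T) \sum_(l in T)
      s%:R ^+ 3 * (density3 (f (i, j, l)) (A' i) (A' j) (A' l) + (col i j + col j l + col i l)))).
    apply: ler_sum => i iT; apply: ler_sum => j jT; apply: ler_sum => l lT.
    have c1 : \sum_(x in A' i) \sum_(y in A' j) \sum_(z in A' l) edge_ind E x y z <= s%:R ^+ 3.
      apply: (@le_trans _ _ (\sum_(x in A' i) \sum_(y in A' j) \sum_(z in A' l) 1)).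
        by do 3 (apply: ler_sum => ? _); rewrite lern1 leq_b1.
      by rewrite !sumr_const !cA' -!mulrnA -natrX ler_nat !expnS expn0; lia.
    have fd : density3 (f (i, j, l)) (A' i) (A' j) (A' l) =
        if D (i, j, l) then (\sum_(x in A' i) \sum_(y in A' j) \sum_(z in A' l) edge_ind E x y z)
          / s%:R ^+ 3
        else 0.
      rewrite /density3 !cA' /box3 /f; case: ifP => _.
        congr (_ / _); last by ring.
        by apply: eq_bigr => x _; apply: eq_bigr => y _; apply: eq_bigr => z _; rewrite !mul1r.
      rewrite big1 ?mul0r // => x _; rewrite big1 // => y _; rewrite big1 // => z _.
      by rewrite mulr0.
    rewrite fd /D /= iT jT lT /= /col.
    have [_|_] := eqVneq i j => /=; last have [_|_] := eqVneq j l => /=;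
      last have [_|_] := eqVneq i l => /=.
    - apply: le_trans c1 _; rewrite add0r ler_peMr ?(ltW s3) //.
      by rewrite -addrA lerDl addr_ge0 ?ler0n.
    - apply: le_trans c1 _; rewrite add0r ler_peMr ?(ltW s3) //.
      by rewrite add0r lerDl.
    - by apply: le_trans c1 _; rewrite !add0r mulr1.
    - by rewrite !addr0 mulrC divfK // lt0r_neq0.
  under eq_bigr => i _ do under eq_bigr => j _ do rewrite -mulr_sumr.
  under eq_bigr => i _ do rewrite -mulr_sumr.
  rewrite -mulr_sumr ler_wpM2l ?(ltW s3) //.
  under eq_bigr => i _ do under eq_bigr => j _ do rewrite big_split.
  under eq_bigr => i _ do rewrite big_split.
  rewrite big_split; apply: lerD.
    apply: le_trans le_q; rewrite !sum_pair big_mkcond; apply: ler_sum => i _ /=.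
    case: ifP => iT; last by apply: sumr_ge0 => j _; apply: sumr_ge0 => l _;
      rewrite /density3 /box3 /f /D /= iT;
      rewrite divr_ge0 ?mulr_ge0 //; do 3 (apply: sumr_ge0 => ? _); rewrite mulr0.
    rewrite big_mkcond; apply: ler_sum => j _ /=.
    case: ifP => jT; last by apply: sumr_ge0 => l _; rewrite /density3 /box3 /f /D /= iT jT;
      rewrite divr_ge0 ?mulr_ge0 //; do 3 (apply: sumr_ge0 => ? _); rewrite mulr0.
    rewrite big_mkcond; apply: ler_sum => l _ /=.
    case: ifP => lT //; rewrite /density3 /box3 /f /D /= iT jT lT.
    by rewrite divr_ge0 ?mulr_ge0 //; do 3 (apply: sumr_ge0 => ? _); rewrite mulr0.
  have cst (x : R) : \sum_(a in T) x = n%:R * x by rewrite sumr_const Tn mulr_natl.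
  have col1 a : a \in T -> \sum_(b in T) col a b = 1.
    move=> aT; rewrite (bigD1 a) //= /col eqxx big1 ?addr0 // => b /andP[_ /negPf].
    by rewrite eq_sym => ->.
  rewrite (eq_bigr (fun=> 3 * n%:R)) => [|i iT]; first by rewrite cst; lra.
  rewrite (eq_bigr (fun j => n%:R * col i j + 2)) => [|j jT].
    by rewrite big_split -mulr_sumr col1 // cst /=; ring.
  by rewrite !big_split /= !cst !col1 //; ring.
have := le_trans hU up.
have n3 : 0 < n%:R :> R by rewrite ltr0n.
have s1 : 1 <= s%:R :> R by rewrite ler1n.
rewrite ler_pdivlMr //.
move: n3 s1 s3; move: (n%:R : R) (s%:R : R) => a b a0 b1 b3 h.
have a20 : 0 < a ^+ 2 by rewrite exprn_gt0.
have h1 : d * (a ^+ 2 * b ^+ 2) <= a ^+ 2 * b ^+ 3.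
  apply: (@le_trans _ _ (1 * (a ^+ 2 * b ^+ 2))); first by rewrite ler_wpM2r // mulr_ge0 ?sqr_ge0.
  by rewrite mul1r ler_wpM2l ?sqr_ge0 // [b ^+ 3]exprSr ler_peMr ?sqr_ge0.
have h2 : (d - q) * a * (a ^+ 2 * b ^+ 3) <= 6 * (a ^+ 2 * b ^+ 3).
  have -> : (d - q) * a * (a ^+ 2 * b ^+ 3) = d * ((a * b) ^+ 3 - 3 * (a * b) ^+ 2)
    - b ^+ 3 * (a ^+ 3 * q + 3 * a ^+ 2) + 3 * (d * (a ^+ 2 * b ^+ 2)) +
      3 * (a ^+ 2 * b ^+ 3) by ring.
  move: h h1; lra.
by rewrite -(ler_pM2r (mulr_gt0 a20 b3)).
Qed.

End Averaging.

Section UniformParts.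
Context (R : archiRealFieldType).

Lemma mass_cst1 (V : finType) (A : {set V}) : mass (fun=> 1) A = #|A|%:R :> R.
Proof. by rewrite /mass sumr_const. Qed.

Definition uniform_on (V : finType) (A : {set V}) (x : V) : R := (x \in A)%:R / #|A|%:R.

Lemma uniform_on_prob (V : finType) (A : {set V}) : (0 < #|A|)%N -> is_prob (uniform_on A).
Proof.
move=> A0; split=> [x|]; first by rewrite divr_ge0.
rewrite -mulr_suml (eq_bigr (fun x => if x \in A then 1 else 0)) => [|x _]; last by case: ifP.
by rewrite -big_mkcond sumr_const divff // pnatr_eq0 -lt0n.
Qed.

(** The 8 comes from passing from test sets to test functions. *)
Lemma cut_energy_uniform (V : finType) (f : V -> V -> V -> R) (A B C : {set V}) (P e : R) :
  (0 < #|A|)%N -> (0 < #|B|)%N -> (0 < #|C|)%N ->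
  (forall x y z, `|f x y z - P| <= 1) ->
  regular3 e P (fun=> 1) (fun=> 1) (fun=> 1) f A B C ->
  cut_energy (uniform_on A) (uniform_on B) (uniform_on C) (fun x y z => f x y z - P) <= 8 * e.
Proof.
move=> A0 B0 C0 f1 reg.
have pA := uniform_on_prob A0; have pB := uniform_on_prob B0; have pC := uniform_on_prob C0.
apply: cut_energy_le => // a b c a1 b1 c1.
pose M : R := #|A|%:R * #|B|%:R * #|C|%:R.
have M0 : 0 < M by rewrite !mulr_gt0 // ltr0n.
have := @sum3_abs_le R V (fun x y z => uniform_on A x * uniform_on B y * uniform_on C z *
  (f x y z - P)) e _ a b c a1 b1 c1.
set S1 := \sum_x _; set S2 := \sum_x _.
have -> : S2 = S1.
  by do 3 (apply: eq_bigr => ? _); ring.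
move=> H; apply: le_trans (ler_norm _) _; apply: H => X Y Z.
have := reg (X :&: A) (Y :&: B) (Z :&: C) (subsetIr _ _) (subsetIr _ _) (subsetIr _ _).
rewrite !mass_cst1 -/M -ler_pdivrMr // -[X in _ / X](ger0_norm (ltW M0)) -normf_div.
congr (`|_| <= _).
have capE (h : V -> R) (X' A' : {set V}) : \sum_(x in X' :&: A') h x =
  \sum_(x in X') (x \in A')%:R * h x.
  rewrite [RHS](big_setID A') /= [X in _ = _ + X]big1 => [|x]; last first.
    by rewrite inE => /andP[/negPf-> _]; rewrite mul0r.
  by rewrite addr0; apply: eq_bigr => x; rewrite inE => /andP[_ ->]; rewrite mul1r.
have -> : box3 (fun=> 1) (fun=> 1) (fun=> 1) f (X :&: A) (Y :&: B) (Z :&: C)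
    - P * (#|X :&: A|%:R * #|Y :&: B|%:R * #|Z :&: C|%:R) =
  \sum_(x in X :&: A) \sum_(y in Y :&: B) \sum_(z in Z :&: C) (f x y z - P).
  rewrite -!mass_cst1 -mulrA /mass /box3 !mulr_suml mulr_sumr -sumrB; apply: eq_bigr => x _.
  rewrite !mul1r mulr_sumr -sumrB; apply: eq_bigr => y _.
  rewrite !mulr_sumr -sumrB; apply: eq_bigr => z _; ring.
rewrite capE mulr_suml; apply: eq_bigr => x _.
rewrite capE mulr_sumr mulr_suml; apply: eq_bigr => y _.
rewrite capE !mulr_sumr mulr_suml; apply: eq_bigr => z _.
by rewrite /uniform_on /M !invfM; ring.
Qed.

Lemma density3_perm (V : finType) (E : {set {set V}}) (X Y Z : {set V}) :
  (density3 (edge_ind R E) X Y Z =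
    density3 (edge_ind R E) Y X Z) * (density3 (edge_ind R E) X Y Z =
      density3 (edge_ind R E) X Z Y).
Proof.
have E1 x y z : edge_ind R E x y z = edge_ind R E y x z by rewrite /edge_ind [[set x; y]]setUC.
have E2 x y z : edge_ind R E x y z = edge_ind R E x z y by rewrite /edge_ind setUAC.
rewrite /density3 /box3; split; congr (_ / _); try ring.
  by rewrite [RHS]exchange_big /=; do 3 (apply: eq_bigr => ? _); rewrite E1.
apply: eq_bigr => x _; rewrite [RHS]exchange_big /=.
by do 2 (apply: eq_bigr => ? _); rewrite E2.
Qed.

Lemma distinct3_sorted (V : finType) (t : nat) (E : {set {set V}}) (A : 'I_t -> {set V})
    (T : {set 'I_t}) (q : R) :
  (forall i j l, i \in T -> j \in T -> l \in T -> (i < j)%N -> (j < l)%N ->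
    density3 (edge_ind R E) (A i) (A j) (A l) <= q) ->
  forall i j l, i \in T -> j \in T -> l \in T -> i != j -> j != l -> i != l ->
    density3 (edge_ind R E) (A i) (A j) (A l) <= q.
Proof.
move=> H i j l iT jT lT; rewrite -!(inj_eq val_inj) /= => ij jl il.
have P X Y Z := density3_perm E X Y Z.
case: (ltnP i j) => h1; [|have {}h1 : (j < i)%N by rewrite ltn_neqAle eq_sym ij].
all: case: (ltnP j l) => h2; [|have {}h2 : (l < j)%N by rewrite ltn_neqAle eq_sym jl].
all: case: (ltnP i l) => h3; [|have {}h3 : (l < i)%N by rewrite ltn_neqAle eq_sym il].
- exact: H.
- by lia.
- by rewrite (P (A i) (A j) (A l)).2; exact: H.
- by rewrite (P (A i) (A j) (A l)).2 (P (A i) (A l) (A j)).1; exact: H.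
- by rewrite (P (A i) (A j) (A l)).1; exact: H.
- by rewrite (P (A i) (A j) (A l)).1 (P (A j) (A i) (A l)).2; exact: H.
- by lia.
- rewrite (P (A i) (A j) (A l)).1 (P (A j) (A i) (A l)).2 (P (A j) (A l) (A i)).1; exact: H.
Qed.

Lemma sum_edge_ind (V : finType) (E : {set {set V}}) (U : {set V}) :
  (forall e, e \in E -> #|e| = 3%N) ->
  \sum_(x in U) \sum_(y in U) \sum_(z in U) edge_ind R E x y z =
    6 * #|[set e in E | e \subset U]|%:R.
Proof.
move=> E3; rewrite -natrM -(sum_ordered_triples U E3) natr_sum; apply: eq_bigr => x _.
by rewrite natr_sum; apply: eq_bigr => y _; rewrite natr_sum.
Qed.

Lemma dense_triples (V : finType) (E : {set {set V}}) (U : {set V}) (d : R) : 0 <= d ->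
  (forall e, e \in E -> #|e| = 3%N) ->
  d * 'C(#|U|, 3)%:R <= #|[set e in E | e \subset U]|%:R ->
  d * (#|U|%:R ^+ 3 - 3 * #|U|%:R ^+ 2) <=
    \sum_(x in U) \sum_(y in U) \sum_(z in U) edge_ind R E x y z.
Proof.
move=> d0 E3 h; rewrite sum_edge_ind //.
have C6 : #|U|%:R ^+ 3 - 3 * #|U|%:R ^+ 2 <= 6 * 'C(#|U|, 3)%:R :> R.
  have := bin_ffact #|U| 3; rewrite (_ : 3`! = 6)%N // mulnC => e.
  rewrite -natrM e; case: #|U| => [|[|u]] {e}.
  - by rewrite !expr0n mulr0 subr0.
  - by rewrite !expr1n mulr1; apply: (@le_trans _ _ 0); [lra|rewrite ler0n].
  rewrite !ffactnS ffactn0 /= !natrM -!natr1; move: (u%:R : R) (ler0n R u) => a a0.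
  rewrite -subr_ge0; set D := (X in 0 <= X); have -> : D = 2 * a + 4 by rewrite /D; ring.
  by rewrite addr_ge0 ?mulr_ge0.
by have := ler_wpM2l d0 C6; lra.
Qed.

Lemma card_residue (V : finType) (t i : nat) : (i < t)%N ->
  (#|V| %/ t <= #|[set x : V | (enum_rank x %% t == i)%N]|)%N.
Proof.
move=> it; set r := (#|V| %/ t)%N.
have lt (j : 'I_r) : (j * t + i < #|V|)%N.
  apply: (@leq_trans (r * t)); last exact: leq_trunc_div.
  have : (j.+1 * t <= r * t)%N by rewrite leq_mul2r ltn_ord orbT.
  by rewrite mulSn; lia.
pose g (j : 'I_r) : V := enum_val (Ordinal (lt j)).
have gI : injective g.
  move=> a b /enum_val_inj [] /eqP; rewrite eqn_add2r eqn_mul2r.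
  by case/orP => [/eqP t0|/eqP/val_inj //]; rewrite t0 in it.
rewrite -[leqLHS]card_ord -(card_imset predT gI) subset_leq_card //.
apply/subsetP => _ /imsetP[j _ ->]; rewrite inE enum_valK /=.
by rewrite modnMDl modn_small.
Qed.

End UniformParts.

(** * From a dense 3-graph to a bounded sample *)

Section UpperBound.
Context (R : archiRealFieldType).

Lemma le_double_divn (n t : nat) : (0 < n %/ t.+1)%N -> (n <= 2 * (t.+1 * (n %/ t.+1)))%N.
Proof.
move=> r0; have rt : (n %% t.+1 <= n %/ t.+1 * t.+1)%N.
  by apply: leq_trans (ltnW (ltn_pmod n (ltn0Sn t))) (leq_pmull _ r0).
by rewrite {1}(divn_eq n t.+1) mul2n -addnn [(t.+1 * _)%N]mulnC leq_add2l.
Qed.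

(** Two one-sided estimates suffice: [P] is nearly an upper bound for the density on the parts, and
    the sample has density nearly at least [P] on every box. On boxes whose sides have mass at least
    [c], the absolute error [tau * c ^+ 3] becomes a relative error [tau]. *)
Lemma dense_sample (t : nat) (tau c : R) : 0 < tau -> 0 < c ->
  exists (m : nat) (c1 : R), [/\ (0 < m)%N, 0 < c1 <= 1 &
  forall (V : finType) (E : {set {set V}}), (0 < Num.truncn (c1 * (#|V| %/ t.+1)%:R))%N ->
  exists (A : 'I_t -> {set V}) (w : 'I_t -> 'I_m -> V),
    [/\ forall i j, i != j -> [disjoint A i & A j],
        forall i, (Num.truncn (c1 * (#|V| %/ t.+1)%:R) <= #|A i|)%N &
        forall i j l : 'I_t, (i < j)%N -> (j < l)%N -> exists P : R,
          density3 (edge_ind R E) (A i) (A j) (A l) <= P + tau /\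
          forall X Y Z : {set V},
            P * (mass (empirical R (w i)) X * mass (empirical R (w j)) Y *
              mass (empirical R (w l)) Z)
            <= box3 (empirical R (w i)) (empirical R (w j)) (empirical R (w l)) (edge_ind R E) X Y Z
               + tau * c ^+ 3]].
Proof.
move=> tau0 c0.
(* The energy bounds the eighth power of a cut. Half of [z] is spent on regularity, [8 * e1] per
   triple of parts, and half on sampling, [12 * #|Q| / m] per part. *)
pose z := (tau * c ^+ 3) ^+ 8.
have z0 : 0 < z by rewrite exprn_gt0 // mulr_gt0 // exprn_gt0.
pose Q := {p : 'I_t * 'I_t * 'I_t | (p.1.1 < p.1.2)%N && (p.1.2 < p.2)%N} : finType.
have Q1 : 0 < #|Q|.+1%:R :> R by rewrite ltr0n.
pose e1 := Num.min tau (z / (16 * #|Q|.+1%:R)).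
have e10 : 0 < e1 by rewrite lt_min tau0 divr_gt0 // mulr_gt0.
have e1tau : e1 <= tau by rewrite ge_min lexx.
have e1z : #|Q|%:R * (8 * e1) <= z / 2.
  have : e1 <= z / (16 * #|Q|.+1%:R) by rewrite ge_min lexx orbT.
  rewrite ler_pdivlMr ?mulr_gt0 // -[#|Q|.+1%:R]natr1 => h.
  have : 0 <= #|Q|%:R * e1 by rewrite mulr_ge0 // ltW.
  move: h (ltW e10); move: (#|Q|%:R : R) => y; lra.
have [c1 [/andP[c10 c11] reg]] := regularity #|Q| e10.
pose m := (Num.bound (24 * t%:R * #|Q|%:R / z)).+1.
have m0 : (0 < m)%N by [].
have mz : t%:R * (12 * #|Q|%:R / m%:R) <= z / 2.
  have mR : 0 < m%:R :> R by rewrite ltr0n.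
  have : 24 * t%:R * #|Q|%:R / z <= m%:R.
    apply: le_trans (ltW (archi_boundP _)) _; last by rewrite ler_nat.
    by rewrite divr_ge0 ?mulr_ge0 // ltW.
  rewrite ler_pdivrMr // mulrA ler_pdivrMr //.
  move: (#|Q|%:R : R) (t%:R : R) (m%:R : R) => a b d; lra.
exists m, c1; split; rewrite ?c10 //.
move=> V E s0; set s := Num.truncn _ in s0 *.
pose B0 (i : 'I_t) := [set x : V | (enum_rank x %% t.+1 == i)%N].
have B0s i : (#|V| %/ t.+1 <= #|B0 i|)%N by apply: card_residue; rewrite ltnW // ltnS ltn_ord.
pose ci (q : Q) := (val q).1.1; pose cj (q : Q) := (val q).1.2; pose cl (q : Q) := (val q).2.
have dist (q : Q) : [/\ ci q != cj q, cj q != cl q & ci q != cl q].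
  have /andP[h1 h2] := valP q; rewrite -!(inj_eq val_inj) /=.
  by rewrite !neq_ltn h1 h2 (ltn_trans h1 h2).
have ind01 x y w : 0 <= edge_ind R E x y w <= 1 by rewrite ler0n lern1 leq_b1.
have [A [AP regA]] := reg _ V Q (fun=> (fun=> 1)) ci cj cl (fun=> edge_ind R E) (fun _ _ => ler01)
  (fun=> ind01) dist (enum Q) (eq_leq (esym (cardE Q))) B0.
have [P PP] := fin_all_exists (fun q => regA q (mem_enum Q q)).
have sA i : (s <= #|A i|)%N.
  have [_] := AP i; rewrite !mass_cst1 => h.
  rewrite -(ler_nat R); apply: le_trans h; apply: (@le_trans _ _ (c1 * (#|V| %/ t.+1)%:R)).
    by rewrite truncn_le mulr_ge0 // ltW.
  by rewrite ler_pM2l // ler_nat.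
have A0 i : (0 < #|A i|)%N by apply: leq_trans (sA i).
have f1 q x y w : `|edge_ind R E x y w - P q| <= 1.
  have [/andP[p0 p1] _] := PP q; have /andP[i0 i1] := ind01 x y w.
  by rewrite ler_norml; lra.
have [w hw] := exists_sample_energy m0 dist f1 (fun i => uniform_on_prob R (A0 i)).
exists A, w; split=> // [i j ij|i j l ij jl].
  have [si _] := AP i; have [sj _] := AP j.
  apply: disjointWl si _; apply: disjointWr sj _.
  rewrite disjoint_subset; apply/subsetP => x; rewrite !inE => /eqP->.
  by rewrite (inj_eq val_inj).
have qP : ((i, j, l).1.1 < (i, j, l).1.2)%N && ((i, j, l).1.2 < (i, j, l).2)%N by rewrite /= ij jl.
pose q : Q := exist _ (i, j, l) qP.
have [P01 regq] := PP q.
exists (P q); split.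
  have := regq _ _ _ (subxx _) (subxx _) (subxx _); rewrite !mass_cst1 /ci /cj /cl /= => h.
  rewrite /density3 ler_pdivrMr ?mulr_gt0 ?ltr0n //.
  have M0 : 0 <= #|A i|%:R * #|A j|%:R * #|A l|%:R :> R by rewrite !mulr_ge0.
  have := ler_wpM2r M0 e1tau.
  by move: h => /ler_normlP[_]; rewrite mulrDl; lra.
have pe a : is_prob (empirical R (w a)) by exact: empirical_prob.
have energyz : cut_energy (empirical R (w i)) (empirical R (w j)) (empirical R (w l))
    (fun x y v => edge_ind R E x y v - P q) <= z.
  apply: le_trans (_ : _ <= \sum_t0 cut_energy (empirical R (w (ci t0))) (empirical R (w (cj t0)))
    (empirical R (w (cl t0))) (fun x y z => edge_ind R E x y z - P t0)) _.
    rewrite [leRHS](bigD1 q) //= lerDl; apply: sumr_ge0 => q' _; exact: cut_energy_ge0.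
  apply: le_trans hw _; rewrite card_ord.
  suff : \sum_t0 cut_energy (uniform_on R (A (ci t0))) (uniform_on R (A (cj t0))) (uniform_on R
    (A (cl t0)))
    (fun x y z => edge_ind R E x y z - P t0) <= #|Q|%:R * (8 * e1) by move: e1z mz; lra.
  rewrite mulr_natl -sumr_const; apply: ler_sum => q' _.
  by apply: cut_energy_uniform => //; case: (PP q').
move=> X Y Z.
set mu := empirical R (w i) in energyz *; set mv := empirical R (w j) in energyz *.
set mw := empirical R (w l) in energyz *.
pose a (S : {set V}) x : R := (x \in S)%:R.
have a1 S x : `|a S x| <= 1 by rewrite /a normr_nat lern1 leq_b1.
have := le_trans (cut_le_energy _ (pe i) (pe j) (pe l) (a1 X) (a1 Y) (a1 Z)) energyz.
rewrite -/mu -/mv -/mw.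
have -> : \sum_x \sum_y \sum_v mu x * mv y * mw v * (a X x * a Y y * a Z v *
  (edge_ind R E x y v - P q)) =
    box3 mu mv mw (edge_ind R E) X Y Z - P q * (mass mu X * mass mv Y * mass mw Z).
  have aE (S : {set V}) (h : V -> R) : \sum_(x in S) h x = \sum_x a S x * h x.
    by rewrite big_mkcond; apply: eq_bigr => x _; rewrite /a; case: ifP; rewrite ?mul1r ?mul0r.
  transitivity (\sum_(x in X) \sum_(y in Y) \sum_(v in Z) mu x * mv y * mw v *
    (edge_ind R E x y v - P q)).
    rewrite aE; apply: eq_bigr => x _; rewrite aE mulr_sumr; apply: eq_bigr => y _.
    rewrite aE !mulr_sumr; apply: eq_bigr => v _; ring.
  rewrite -mulrA /mass /box3 !mulr_suml mulr_sumr -sumrB; apply: eq_bigr => x _.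
  rewrite !mulr_sumr -sumrB; apply: eq_bigr => y _.
  rewrite !mulr_sumr -sumrB; apply: eq_bigr => v _; ring.
set D := box3 _ _ _ _ _ _ _ - _ => h.
have : `|D| <= tau * c ^+ 3.
  rewrite -(@ler_pXn2r _ 8) ?nnegrE ?mulr_ge0 ?exprn_ge0 ?(ltW tau0) ?(ltW c0) //.
  by rewrite -normrX ger0_norm // exprn_even_ge0.
by move=> /ler_normlP[]; rewrite /D; lra.
Qed.

(** The constants are chosen in the order [n] (parts to average over), then [t] and [c] (parts to
    start from, mass of the coloured boxes), then [m] and [c2] (sample size per part, size of the
    parts). None of them depends on the 3-graph. *)
Lemma dense_not_locally_admissible (k : nat) : (0 < k)%N ->
  exists (N n0 : nat) (eta : R), 0 < eta /\
  forall (V : finType) (E : {set {set V}}),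
    (forall e, e \in E -> #|e| = 3%N) -> (n0 <= #|V|)%N ->
    (forall W : {set V}, (#|W| <= N)%N -> admissible_on k E W) ->
    ~ (forall U : {set V}, eta * #|V|%:R <= #|U|%:R ->
       (1 - k%:R ^- 2 / 2) / 3 * 'C(#|U|, 3)%:R <= #|[set e in E | e \subset U]|%:R :> R).
Proof.
move=> k0.
have kR : 1 <= k%:R :> R by rewrite ler1n.
pose K : R := k%:R ^- 2.
have K0 : 0 < K by rewrite invr_gt0 exprn_gt0 // ltr0n.
have K1 : K <= 1 by rewrite invf_le1 ?exprn_gt0 ?ltr0n // exprn_ege1.
(* The gap between the assumed density and the palette bound (1 - K) / 3 is K / 6 = 4 tau;
   each of the four approximation errors is at most tau. *)
pose tau : R := K / 24.
have tau0 : 0 < tau by rewrite divr_gt0.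
pose e := tau * K / 18.
have e0 : 0 < e by rewrite divr_gt0 // mulr_gt0.
have ke : 18 * k%:R ^+ 2 * e = tau.
  by rewrite /e /K; field; rewrite pnatr_eq0 -lt0n.
pose n := (Num.bound (6 / tau)).+1.
have nt : 6 / n%:R < tau.
  rewrite ltr_pdivrMr ?ltr0n // mulrC -ltr_pdivrMr //.
  apply: lt_le_trans (archi_boundP _) _; first by rewrite divr_ge0 // ltW.
  by rewrite ler_nat.
have [t [c [/andP[c0 c1] col]]] := colour_parts n k0 e0.
have [m [c2 [m0 /andP[c20 c21] samp]]] := dense_sample t tau0 c0.
(* [t * m] bounds the number of sampled points. The bound on [#|V|] gives [c2 * r >= 2], so the
   parts are nonempty. The 4 in [eta] covers two roundings, in [r] and in [s], each losing at most a
   factor 2. *)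
exists (t * m)%N, (t.+1 * (Num.bound (2 / c2)).+1)%N, (c2 / (4 * t.+1%:R)); split.
  by rewrite divr_gt0 // mulr_gt0 // ltr0n.
move=> V E E3 Vn adm dense.
set r := (#|V| %/ t.+1)%N.
have r2 : 2 <= c2 * r%:R.
  rewrite mulrC -ler_pdivrMr //; apply: le_trans (ltW (archi_boundP _)) _.
    by rewrite divr_ge0 // ltW.
  by rewrite ler_nat leq_divRL // mulnC; apply: leq_trans Vn; rewrite leq_mul2l leqnSn orbT.
set s := Num.truncn (c2 * r%:R) in samp *.
have /andP[s1 s2] : s%:R <= c2 * r%:R < s.+1%:R by rewrite truncn_itv // (le_trans _ r2).
have s0 : (0 < s)%N by rewrite -(ltr_nat R); move: s2; rewrite -natr1; lra.
have [A [w [disA sA trip]]] := samp V E s0.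
have sV : c2 / (4 * t.+1%:R) * #|V|%:R <= s%:R.
  have tR : 0 < t.+1%:R :> R by rewrite ltr0n.
  rewrite mulrAC ler_pdivrMr ?mulr_gt0 //.
  have Vr : #|V|%:R <= 2 * (t.+1%:R * r%:R) :> R.
    rewrite -!natrM ler_nat.
    have r0 : (0 < r)%N by rewrite lt0n; apply/eqP => r0; move: r2; rewrite r0 mulr0; lra.
    exact: le_double_divn.
  have sr : c2 * r%:R <= 2 * s%:R.
    by move: s2; rewrite -natr1; lra.
  apply: (@le_trans _ _ (c2 * (2 * (t.+1%:R * r%:R)))); first by rewrite ler_pM2l.
  have -> : c2 * (2 * (t.+1%:R * r%:R)) = 2 * t.+1%:R * (c2 * r%:R) by ring.
  have -> : s%:R * (4 * t.+1%:R) = 2 * t.+1%:R * (2 * s%:R) :> R by ring.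
  by rewrite ler_wpM2l // mulr_ge0 // ltW.
pose W := [set w p.1 p.2 | p in [set: 'I_t * 'I_m]].
have Wn : (#|W| <= t * m)%N.
  by apply: leq_trans (leq_imset_card _ _) _; rewrite cardsT card_prod !card_ord.
have supp i x : x \notin W -> empirical R (w i) x = 0.
  move=> xW; rewrite /empirical big1 ?mulr0 // => q _.
  case: eqP => // E0; case/negP: xW; rewrite -E0; apply/imsetP; exists (i, q) => //.
have [T [sT szT colT]] :=
  col V E W (fun i => empirical R (w i)) (fun i => empirical_prob R (w i) m0)
  supp (adm W Wn).
have uT : uniq T by apply: subseq_uniq sT (enum_uniq _).
have cT : #|[set i in T]| = n by rewrite cardsE (card_uniqP uT).
have key (i j l : 'I_t) : i \in [set i in T] -> j \in [set i in T] -> l \in [set i in T] ->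
    (i < j)%N -> (j < l)%N -> density3 (edge_ind R E) (A i) (A j) (A l) <= (1 - K) / 3 + 3 * tau.
  rewrite !inE => iT jT lT ij jl.
  have [P [dP boxP]] := trip i j l ij jl.
  have [X [Y [Z [mX mY mZ up]]]] := colT i j l iT jT lT ij jl.
  have := le_trans (boxP X Y Z) (lerD up (lexx _)); rewrite -/K ke.
  set M := mass _ X * _ * _.
  have M3 : c ^+ 3 <= M.
    by rewrite !exprS expr0 mulr1 mulrA /M !ler_pM ?mulr_ge0 // ltW.
  have M0 : 0 < M by apply: lt_le_trans M3; rewrite exprn_gt0.
  have tM : tau * c ^+ 3 <= tau * M by rewrite ler_pM2l.
  (* On the box [X], [Y], [Z] the sampled density is bounded below through [P] and above by the
     palette. Since its mass [M] is at least [c ^+ 3], the sampling error is at most [tau * M] and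
     [M] cancels. *)
  move=> h; have : P * M <= ((1 - K) / 3 + 2 * tau) * M.
    by apply: le_trans h _; rewrite [leRHS](_ : _ = ((1 - K) / 3 + tau) * M + tau * M);
      [rewrite lerD2l|ring].
  by rewrite ler_pM2r //; lra.
have := @averaging R _ _ E A [set i in T] s n ((1 - K / 2) / 3) ((1 - K) / 3 +
  3 * tau) cT (ltn0Sn _) s0
  _ _ disA sA (distinct3_sorted key).
have h1 : 0 <= (1 - K) / 3 + 3 * tau by move: (ltW tau0); lra.
have h2 : (1 - K / 2) / 3 <= 1 by move: (ltW K0); lra.
move=> /(_ h1 h2) H; have : (1 - K / 2) / 3 - ((1 - K) / 3 + 3 * tau) <= 6 / n%:R.
  apply: H => U hU; apply: dense_triples => //; first by lra.
  apply: dense; apply: le_trans sV _; rewrite ler_nat; apply: leq_trans hU.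
  by rewrite leq_pmull.
by move: nt; rewrite /tau; lra.
Qed.

End UpperBound.

(** * Lower bound *)

Section Palette.
Context (R : archiRealFieldType).

Lemma lower_of_norm (t p m x y : R) : y <= m -> x <= m -> `|t - p| <= y + y + x -> p - 3 * m <= t.
Proof. by move=> ? ? /ler_normlP[]; lra. Qed.

Section Construction.
Context (F : finFieldType) (b k : nat) (k0 : (0 < k)%N).

(** [b] copies of the affine plane over [F], ordered by copy, so that a block together with all
    later blocks gives product sets on which quasirandomness can be used. Pairs inside a block stay
    unoriented, which loses a share of order [1/b]. The quasirandom error gets multiplied by [b], so
    [F] is chosen after [b]. *)
Definition vertex : finType := ('I_b * F * F)%type.
Definition pair_label (x y : vertex) : F := x.1.2 * y.1.2 + x.2 + y.2.

Lemma card_vertex : #|vertex| = (b * #|F| ^ 2)%N.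
Proof. by rewrite !card_prod card_ord -mulnA. Qed.

Lemma label_sym x y : pair_label x y = pair_label y x.
Proof. rewrite /pair_label; ring. Qed.

Lemma sum_vertex (h : vertex -> R) : \sum_x h x = \sum_j \sum_a \sum_c h (j, a, c).
Proof. by rewrite !sum_pair. Qed.

(* For fixed y, y' with distinct slopes, (pair_label x y, pair_label x y') is uniformly
  distributed. *)
Lemma label_orthogonal (g : F -> R) (y y' : vertex) : \sum_z g z = 0 -> y.1.2 != y'.1.2 ->
  \sum_x g (pair_label x y) * g (pair_label x y') = 0.
Proof.
move=> g0 yy'; rewrite sum_vertex big1 // => j _.
pose h (p : F * F) := (p.1 * y.1.2 + p.2 + y.2, p.1 * y'.1.2 + p.2 + y'.2).
have hI : injective h.
  move=> [a c] [a' c'] [/= h1 h2].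
  have e : (a - a') * (y.1.2 - y'.1.2) = 0.
    have -> : (a - a') * (y.1.2 - y'.1.2) = (a * y.1.2 + c + y.2) - (a' * y.1.2 + c' + y.2)
      - ((a * y'.1.2 + c + y'.2) - (a' * y'.1.2 + c' + y'.2)) by ring.
    by rewrite h1 h2 !subrr.
  move/eqP: e; rewrite mulf_eq0 !subr_eq0 (negPf yy') orbF => /eqP aa.
  by move: h1; rewrite aa => /addIr/addrI ->.
rewrite pair_bigA /=.
transitivity (\sum_(p : F * F) g (h p).1 * g (h p).2) => //.
rewrite -(reindex_inj hI (P := predT) (F := fun p => g p.1 * g p.2)) /=.
by rewrite -sumM_pair g0 mul0r.
Qed.

(** After Cauchy-Schwarz over [x], only pairs [y], [y'] with equal slope survive, a fraction
    [1 / #|F|] of all pairs. This permits every [d] with [d ^+ 2 * #|F| >= 1]. *)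
Lemma label_cut (g : F -> R) (X Y : {set vertex}) (d : R) : \sum_z g z = 0 ->
  (forall z, `|g z| <= 1) -> 0 <= d -> 1 <= d ^+ 2 * #|F|%:R ->
  `|\sum_(x in X) \sum_(y in Y) g (pair_label x y)| <= d * #|vertex|%:R ^+ 2.
Proof.
move=> g0 g1 d0 dF; set n : R := #|vertex|%:R.
have n0 : 0 <= n by [].
have F0 : 0 < #|F|%:R :> R by rewrite ltr0n; apply/card_gt0P; exists 0.
pose col (y : vertex) x : R := g (pair_label x y).
set S := \sum_(x in X) _.
have cs (h : vertex -> R) : (\sum_(x in X) h x) ^+ 2 <= n * \sum_x h x ^+ 2.
  have [n00|nn0] := eqVneq #|vertex| 0%N.
    have : #|X| = 0%N by apply/eqP; rewrite -leqn0 -n00 max_card.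
    move=> /eqP; rewrite cards_eq0 => /eqP->; rewrite big_set0 expr0n /= mulr_ge0 //.
    by apply: sumr_ge0 => x _; rewrite sqr_ge0.
  have nn : n != 0 by rewrite pnatr_eq0.
  have pn : is_prob (fun _ : vertex => n^-1).
    split=> [x|]; first by rewrite invr_ge0.
    by rewrite sumr_const -[_ *+ #|_|]mulr_natr -/n mulVf.
  have := jensen_sqr (fun x => if x \in X then h x else 0) pn.
  rewrite -!mulr_sumr -big_mkcond exprMn => H.
  have -> : (\sum_(x in X) h x) ^+ 2 = n ^+ 2 * (n^-1 ^+ 2 * (\sum_(x in X) h x) ^+ 2).
    by rewrite mulrA -exprMn divff // expr1n mul1r.
  apply: le_trans (ler_wpM2l (sqr_ge0 n) H) _.
  rewrite expr2 -mulrA mulVKf // ler_wpM2l //; apply: ler_sum => x _.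
  by case: ifP => _ //; rewrite expr0n sqr_ge0.
have S2 : S ^+ 2 <= n * \sum_(y in Y) \sum_(y' in Y | y'.1.2 == y.1.2) n.
  apply: le_trans (cs _) _; rewrite ler_wpM2l //.
  under eq_bigr => x _ do rewrite expr2 big_distrlr.
  rewrite exchange_big; apply: ler_sum => y _; rewrite exchange_big [leRHS]big_mkcondr /=.
  apply: ler_sum => y' _; case: eqVneq => [e|ne].
    apply: le_trans (ler_norm _) _; apply: le_trans (ler_norm_sum _ _ _) _.
    apply: (@le_trans _ _ (\sum_(x : vertex) 1)); last by rewrite sumr_const.
    by apply: ler_sum => x _; rewrite normM_le1.
  by rewrite label_orthogonal // eq_sym.
have fib y : (#|[set y' in Y | y'.1.2 == y.1.2]| <= b * #|F|)%N.
  pose h (y' : vertex) := (y'.1.1, y'.2).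
  have hI : {in [set y' in Y | y'.1.2 == y.1.2] &, injective h}.
    move=> [[j a] c] [[j' a'] c']; rewrite !inE /= => /andP[_ /eqP->] /andP[_ /eqP->].
    by move=> [-> ->].
  rewrite -(card_in_imset hI) (leq_trans (max_card _)) // card_prod card_ord //.
have nE : n = (b * #|F|)%:R * #|F|%:R.
  by rewrite /n card_vertex -natrM expnS expn1 mulnA.
have S2' : S ^+ 2 <= (d * n ^+ 2) ^+ 2.
  apply: le_trans S2 _.
  apply: (@le_trans _ _ (n * (n * ((b * #|F|)%:R * n)))).
    rewrite ler_wpM2l //; apply: (@le_trans _ _ (\sum_(y in Y) (b * #|F|)%:R * n)).
      apply: ler_sum => y _.
      rewrite (eq_bigl [in [set y' in Y | y'.1.2 == y.1.2]]) => [|y']; last by rewrite !inE.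
      by rewrite sumr_const -[_ *+ _]mulr_natl ler_wpM2r // ler_nat.
    by rewrite sumr_const -[_ *+ _]mulr_natl ler_wpM2r ?mulr_ge0 // ler_nat max_card.
  have -> : n * (n * ((b * #|F|)%:R * n)) = n ^+ 4 / #|F|%:R.
    by apply: (canRL (mulfK (lt0r_neq0 F0))); rewrite [in RHS]exprSr [X in _ = _ * X]nE; ring.
  rewrite ler_pdivrMr //.
  have -> : (d * n ^+ 2) ^+ 2 * #|F|%:R = (d ^+ 2 * #|F|%:R) * n ^+ 4 by ring.
  by rewrite ler_peMl // exprn_ge0.
by rewrite -(@ler_pXn2r _ 2) ?nnegrE ?mulr_ge0 ?sqr_ge0 // real_normK ?num_real.
Qed.

Definition colour_of_label (z : F) : 'I_k := Ordinal (ltn_pmod (enum_rank z) k0).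
(** Exact frequencies instead of [1/k]: the centred colour indicator then sums to exactly zero over
    [F], as [label_cut] requires. *)
Definition colour_weight (s : 'I_k) : R := #|[set z | colour_of_label z == s]|%:R / #|F|%:R.
Definition block_lt (x y : vertex) : bool := (x.1.1 < y.1.1)%N.
Definition pair_colour (x y : vertex) : 'I_k := colour_of_label (pair_label x y).

Definition pattern_edges : {set {set vertex}} :=
  [set e : {set vertex} | (#|e| == 3%N) && [exists x, exists y, exists z,
    (e == [set x; y; z]) && pattern block_lt pair_colour x y z]].

Lemma pattern_edges_card (e : {set vertex}) : e \in pattern_edges -> #|e| = 3%N.
Proof. by rewrite inE => /andP[/eqP]. Qed.

Lemma pair_colour_sym x y : pair_colour x y = pair_colour y x.
Proof. by rewrite /pair_colour label_sym. Qed.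

Lemma pattern_edges_admissible : admissible_on k pattern_edges setT.
Proof.
exists block_lt, pair_colour; split; first exact: pair_colour_sym.
  by move=> x y; rewrite /block_lt; lia.
move=> x y z _ _ _; rewrite inE => /andP[/eqP E3 /existsP[x' /existsP[y' /existsP[z' /andP[/eqP
  E1 pat]]]]].
have psym u v w : pattern block_lt pair_colour u v w = pattern block_lt pair_colour u w v.
  by rewrite /pattern [pair_colour v w]pair_colour_sym andbCA; do !bool_congr.
rewrite E1 in E3.
have [xy yz xz] : [/\ x' != y', y' != z' & x' != z'].
  have := E3; rewrite setUC cardsU1 cards2 !inE negb_or.
  by rewrite ![z' == _]eq_sym; case: (x' == y'); case: (x' == z'); case: (y' == z').
have mem u : u \in [set x'; y'; z'] -> [\/ u = x, u = y | u = z].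
  by rewrite -E1 !inE => /orP[/orP[]|] /eqP->; [constructor 1|constructor 2|constructor 3].
have mx : [\/ x' = x, x' = y | x' = z] by apply: mem; rewrite !inE eqxx.
have my : [\/ y' = x, y' = y | y' = z] by apply: mem; rewrite !inE eqxx orbT.
have mz : [\/ z' = x, z' = y | z' = z] by apply: mem; rewrite !inE eqxx !orbT.
by case: mx => ex; case: my => ey; case: mz => ez; move: pat xy yz xz;
  rewrite ex ey ez ?eqxx // => pat _ _ _;
  have pat' := pat; rewrite psym in pat'; rewrite ?pat ?pat' ?orbT.
Qed.

Lemma pattern_edgesP x y z : y != z -> pattern block_lt pair_colour x y z ->
  [set x; y; z] \in pattern_edges.
Proof.
move=> yz pat; rewrite inE; apply/andP; split; last first.
  by apply/existsP; exists x; apply/existsP; exists y; apply/existsP; exists z; rewrite eqxx.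
move: pat; rewrite /pattern /block_lt => /and3P[xy xz _].
rewrite setUC cardsU1 cards2 !inE negb_or [z == y]eq_sym yz.
have -> : z != x by apply: contraTneq xz => ->; rewrite ltnn.
by have -> : x != y by apply: contraTneq xy => ->; rewrite ltnn.
Qed.

(** A source lies in a strictly earlier block than the two other vertices, so at most one of the
    three patterns holds; it yields an edge unless the two base vertices coincide. *)
Lemma ordered_patterns_le (x y z : vertex) :
  (pattern block_lt pair_colour x y z)%:R + (pattern block_lt pair_colour y x z)%:R
    + (pattern block_lt pair_colour z x y)%:R
  <= edge_ind R pattern_edges x y z + ((y == z)%:R + (x == z)%:R + (x == y)%:R).
Proof.
have E1 : [set y; x; z] = [set x; y; z] by rewrite [[set y; x]]setUC.
have E2 : [set z; x; y] = [set x; y; z] by rewrite setUC [[set z; x]]setUC setUA [[set y; x]]setUC.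
have h1 := @pattern_edgesP x y z; have h2 := @pattern_edgesP y x z.
have h3 := @pattern_edgesP z x y; rewrite E1 in h2; rewrite E2 in h3.
have blk u v w : pattern block_lt pair_colour u v w -> (u.1.1 < v.1.1)%N && (u.1.1 < w.1.1)%N.
  by case/and3P => ? ? _; apply/andP.
have i0 : 0 <= ([set x; y; z] \in pattern_edges)%:R :> R by [].
have n1 : 0 <= (y == z)%:R :> R by [].
have n2 : 0 <= (x == z)%:R :> R by [].
have n3 : 0 <= (x == y)%:R :> R by [].
rewrite /edge_ind; case p1 : (pattern _ _ x y z).
  have /andP[b1 b2] := blk _ _ _ p1.
  have -> : pattern block_lt pair_colour y x z = false.
    by apply/negP => /blk; rewrite ltnNge (ltnW b1).
  have -> : pattern block_lt pair_colour z x y = false.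
    by apply/negP => /blk; rewrite ltnNge (ltnW b2).
  by rewrite !addr0; case: (eqVneq y z) => [_|/h1->] //=; move: i0 n2 n3; lra.
case p2 : (pattern _ _ y x z).
  have /andP[b1 b2] := blk _ _ _ p2.
  have -> : pattern block_lt pair_colour z x y = false.
    by apply/negP => /blk; rewrite andbC ltnNge (ltnW b2).
  by rewrite !addr0 add0r; case: (eqVneq x z) => [_|/h2->] //=; move: i0 n1 n3; lra.
case p3 : (pattern _ _ z x y); last by rewrite !addr0 !addr_ge0.
by rewrite !add0r; case: (eqVneq x y) => [_|/h3->] //=; move: i0 n1 n2; lra.
Qed.

Lemma colour_weight_ge0 s : 0 <= colour_weight s.
Proof. by rewrite divr_ge0. Qed.

Lemma cardF_gt0 : 0 < #|F|%:R :> R.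
Proof. by rewrite ltr0n; apply/card_gt0P; exists 0. Qed.

Lemma colour_weight_set (S : {set 'I_k}) :
  \sum_(s in S) colour_weight s = (\sum_z (colour_of_label z \in S)%:R) / #|F|%:R.
Proof.
rewrite -mulr_suml; congr (_ / _).
have cE s : #|[set z | colour_of_label z == s]|%:R = \sum_z (colour_of_label z == s)%:R :> R.
  by rewrite -sum1_card natr_sum big_mkcond; apply: eq_bigr => z _; rewrite inE; case: ifP.
under eq_bigr => s _ do rewrite cE.
rewrite exchange_big; apply: eq_bigr => z _ /=.
case hS : (colour_of_label z \in S).
  rewrite (bigD1 (colour_of_label z)) //= eqxx big1 ?addr0 // => s /andP[_ /negPf].
  by rewrite eq_sym => ->.
by rewrite big1 // => s sS; case: eqP => // e; rewrite e sS in hS.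
Qed.

Lemma colour_weight_sum : \sum_s colour_weight s = 1.
Proof.
have := colour_weight_set setT; rewrite (eq_bigl predT) => [->|s]; last by rewrite inE.
rewrite (eq_bigr (fun=> 1)) => [|z _]; last by rewrite inE.
by rewrite sumr_const divff // lt0r_neq0 // cardF_gt0.
Qed.

Lemma colour_weight_set_le1 (S : {set 'I_k}) : 0 <= \sum_(s in S) colour_weight s <= 1.
Proof.
rewrite sumr_ge0 => [|s _]; last exact: colour_weight_ge0.
rewrite -colour_weight_sum [leRHS](bigID [in S]) /= lerDl sumr_ge0 // => s _;
  exact: colour_weight_ge0.
Qed.

(** A residue class modulo [k] has at most [#|F| %/ k + 1] elements, and [k <= #|F|] absorbs the
    1. *)
Lemma colour_weight_le s : (k <= #|F|)%N -> colour_weight s <= 2 / k%:R.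
Proof.
move=> kF; rewrite ler_pdivrMr ?cardF_gt0 // mulrAC ler_pdivlMr ?ltr0n // -!natrM ler_nat.
pose h (z : F) : 'I_(#|F| %/ k).+1 := inord (enum_rank z %/ k).
have hI : {in [set z | colour_of_label z == s] &, injective h}.
  move=> z z'; rewrite !inE => /eqP e1 /eqP e2 /(congr1 val) /=.
  have lt (y : F) : (enum_rank y %/ k < (#|F| %/ k).+1)%N.
    by rewrite ltnS leq_div2r // ltnW.
  rewrite !inordK // => e3; apply: enum_rank_inj; apply: val_inj => /=.
  have := congr1 val (etrans e1 (esym e2)) => /= e4.
  by rewrite (divn_eq (enum_rank z) k) (divn_eq (enum_rank z') k) e3 e4.
have : (#|[set z | colour_of_label z == s]| <= (#|F| %/ k).+1)%N.
  by rewrite -(card_in_imset hI) (leq_trans (max_card _)) // card_ord.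
move=> hc; apply: (@leq_trans ((#|F| %/ k).+1 * k)); first by rewrite leq_mul2r hc orbT.
by rewrite mulSn mul2n -addnn leq_add // leq_trunc_div.
Qed.

Lemma colour_cut (S : {set 'I_k}) (X Y : {set vertex}) (d : R) : 0 <= d -> 1 <= d ^+ 2 * #|F|%:R ->
  `|\sum_(x in X) \sum_(y in Y)
     (fun=> 1) x * (fun=> 1) y * ((pair_colour x y \in S)%:R - \sum_(s in S) colour_weight s)|
  <= d * #|vertex|%:R ^+ 2.
Proof.
move=> d0 dF; set c := \sum_(s in S) _.
have /andP[c0 c1] := colour_weight_set_le1 S.
pose g (z : F) := (colour_of_label z \in S)%:R - c.
have g1 z : `|g z| <= 1.
  rewrite ler_norml /g -/c in c0 c1 *; case: (_ \in S) => /=; move: c0 c1; rewrite -/c; lra.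
have g0 : \sum_z g z = 0.
  rewrite sumrB sumr_const /c colour_weight_set -[_ *+ #|_|]mulr_natr divfK ?subrr //.
  by rewrite lt0r_neq0 // cardF_gt0.
have := label_cut X Y g0 g1 d0 dF; congr (`|_| <= _).
by apply: eq_bigr => x _; apply: eq_bigr => y _; rewrite !mul1r.
Qed.

Definition palette_density : R :=
  \sum_s colour_weight s * (\sum_(i < k | (s < i)%N) colour_weight i) ^+ 2.

Lemma palette_density_ge : (k <= #|F|)%N -> (1 - 8 / k%:R) / 3 <= palette_density.
Proof.
move=> kF; have := @tail_square_ge R k colour_weight (2 / k%:R).
rewrite colour_weight_sum !expr1n => H; have : 1 <= 3 * palette_density + 4 * (2 / k%:R) * 1.
  by apply: H => s; rewrite colour_weight_ge0 colour_weight_le.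
lra.
Qed.

Lemma palette_density_le : 3 * palette_density <= 1.
Proof.
have := tail_square_le colour_weight_ge0; rewrite colour_weight_sum expr1n.
have : 0 <= \sum_s colour_weight s ^+ 3.
  by apply: sumr_ge0 => s _; rewrite exprn_ge0 // colour_weight_ge0.
rewrite -/palette_density; lra.
Qed.

Lemma palette_density_ge0 : 0 <= palette_density.
Proof. by apply: sumr_ge0 => s _; rewrite mulr_ge0 ?sqr_ge0 // colour_weight_ge0. Qed.

(** For each block [j] of the source and each base colour [s], count triangles between [Uj j] and
    two copies of [Vj j]. The main terms are summed by [tail_square_ge], blocks having at most
    [#|F| ^ 2] points; the [b * k] errors of [3 * d * n ^+ 3] are tripled with everything else. *)
Lemma pattern_count_ge (U : {set vertex}) (d : R) : 0 <= d -> 1 <= d ^+ 2 * #|F|%:R ->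
  palette_density * (#|U|%:R ^+ 3 - 4 * #|F|%:R ^+ 2 * #|U|%:R ^+ 2)
    - 9 * b%:R * k%:R * d * #|vertex|%:R ^+ 3 <=
  3 * \sum_(x in U) \sum_(y in U) \sum_(z in U) (pattern block_lt pair_colour x y z)%:R.
Proof.
move=> d0 dF; set n : R := #|vertex|%:R.
pose Uj (j : 'I_b) := [set x in U | x.1.1 == j].
pose Vj (j : 'I_b) := [set x in U | (j < x.1.1)%N].
have n0 : 0 <= n by [].
have cn (X : {set vertex}) : #|X|%:R <= n by rewrite ler_nat max_card.
have Vsum j : #|Vj j|%:R = \sum_(i < b | (j < i)%N) #|Uj i|%:R :> R.
  rewrite -sum1_card natr_sum (partition_big (fun x : vertex => x.1.1) (fun i : 'I_b => j < i)%N)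
    /=.
    apply: eq_bigr => i ji; rewrite -sum1_card natr_sum; apply: eq_bigl => x; rewrite !inE.
    by case: eqP => [->|_]; rewrite ?andbF ?andbT // ji andbT.
  by move=> x; rewrite inE => /andP[].
have Usum : \sum_j #|Uj j|%:R = #|U|%:R :> R.
  rewrite -[in RHS]sum1_card natr_sum (partition_big (fun x : vertex => x.1.1) predT) //=.
  by apply: eq_bigr => i _; rewrite -sum1_card natr_sum; apply: eq_bigl => x; rewrite !inE.
have Uj_le j : 0 <= (#|Uj j|%:R : R) <= #|F|%:R ^+ 2.
  rewrite ler0n /= -natrX ler_nat.
  pose h (x : vertex) := (x.1.2, x.2).
  have hI : {in Uj j &, injective h}.
    move=> [[i a] c] [[i' a'] c']; rewrite !inE /= => /andP[_ /eqP->] /andP[_ /eqP->].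
    by move=> [-> ->].
  by rewrite -(card_in_imset hI) (leq_trans (max_card _)) // card_prod expnS expn1.
have := tail_square_ge Uj_le; rewrite Usum => tail.
pose T (j : 'I_b) (s : 'I_k) : R := \sum_(x in Uj j) \sum_(y in Vj j) \sum_(z in Vj j)
  (fun=> 1) x * (fun=> 1) y * (fun=> 1) z *
  [&& pair_colour x y \in [set i : 'I_k | (s < i)%N], pair_colour x z \in [set i : 'I_k | (s <
    i)%N] &
      pair_colour y z \in [set s]]%:R.
have splitT : \sum_(x in U) \sum_(y in U) \sum_(z in U) (pattern block_lt pair_colour x y z)%:R
    = \sum_j \sum_s T j s.
  rewrite (partition_big (fun x : vertex => x.1.1) predT) //=; apply: eq_bigr => j _.
  rewrite [RHS]exchange_big /= (eq_bigl [in Uj j]) => [|x]; last by rewrite !inE.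
  apply: eq_bigr => x; rewrite inE => /andP[_ /eqP xj].
  rewrite [RHS]exchange_big /= [RHS]big_set big_mkcondr /=; apply: eq_bigr => y _.
  case: (boolP (j < y.1.1)%N) => jy; last first.
    by rewrite big1 // => z _; rewrite /pattern /block_lt xj (negPf jy).
  rewrite [RHS]exchange_big /= [RHS]big_set big_mkcondr /=; apply: eq_bigr => z _.
  rewrite /pattern /block_lt xj jy; case: (boolP (j < z.1.1)%N) => jz //=.
  rewrite (bigD1 (pair_colour y z)) //= !inE eqxx andbT !mul1r big1 ?addr0 // => s /negPf ns.
  by rewrite !inE eq_sym ns !andbF mulr0.
have TB (j : 'I_b) (s : 'I_k) : colour_weight s * (\sum_(i < k | (s < i)%N) colour_weight i) ^+ 2 *
    (#|Uj j|%:R * #|Vj j|%:R ^+ 2) - 3 * d * n ^+ 3 <= T j s.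
  pose S1 := [set i : 'I_k | (s < i)%N].
  have o1 (x : vertex) : 0 <= (fun _ : vertex => 1 : R) x by [].
  have := @triangle_count R _ (fun=> 1) (fun=> 1) (fun=> 1) (Uj j) (Vj j) (Vj j)
    (fun x y => pair_colour x y \in S1) (fun x y => pair_colour x y \in S1)
    (fun x y => pair_colour x y \in [set s]) (\sum_(i in S1) colour_weight i)
    (\sum_(i in S1) colour_weight i) (\sum_(i in [set s]) colour_weight i)
    (d * n ^+ 2) (d * n ^+ 2) (d *
      n ^+ 2) o1 o1 o1 (colour_weight_set_le1 _) (colour_weight_set_le1 _)
    (fun X Y _ _ => colour_cut _ X Y d0 dF) (fun X Y _ _ => colour_cut _ X Y d0 dF)
    (fun X Y _ _ => colour_cut _ X Y d0 dF).
  rewrite -/(T j s) !mass_cst1 big_set1 /S1 big_set.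
  have dn : 0 <= d * n ^+ 2 by rewrite mulr_ge0 ?sqr_ge0.
  have := ler_wpM2l dn (cn (Uj j)); have := ler_wpM2l dn (cn (Vj j)).
  set W := \sum_(i < k | _) _.
  have -> : d * n ^+ 2 * n = d * n ^+ 3 by ring.
  have -> : W * W * colour_weight s * (#|Uj j|%:R * #|Vj j|%:R * #|Vj j|%:R) =
    colour_weight s * W ^+ 2 * (#|Uj j|%:R * #|Vj j|%:R ^+ 2) by ring.
  by move=> h1 h2 h3; rewrite -[3 * d * n ^+ 3]mulrA; exact: lower_of_norm h1 h2 h3.
rewrite splitT.
apply: (@le_trans _ _ (3 * \sum_j \sum_s (colour_weight s *
  (\sum_(i < k | (s < i)%N) colour_weight i) ^+ 2 *
    (#|Uj j|%:R * #|Vj j|%:R ^+ 2) - 3 * d * n ^+ 3))); last first.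
  by rewrite ler_pM2l //; apply: ler_sum => j _; apply: ler_sum => s _; exact: TB.
under eq_bigr => j _ do rewrite sumrB -mulr_suml -/palette_density sumr_const card_ord Vsum.
rewrite sumrB -mulr_sumr sumr_const card_ord -[(_ *+ k) *+ b]mulr_natl -[(3 * d *
  n ^+ 3) *+ k]mulr_natl.
have := ler_wpM2l palette_density_ge0 tail.
set a := \sum_(j < b) _; set u : R := #|U|%:R; set q : R := #|F|%:R => h.
have : palette_density * (u ^+ 3 - 4 * q ^+ 2 * u ^+ 2) <= palette_density * (3 * a).
  by apply: ler_wpM2l; [exact: palette_density_ge0|move: tail; rewrite -/a -/u -/q; lra].
move=> h'; have -> : 3 * (palette_density * a - b%:R * (k%:R * (3 * d * n ^+ 3))) =
  palette_density * (3 * a) - 9 * b%:R * k%:R * d * n ^+ 3 by ring.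
by rewrite lerD2r.
Qed.

(** Summed over [U], the three positions of the source contribute equally, and the coincidence terms
    add up to [3 * #|U|%:R ^+ 2]. *)
Lemma edge_count_ge (U : {set vertex}) (d : R) : 0 <= d -> 1 <= d ^+ 2 * #|F|%:R ->
  palette_density * (#|U|%:R ^+ 3 - 4 * #|F|%:R ^+ 2 * #|U|%:R ^+ 2)
    - 9 * b%:R * k%:R * d * #|vertex|%:R ^+ 3 - 3 * #|U|%:R ^+ 2 <=
  \sum_(x in U) \sum_(y in U) \sum_(z in U) edge_ind R pattern_edges x y z.
Proof.
move=> d0 dF; have := pattern_count_ge U d0 dF.
pose pat (x y z : vertex) : R := (pattern block_lt pair_colour x y z)%:R.
pose col (x y : vertex) : R := (x == y)%:R.
have cst (c : R) : \sum_(x in U) c = #|U|%:R * c by rewrite sumr_const mulr_natl.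
have col1 x : x \in U -> \sum_(y in U) col x y = 1.
  move=> xU; rewrite (bigD1 x) //= /col eqxx big1 ?addr0 // => y /andP[_ /negPf].
  by rewrite eq_sym => ->.
have : \sum_(x in U) \sum_(y in U) \sum_(z in U) (pat x y z + pat y x z + pat z x y) <=
    \sum_(x in U) \sum_(y in U) \sum_(z in U)
      (edge_ind R pattern_edges x y z + (col y z + col x z + col x y)).
  by do 3 (apply: ler_sum => ? _); exact: ordered_patterns_le.
have -> : \sum_(x in U) \sum_(y in U) \sum_(z in U)
      (edge_ind R pattern_edges x y z + (col y z + col x z + col x y)) =
   \sum_(x in U) \sum_(y in U) \sum_(z in U) edge_ind R pattern_edges x y z + 3 * #|U|%:R ^+ 2.
  transitivity (\sum_(x in U) (\sum_(y in U) \sum_(z in U) edge_ind R pattern_edges x y z +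
    3 * #|U|%:R)).
    apply: eq_bigr => x xU.
    transitivity (\sum_(y in U) (\sum_(z in U) edge_ind R pattern_edges x y z + (2 +
      #|U|%:R * col x y))).
      apply: eq_bigr => y yU; rewrite !big_split /= !col1 // cst; congr (_ + _).
    by rewrite !big_split /= cst -mulr_sumr col1 //; congr (_ + _); ring.
  by rewrite big_split /= cst; congr (_ + _); ring.
have -> : \sum_(x in U) \sum_(y in U) \sum_(z in U) (pat x y z + pat y x z + pat z x y) =
    3 * \sum_(x in U) \sum_(y in U) \sum_(z in U) pat x y z.
  have e2 : \sum_(x in U) \sum_(y in U) \sum_(z in U) pat y x z =
    \sum_(x in U) \sum_(y in U) \sum_(z in U) pat x y z by rewrite exchange_big.
  have e3 : \sum_(x in U) \sum_(y in U) \sum_(z in U) pat z x y =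
    \sum_(x in U) \sum_(y in U) \sum_(z in U) pat x y z.
    by under eq_bigr => x _ do rewrite exchange_big; rewrite exchange_big.
  under eq_bigr => x _ do under eq_bigr => y _ do rewrite !big_split /=.
  under eq_bigr => x _ do rewrite !big_split /=.
  by rewrite !big_split /= e2 e3; ring.
rewrite -/(pat _ _ _); lra.
Qed.

End Construction.

End Palette.

(** * Parameters of the construction *)

Section LowerBound.
Context (R : archiRealFieldType).

Lemma dense_of_triples (V : finType) (E : {set {set V}}) (U : {set V}) (d : R) : 0 <= d ->
  (forall e, e \in E -> #|e| = 3%N) ->
  d * #|U|%:R ^+ 3 <= \sum_(x in U) \sum_(y in U) \sum_(z in U) edge_ind R E x y z ->
  d * 'C(#|U|, 3)%:R <= #|[set e in E | e \subset U]|%:R.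
Proof.
move=> d0 E3; rewrite sum_edge_ind // => h.
have C6 : 6 * 'C(#|U|, 3)%:R <= #|U|%:R ^+ 3 :> R.
  have := bin_ffact #|U| 3; rewrite (_ : 3`! = 6)%N // mulnC => e.
  rewrite -natrM e -natrX ler_nat !ffactnS ffactn0 !expnS expn0.
  by rewrite leq_mul2l; case: #|U| => [|[|u]] //=; rewrite leq_mul // ltnW.
by have := ler_wpM2l d0 C6; move: h; lra.
Qed.

Lemma exists_dense_admissible (k n0 : nat) (eta eps d : R) : (0 < k)%N -> 0 < eta -> 0 < eps ->
  0 <= d ->
  d <= (1 - 8 / k%:R) / 3 - eps ->
  exists (V : finType) (E : {set {set V}}), [/\ forall e, e \in E -> #|e| = 3%N,
    (n0 <= #|V|)%N, admissible_on k E setT &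
    forall U : {set V}, eta * #|V|%:R <= #|U|%:R ->
      d * 'C(#|U|, 3)%:R <= #|[set e in E | e \subset U]|%:R].
Proof.
move=> k0 eta0 eps0 d0 dk.
(* Three errors of at most [eps / 3 * u ^+ 3] are allowed. This [b] handles the triples lost to
   blocks, through [u >= eta * b * p ^ 2]. *)
pose b := (Num.bound (12 / (eps * eta))).+1.
have bR : 0 < b%:R :> R by rewrite ltr0n.
have kR : 0 < k%:R :> R by rewrite ltr0n.
have hb : 12 <= b%:R * (eps * eta).
  rewrite -ler_pdivrMr ?mulr_gt0 //; apply: le_trans (ltW (archi_boundP _)) _.
    by rewrite divr_ge0 // ltW // mulr_gt0.
  by rewrite ler_nat.
(* With this value the quasirandom error [9 * b * k * del * n ^+ 3] equals
   [eps / 3 * (eta * n) ^+ 3]. *)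
pose del := eps * eta ^+ 3 / (27 * k%:R * b%:R).
have del0 : 0 < del by rewrite divr_gt0 ?mulr_gt0 // exprn_gt0.
(* Four lower bounds for the prime: for the cut error [del], for the coincidence term [3 * u ^+ 2],
   for [k <= #|F|] and for the number of vertices. *)
pose M := (Num.bound (del ^- 2) + Num.bound (9 / (eta * eps)) + k + n0)%N.
have hM x : [|| x == Num.bound (del ^- 2), x == Num.bound (9 / (eta * eps)), x == k | x == n0] ->
    (x <= M)%N.
  by rewrite /M; move: (Num.bound _) (Num.bound _) => ? ? /or4P[] /eqP->; lia.
have [p Mp p_prime] := prime_above M.
pose F := 'F_p.
have Fp : #|F| = p by exact: card_Fp.
have hdel : 1 <= del ^+ 2 * #|F|%:R.
  rewrite Fp mulrC -ler_pdivrMr ?exprn_gt0 // div1r.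
  apply: le_trans (ltW (archi_boundP _)) _; first by rewrite invr_ge0 sqr_ge0.
  by rewrite ler_nat; apply: leq_trans (ltnW Mp); apply: hM; rewrite eqxx ?orbT.
have hp : 9 <= p%:R * (eta * eps).
  rewrite -ler_pdivrMr ?mulr_gt0 //; apply: le_trans (ltW (archi_boundP _)) _.
    by rewrite divr_ge0 // ltW // mulr_gt0.
  by rewrite ler_nat; apply: leq_trans (ltnW Mp); apply: hM; rewrite eqxx ?orbT.
have kp : (k <= #|F|)%N by rewrite Fp; apply: leq_trans (ltnW Mp); apply: hM; rewrite eqxx ?orbT.
have p1 : 1 <= p%:R :> R by rewrite ler1n prime_gt0.
exists (vertex F b), (pattern_edges F b k0); split.
- exact: pattern_edges_card.
- rewrite card_vertex Fp; apply: (@leq_trans p).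
    by apply: leq_trans (ltnW Mp); apply: hM; rewrite eqxx ?orbT.
  by rewrite expnS expn1 mulnA leq_pmull // muln_gt0 /= prime_gt0.
- exact: pattern_edges_admissible.
move=> U hU; apply: dense_of_triples => //; first exact: pattern_edges_card.
apply: le_trans (edge_count_ge k0 U (ltW del0) hdel).
have L1 := palette_density_ge R k0 kp; have L2 := palette_density_le R F k0.
have L0 := palette_density_ge0 R F k0.
set L := palette_density _ _ _ in L0 L1 L2 *.
rewrite card_vertex natrM natrX Fp in hU *.
set u : R := #|U|%:R in hU *; set q : R := p%:R in hU hp p1 *; set B : R := b%:R in hU hb bR *.
have u0 : 0 <= u by [].
have u3 : 0 <= u ^+ 3 by rewrite exprn_ge0.
have q0 : 0 <= q by lra.
pose n := B * q ^+ 2.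
have n0' : 0 <= n by rewrite mulr_ge0 ?sqr_ge0 // ltW.
have B1 : 1 <= B by rewrite ler1n.
have qn : q <= n.
  have : q * 1 <= q * (B * q) by rewrite ler_wpM2l // mulr_ege1.
  by rewrite mulr1 /n; have -> : q * (B * q) = B * q ^+ 2 by ring.
have e1 : L * (4 * q ^+ 2 * u ^+ 2) <= eps / 3 * u ^+ 3.
  have h1 : L * (4 * q ^+ 2 * u ^+ 2) <= 4 * q ^+ 2 * u ^+ 2.
    by rewrite ler_piMl ?mulr_ge0 ?sqr_ge0 //; lra.
  apply: le_trans h1 _.
  have h2 : 12 * (q ^+ 2 * u ^+ 2) <= (B * (eps * eta)) * (q ^+ 2 * u ^+ 2).
    by rewrite ler_wpM2r // mulr_ge0 ?sqr_ge0.
  have h3 : (eta * (B * q ^+ 2)) * (eps * u ^+ 2) <= u * (eps * u ^+ 2).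
    by rewrite ler_wpM2r // mulr_ge0 ?sqr_ge0 // ltW.
  have e4 : (eta * (B * q ^+ 2)) * (eps * u ^+ 2) = (B * (eps * eta)) * (q ^+ 2 * u ^+ 2) by ring.
  have e5 : u * (eps * u ^+ 2) = eps * u ^+ 3 by ring.
  move: h2 h3; rewrite e4 e5 -[4 * q ^+ 2 * u ^+ 2]mulrA.
  move: (q ^+ 2 * u ^+ 2) => x; move: (B * _ * _) => y; lra.
have e2 : 9 * B * k%:R * del * n ^+ 3 <= eps / 3 * u ^+ 3.
  have -> : 9 * B * k%:R * del * n ^+ 3 = eps / 3 * (eta * n) ^+ 3.
    by rewrite /del -/B; field; rewrite !pnatr_eq0 -!lt0n k0.
  apply: ler_wpM2l; first by lra.
  by rewrite lerXn2r ?nnegrE ?mulr_ge0 // ltW.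
have e3 : 3 * u ^+ 2 <= eps / 3 * u ^+ 3.
  have h1 : 9 <= eps * u.
    apply: le_trans hp _; have -> : q * (eta * eps) = eps * (eta * q) by ring.
    apply: ler_wpM2l; first exact: ltW.
    by apply: le_trans hU; rewrite ler_pM2l.
  have := ler_wpM2r (sqr_ge0 u) h1; have -> : eps * u * u ^+ 2 = eps * u ^+ 3 by ring.
  lra.
have dL : d * u ^+ 3 <= (L - eps) * u ^+ 3 by apply: ler_wpM2r => //; lra.
rewrite -/n mulrBr; move: e1 e2 e3 dL; rewrite mulrBl.
move: (L * (4 * q ^+ 2 * u ^+ 2)) (9 * B * k%:R * del * n ^+ 3) (u ^+ 2) => x1 x2 x3.
have -> : eps / 3 * u ^+ 3 = eps * u ^+ 3 / 3 by ring.
move: (L * u ^+ 3) (eps * u ^+ 3) (d * u ^+ 3) => y1 y2 y3; lra.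
Qed.

Lemma admissible_preim (k : nat) (V V' : finType) (f : V -> V') (E : {set {set V}})
    (E' : {set {set V'}}) (W : {set V}) :
  (forall e : {set V}, e \in E -> f @: e \in E') -> admissible_on k E' (f @: W) ->
  admissible_on k E W.
Proof.
move=> fE [ o [phi [sym asym pat]]].
exists (fun x y => o (f x) (f y)), (fun x y => phi (f x) (f y)); split=> // [x y|x y z xW yW zW e].
  exact: asym.
apply: pat; rewrite ?imset_f //.
by have := fE _ e; rewrite !imsetU !imset_set1.
Qed.

End LowerBound.

(** * Densities of finite families *)

Lemma admissible_on_sub (k : nat) (V : finType) (E : {set {set V}}) (W W' : {set V}) :
  W' \subset W -> admissible_on k E W -> admissible_on k E W'.
Proof.
move=> /subsetP sub [ o [phi [sym asym pat]]]; exists o, phi; split=> // x y z xW yW zW.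
by apply: pat; apply: sub.
Qed.

(** Pullback along an injection serves two purposes: induced sub-3-graphs, and moving a 3-graph from
    an arbitrary finite type to an ordinal. *)
Definition three_graph_on (V : finType) (E : {set {set V}}) (n : nat) (f : 'I_n -> V)
    (fI : injective f) (E3 : forall e, e \in E -> #|e| = 3%N) : three_graph.
Proof.
exists n [set e : {set 'I_n} | f @: e \in E].
by apply/forall_inP => e; rewrite inE => /E3; rewrite card_imset // => ->.
Defined.

Definition inadmissible_family (k N : nat) : set three_graph :=
  [set H | (nverts H <= N)%N /\ ~ admissible_on k (edges H) [set: 'I_(nverts H)]%SET]%classic.

Definition empty_three_graph : three_graph.
Proof. by exists 0%N finset.set0; apply/forallP => e; rewrite inE. Defined.

(** Made total by a default value, so that the 3-graphs on at most [N] vertices lie in the image of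
    a finite type. *)
Definition to_three_graph (n : nat) (E : {set {set 'I_n}}) : three_graph :=
  match [forall e in E, #|e| == 3%N] =P true with
  | ReflectT h => ThreeGraph h
  | ReflectF _ => empty_three_graph
  end.

Lemma to_three_graphE (H : three_graph) : to_three_graph (edges H) = H.
Proof.
case: H => n E h; rewrite /to_three_graph /=; case: eqP => [h'|]; last by rewrite h.
by rewrite (bool_irrelevance h h').
Qed.

Lemma finite_inadmissible_family (k N : nat) : finite_set (inadmissible_family k N).
Proof.
pose T := {n : 'I_N.+1 & {set {set 'I_n}}} : finType.
pose g (t : T) : three_graph := to_three_graph (tagged t).
apply: (@sub_finite_set _ _ (range g)).
  move=> H [HN _]; have HN' : (nverts H < N.+1)%N by [].
  exists (@existT _ (fun n : 'I_N.+1 => {set {set 'I_n}}) (Ordinal HN') (edges H)) => //.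
  exact: to_three_graphE.
by apply: finite_image; exact: finite_finset.
Qed.

Lemma admissible_free (k N : nat) (G : three_graph) :
  admissible_on k (edges G) [set: 'I_(nverts G)]%SET -> family_free (inadmissible_family k N) G.
Proof.
move=> adm H [_ nadm] [f _ fE]; apply: nadm; apply: (admissible_preim fE).
exact: admissible_on_sub (subsetT _) adm.
Qed.

(** The 3-graph induced on [W] is contained in [G] and has at most [N] vertices, so freeness keeps
    it out of the family; its colouring is carried back to [W] by ranks. *)
Lemma free_admissible (k N : nat) (G : three_graph) (W : {set 'I_(nverts G)}) : (0 < k)%N ->
  family_free (inadmissible_family k N) G -> (#|W| <= N)%N -> admissible_on k (edges G) W.
Proof.
move=> k0 free WN.
(* An empty [W] is treated apart because the rank function [rk] needs a point of [W] as default. *)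
have [->|[x0 x0W]] := set_0Vmem W.
  exists (fun _ _ => false), (fun _ _ => Ordinal k0); split=> // x y z.
  by rewrite inE.
have E3 (e : {set 'I_(nverts G)}) : e \in edges G -> #|e| = 3%N.
  by move=> eE; have /forall_inP/(_ e eE)/eqP := edges_card G.
pose H := three_graph_on (@enum_val_inj _ (mem W)) E3.
have : ~ inadmissible_family k N H.
  move=> FH; apply: (free H FH); exists (@enum_val _ (mem W)); first exact: enum_val_inj.
  by move=> e; rewrite inE.
rewrite /inadmissible_family /= => nF.
have [ o [phi [sym asym pat]]] : admissible_on k (edges H) [set: 'I_(nverts H)]%SET.
  by apply: contrapT => nadm; apply: nF.
pose rk := @enum_rank_in _ x0 (mem W) x0W.
exists (fun x y => o (rk x) (rk y)), (fun x y => phi (rk x) (rk y));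
  split=> // [x y|x y z xW yW zW e].
  exact: asym.
apply: pat; rewrite ?inE //.
by rewrite !imsetU !imset_set1 !enum_rankK_in.
Qed.

Lemma three_graph_of_dense (R : realType) (k n0 : nat) (eta d : R) (V : finType)
    (E : {set {set V}}) :
  (forall e, e \in E -> #|e| = 3%N) -> (n0 <= #|V|)%N -> admissible_on k E [set: V]%SET ->
  (forall U : {set V}, eta * #|V|%:R <= #|U|%:R ->
     d * 'C(#|U|, 3)%:R <= #|[set e in E | e \subset U]|%:R) ->
  exists G : three_graph, [/\ (n0 <= nverts G)%N,
    forall N, family_free (inadmissible_family k N) G & uniformly_dense d eta G].
Proof.
move=> E3 Vn adm dense.
pose G := three_graph_on (@enum_val_inj _ (mem V)) E3.
exists G; split=> // [N|U].
  apply: admissible_free; apply: (@admissible_preim _ _ _ (@enum_val _ (mem V)) _ E).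
    by move=> e; rewrite inE.
  exact: admissible_on_sub (subsetT _) adm.
pose fU := (@enum_val _ (mem V)) @: U.
have cU : #|fU| = #|U| by rewrite card_imset //; exact: enum_val_inj.
have := dense fU; rewrite cU => h hU; apply: le_trans (h hU) _.
rewrite ler_nat /edges_in.
have rI : injective (fun e : {set V} => [set x : 'I_#|V| | enum_val x \in e]).
  move=> e e' /setP ee'; apply/setP => x; have := ee' (enum_rank x).
  by rewrite !inE enum_rankK.
rewrite -(card_imset _ rI) subset_leq_card //; apply/subsetP => e'.
move=> /imsetP[e]; rewrite inE => /andP[eE /subsetP eU] ->.
rewrite !inE; apply/andP; split.
  suff -> : (@enum_val _ (mem V)) @: [set x : 'I_#|V| | enum_val x \in e] = e by [].
  apply/setP => x; apply/imsetP/idP => [[y]|xe]; first by rewrite inE => ye ->.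
  by exists (enum_rank x); rewrite ?inE enum_rankK.
apply/subsetP => x; rewrite inE => /eU /imsetP[y yU /enum_val_inj ->] //.
Qed.

(** The dense 3-graphs of the lower bound are admissible as a whole, hence free for every [N]; so
    [N] can be dictated by the upper bound alone. *)
Lemma turan_density_bounds (R : realType) (k : nat) (eps : R) : (0 < k)%N -> 0 < eps ->
  0 <= (1 - 8 / k%:R) / 3 - eps ->
  exists N : nat, (1 - 8 / k%:R) / 3 - eps <=
    uniform_turan_density R (inadmissible_family k N) <= (1 - k%:R ^- 2 / 2) / 3.
Proof.
move=> k0 eps0 d0; have [N [n0 [eta [eta0 up]]]] := dense_not_locally_admissible R k0.
exists N; rewrite /uniform_turan_density; set S := [set d : R | _]%classic.
have kR : 0 < k%:R :> R by rewrite ltr0n.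
have K0 : 0 <= (k%:R ^- 2 : R) by rewrite invr_ge0 exprn_ge0.
have low : S ((1 - 8 / k%:R) / 3 - eps).
  have k8 : 0 < 8 / k%:R :> R by rewrite divr_gt0.
  split; first by rewrite d0 /=; lra.
  move=> e n e0; have [V [E [E3 Vn adm dense]]] := exists_dense_admissible n k0 e0 eps0 d0 (lexx _).
  by have [G [h1 h2 h3]] := three_graph_of_dense E3 Vn adm dense; exists G.
have ub d : S d -> d <= (1 - k%:R ^- 2 / 2) / 3.
  move=> [_ hd]; rewrite leNgt; apply/negP => lt_d.
  (* A density in [S] is realised for every [eta] and [n0], in particular for those of the upper
     bound. *)
  have [G [Gn free dense]] := hd eta n0 eta0.
  apply: (up _ (edges G)).
  - by move=> e eE; have /forall_inP/(_ e eE)/eqP := edges_card G.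
  - by rewrite card_ord.
  - by move=> W WN; exact: free_admissible free WN.
  rewrite card_ord => U hU; apply: le_trans (dense U hU).
  by rewrite ler_wpM2r // ltW.
apply/andP; split; last by apply: ge_sup; [exists ((1 - 8 / k%:R) / 3 - eps)|].
by apply: ub_le_sup => //; exists ((1 - k%:R ^- 2 / 2) / 3) => d; exact: ub.
Qed.

Local Open Scope classical_set_scope.

Theorem corollary8p4 (R : realType) :
  limit_point
    [set uniform_turan_density R F | F in [set F : set three_graph | finite_set F]]
    (3^-1 : R).
Proof.
move=> U /nbhs_ballP[e /= e0 eU].
(* The minimum with 1/3 keeps the lower bound nonnegative: with [8 / k <= a / 4] it is at least
   [1/3 - a/12 - a/4 = (1 - a) / 3]. This is also within [a / 3 < e] of 1/3. *)
pose a : R := Num.min e 3^-1.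
have a0 : 0 < a by rewrite lt_min e0 invr_gt0 ltr0n.
have ae : a <= e by rewrite ge_min lexx.
have a3 : a <= 3^-1 by rewrite ge_min lexx orbT.
pose k := (Num.bound (32 / a)).+1.
have kR : 0 < k%:R :> R by rewrite ltr0n.
have k0 : (0 < k)%N by [].
have ka : 8 / k%:R <= a / 4.
  rewrite ler_pdivrMr // mulrC -ler_pdivrMr ?divr_gt0 //.
  have -> : 8 / (a / 4) = 32 / a by field; rewrite gt_eqF.
  apply: le_trans (ltW (archi_boundP _)) _; first by rewrite divr_ge0 // ltW.
  by rewrite ler_nat.
have a4 : 0 < a / 4 by rewrite divr_gt0.
have low0 : 0 <= (1 - 8 / k%:R) / 3 - a / 4 by lra.
have [N /andP[lo hi]] := turan_density_bounds k0 a4 low0.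
have K0 : 0 < (k%:R ^- 2 : R) by rewrite invr_gt0 exprn_gt0.
exists (uniform_turan_density R (inadmissible_family k N)); split.
(* A limit point needs values different from 1/3; the gap [k%:R ^- 2 / 6] in the upper bound makes
   the inequality strict. *)
- by rewrite lt_eqF //; lra.
- by exists (inadmissible_family k N) => //; exact: finite_inadmissible_family.
apply: eU; rewrite /ball /= ger0_norm; lra.
Qed.
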